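(* There exist a Riemannian metric $g$ on the $2$-dimensional torus $\mathbb{T}^2$ and a sequence $(\phi_i)_{i\ge 1}$ of eigenfunctions of the Laplace--Beltrami operator $\Delta_g$, with $\Delta_g\phi_i+\lambda_i\phi_i=0$ and $\lambda_i\to\infty$ as $i\to\infty$, such that each $\phi_i$ has infinitely many isolated critical points on $\mathbb{T}^2$.
   Context: Riemannian metrics are smooth ($C^\infty$). Eigenfunctions are smooth, real-valued and not identically zero. The sign convention is that $\phi$ is an eigenfunction with eigenvalue $\lambda\ge 0$ if $\Delta_g\phi+\lambda\phi=0$. A critical point of $\phi$ is a point where $d\phi=0$; it is isolated if it has a neighbourhood containing no other critical point of $\phi$. *)

(* Defs.v *)
(* Stdlib real numbers with Coquelicot.

   The torus T^2 is R^2 / Z^2.  Points of T^2 are represented by pairs of reals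
   up to [same_point]; smooth functions on T^2 are the smooth Z^2-periodic
   functions on R^2.  The tangent bundle of T^2 is trivialized by the coordinate
   fields d/dx, d/dy, so a Riemannian metric on T^2 is given by its three
   coefficients g11, g12 = g21, g22, which are smooth functions on T^2. *)
From Stdlib Require Import Reals List.
From Coquelicot Require Import Coquelicot.
Open Scope R_scope.

Definition same_point (p q : R * R) : Prop :=
  exists m n : Z, fst q = fst p + IZR m /\ snd q = snd p + IZR n.

Definition periodic (f : R -> R -> R) : Prop :=
  forall x y, f (x + 1) y = f x y /\ f x (y + 1) = f x y.

(* [ex_diff_n f n x y] says that all iterated partial derivatives of f of order
   at most n exist and are continuous at (x, y). *)
Definition smooth (f : R -> R -> R) : Prop :=
  forall (n : nat) (x y : R), ex_diff_n f n x y.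

Definition smooth_on_torus (f : R -> R -> R) : Prop :=
  smooth f /\ periodic f.

Record torus_metric := {
  g11 : R -> R -> R;
  g12 : R -> R -> R;
  g22 : R -> R -> R;
  g11_smooth : smooth_on_torus g11;
  g12_smooth : smooth_on_torus g12;
  g22_smooth : smooth_on_torus g22;
  g_posdef : forall x y u v, (u, v) <> (0, 0) ->
    0 < g11 x y * u ^ 2 + 2 * g12 x y * u * v + g22 x y * v ^ 2
}.

Definition d1 (f : R -> R -> R) (x y : R) : R := Derive (fun t => f t y) x.
Definition d2 (f : R -> R -> R) (x y : R) : R := Derive (fun t => f x t) y.

Definition det_g (g : torus_metric) (x y : R) : R :=
  g11 g x y * g22 g x y - g12 g x y ^ 2.

(* Contravariant components of the gradient: (grad f)^i = g^{ij} d_j f, where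
   (g^{ij}) is the inverse of the matrix (g_{ij}). *)
Definition grad1 (g : torus_metric) (f : R -> R -> R) (x y : R) : R :=
  g22 g x y / det_g g x y * d1 f x y + - g12 g x y / det_g g x y * d2 f x y.
Definition grad2 (g : torus_metric) (f : R -> R -> R) (x y : R) : R :=
  - g12 g x y / det_g g x y * d1 f x y + g11 g x y / det_g g x y * d2 f x y.

(* Delta_g f = (det g)^(-1/2) d_i ((det g)^(1/2) g^{ij} d_j f) *)
Definition laplace_beltrami (g : torus_metric) (f : R -> R -> R) (x y : R) : R :=
  / sqrt (det_g g x y) *
  (d1 (fun s t => sqrt (det_g g s t) * grad1 g f s t) x y +
   d2 (fun s t => sqrt (det_g g s t) * grad2 g f s t) x y).

Definition eigenfunction (g : torus_metric) (lam : R) (f : R -> R -> R) : Prop :=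
  smooth_on_torus f /\
  (exists x y, f x y <> 0) /\
  0 <= lam /\
  (forall x y, laplace_beltrami g f x y + lam * f x y = 0).

Definition critical_point (f : R -> R -> R) (p : R * R) : Prop :=
  d1 f (fst p) (snd p) = 0 /\ d2 f (fst p) (snd p) = 0.

Definition isolated_critical_point (f : R -> R -> R) (p : R * R) : Prop :=
  critical_point f p /\
  locally_2d (fun x y => critical_point f (x, y) -> same_point p (x, y))
             (fst p) (snd p).

(* The subset of T^2 described by A is infinite: no finite list of points
   contains all of it.  Points are counted modulo Z^2. *)
Definition infinite_on_torus (A : R * R -> Prop) : Prop :=
  forall l : list (R * R),
    exists p, A p /\ forall q, In q l -> ~ same_point q p.

(* Main.v *)
From Stdlib Require Import Reals Factorial Compare_dec Lra Lia List.
From Stdlib Require Import Classical ClassicalEpsilon FunctionalExtensionality.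
From Coquelicot Require Import Coquelicot.
Require Import Defs.
Open Scope R_scope.

(** Let U be even and 1-periodic with 1 + U > 0, and give the torus the metric
    (1 + U(x)) (dx^2 + dy^2).  For k in 2 pi Z the function f(x) cos(k y) is an
    eigenfunction with eigenvalue k^2 exactly when f'' = - k^2 U f and f is
    1-periodic.  The eigenvalue is tied to k so that all these equations share
    the coefficient U, up to the factor k^2: one place where U degenerates then
    serves all frequencies at once.

    That place is x = 0.  On the blocks [2^-(m+4), 2^-(m+3)] the function U is a
    bump of sign (-1)^m, each so much smaller than the preceding one that the
    sum is smooth and that each block outweighs all the blocks nearer to 0.  If
    f(0) = 1 and f'(0) = 0 then f' = - k^2 int_0^x U f changes sign inside every
    block close enough to 0; there U does not vanish, so f'' does not either,
    the zero of f' is simple, and it gives an isolated critical point on the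
    line y = 0 ([derivative_zeros], [separated_isolated]).

    As U is symmetric about 0 and about 1/2, a solution with f'(0) = f'(1/2) = 0
    is symmetric about both points and hence 1-periodic.  What remains is to
    choose U so that f'(1/2) = 0 for infinitely many k.  Write f = rho cos theta
    and f' = - k rho sin theta; the phase theta solves the first order equation
    theta' = k (1 + (U - 1) cos^2 theta) with theta(0) = 0, and the requirement
    is sin theta(1/2) = 0.  On [1/4, 1/2] start from U = 1 and modify it on
    successive intervals that accumulate at 1/2.  The n-th modification w leaves
    the exit phases of the frequencies k_0, ..., k_(n-1) already treated
    unchanged and creates a new good frequency k_n ([block_perturbation]):

    - for small w, the exit phase of k_j moves by k_j int w cos^2(k_j x + psi_j)
      up to a quadratic error ([phase_response]).  With test functions dual to 1
      and to the cos(2 k_j x + 2 psi_j) ([dual_functions]), a fixed point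
      argument gives a family w_s, Lipschitz in s, which moves none of these
      phases although int w_s = s ([fixed_point_family]);
    - a high frequency k is moved by about k s / 2 ([phase_gain]); when this
      exceeds pi, the intermediate value theorem gives an s for which the phase
      of k is adjusted exactly.

    Later modifications do not disturb the phases at the ends of the later
    intervals, so by continuity sin theta(1/2) = 0 survives in the limit. *)

(** * Smooth functions of one variable *)

Fixpoint diffn (n : nat) (f : R -> R) : Prop :=
  match n with
  | O => True
  | S n => (forall x, ex_derive f x) /\ diffn n (Derive f)
  end.

Definition smooth1 (f : R -> R) : Prop := forall n, diffn n f.

(** One constant for the function and for its first n derivatives: smallness
    in C^n, as needed to sum a series of perturbations. *)
Fixpoint norm_le (n : nat) (M : R) (f : R -> R) : Prop :=
  (forall x, Rabs (f x) <= M) /\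
  match n with
  | O => True
  | S n => (forall x, ex_derive f x) /\ norm_le n M (Derive f)
  end.

Lemma Derive_fun (f f' : R -> R) :
  (forall x, is_derive f x (f' x)) -> Derive f = f'.
Proof.
  intros H; apply functional_extensionality; intros x.
  now apply is_derive_unique.
Qed.

Lemma diffn_intro n f f' :
  (forall x, is_derive f x (f' x)) -> diffn n f' -> diffn (S n) f.
Proof.
  intros H H'; split.
  - intros x; eexists; apply H.
  - now rewrite (Derive_fun _ _ H).
Qed.

Lemma diffn_S n f : diffn (S n) f -> diffn n f.
Proof.
  revert f; induction n as [|n IH]; intros f H; [exact I|].
  destruct H as [H1 H2]; split; [exact H1|]. now apply IH.
Qed.

Lemma smooth1_derive f x : smooth1 f -> is_derive f x (Derive f x).
Proof. intros H; apply Derive_correct, (H 1%nat). Qed.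

Lemma smooth1_Derive f : smooth1 f -> smooth1 (Derive f).
Proof. intros H n; apply (H (S n)). Qed.

Lemma smooth1_continuous f x : smooth1 f -> continuous f x.
Proof.
  intros H; apply (ex_derive_continuous f x); exists (Derive f x).
  now apply smooth1_derive.
Qed.

Lemma diffn_const n c : diffn n (fun _ => c).
Proof.
  revert c; induction n as [|n IH]; intros c; [exact I|].
  apply diffn_intro with (fun _ => 0); [|apply IH].
  intros x; apply (is_derive_const c x).
Qed.

Lemma diffn_plus n f g : diffn n f -> diffn n g -> diffn n (fun x => f x + g x).
Proof.
  revert f g; induction n as [|n IH]; intros f g Hf Hg; [exact I|].
  apply diffn_intro with (fun x => Derive f x + Derive g x).
  - intros x; apply (is_derive_plus f g x); apply Derive_correct; [apply Hf|apply Hg].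
  - apply IH; [apply Hf|apply Hg].
Qed.

Lemma diffn_mult n f g : diffn n f -> diffn n g -> diffn n (fun x => f x * g x).
Proof.
  revert f g; induction n as [|n IH]; intros f g Hf Hg; [exact I|].
  apply diffn_intro with (fun x => Derive f x * g x + f x * Derive g x).
  - intros x; apply (is_derive_mult f g x); try (apply Derive_correct; [apply Hf|apply Hg]).
    + apply Derive_correct, Hf.
    + apply Derive_correct, Hg.
    + intros; apply Rmult_comm.
  - apply diffn_plus; apply IH; try apply Hf; try apply Hg; now apply diffn_S.
Qed.

Lemma diffn_affine n f u v : diffn n f -> diffn n (fun x => f (u * x + v)).
Proof.
  revert f; induction n as [|n IH]; intros f Hf; [exact I|].
  apply diffn_intro with (fun x => u * Derive f (u * x + v)).
  - intros x.
    assert (H : is_derive f (u * x + v) (Derive f (u * x + v)))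
      by apply Derive_correct, Hf.
    evar_last.
    + apply (is_derive_comp f (fun x => u * x + v)); [exact H|].
      auto_derive; [exact I|reflexivity].
    + unfold scal; simpl; unfold mult; simpl; ring.
  - apply diffn_mult; [apply diffn_const|]. apply IH, Hf.
Qed.

Lemma smooth1_const c : smooth1 (fun _ => c).
Proof. intros n; apply diffn_const. Qed.

Lemma smooth1_plus f g : smooth1 f -> smooth1 g -> smooth1 (fun x => f x + g x).
Proof. intros Hf Hg n; now apply diffn_plus. Qed.

Lemma smooth1_mult f g : smooth1 f -> smooth1 g -> smooth1 (fun x => f x * g x).
Proof. intros Hf Hg n; now apply diffn_mult. Qed.

Lemma smooth1_affine f u v : smooth1 f -> smooth1 (fun x => f (u * x + v)).
Proof. intros Hf n; now apply diffn_affine. Qed.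

Lemma smooth1_ext f g : (forall x, f x = g x) -> smooth1 f -> smooth1 g.
Proof. intros H; now rewrite (functional_extensionality _ _ H). Qed.

Lemma smooth1_scal c f : smooth1 f -> smooth1 (fun x => c * f x).
Proof. intros Hf; apply smooth1_mult; [apply smooth1_const|exact Hf]. Qed.

Lemma smooth1_primitive f f' :
  (forall x, is_derive f x (f' x)) -> smooth1 f' -> smooth1 f.
Proof.
  intros H H' [|n]; [exact I|]. now apply diffn_intro with f'.
Qed.

(** Differentiation shifts the phase by pi / 2, so that an induction over all
    phases handles sine and cosine together. *)
Lemma smooth1_cos k c : smooth1 (fun x => cos (k * x + c)).
Proof.
  intros n; revert c; induction n as [|n IH]; intros c; [exact I|].
  apply diffn_intro with (fun x => k * cos (k * x + (c + PI / 2))).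
  - intros x; auto_derive; [exact I|].
    replace (k * x + (c + PI / 2)) with (PI / 2 + (k * x + c)) by ring.
    rewrite cos_plus, cos_PI2, sin_PI2.
    ring.
  - apply diffn_mult; [apply diffn_const|apply IH].
Qed.

Lemma smooth1_sum (f : nat -> R -> R) n :
  (forall i, smooth1 (f i)) -> smooth1 (fun x => sum_f_R0 (fun i => f i x) n).
Proof.
  intros H; induction n as [|n IH]; simpl; [apply H|].
  now apply smooth1_plus.
Qed.

(** Each derivative gained for f is gained for q f, that is, for f''. *)
Lemma smooth1_of_ode f q :
  smooth1 q -> (forall x, ex_derive f x) ->
  (forall x, is_derive (Derive f) x (q x * f x)) -> smooth1 f.
Proof.
  intros Hq H1 H2.
  assert (H : forall n, diffn n f /\ diffn (S n) f).
  { induction n as [|n [IH1 IH2]].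
    - split; [exact I|]. split; [exact H1|exact I].
    - split; [exact IH2|]. split; [exact H1|].
      apply diffn_intro with (fun x => q x * f x); [exact H2|].
      apply diffn_mult; [apply Hq|exact IH1]. }
  intros n; apply H.
Qed.

(** * Bounds on derivatives *)

Lemma norm_le_0 n M f x : norm_le n M f -> Rabs (f x) <= M.
Proof. destruct n; intros H; apply H. Qed.

Lemma norm_le_intro n M f f' :
  (forall x, Rabs (f x) <= M) -> (forall x, is_derive f x (f' x)) ->
  norm_le n M f' -> norm_le (S n) M f.
Proof.
  intros HM H H'; split; [exact HM|]. split.
  - intros x; eexists; apply H.
  - now rewrite (Derive_fun _ _ H).
Qed.

Lemma norm_le_weaken n M M' f : M <= M' -> norm_le n M f -> norm_le n M' f.
Proof.
  intros HM; revert f; induction n as [|n IH]; intros f H.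
  - split; [|exact I]. intros x; eapply Rle_trans; [apply H|exact HM].
  - destruct H as [H [H1 H2]]. split; [|split]; auto.
    intros x; eapply Rle_trans; [apply H|exact HM].
Qed.

Lemma norm_le_order n m M f : (m <= n)%nat -> norm_le n M f -> norm_le m M f.
Proof.
  revert m f; induction n as [|n IH]; intros m f Hm H.
  - now replace m with 0%nat by lia.
  - destruct m as [|m].
    + split; [apply H|exact I].
    + destruct H as [H [H1 H2]]. split; [|split]; auto. apply IH; [lia|auto].
Qed.

Lemma norm_le_plus n M1 M2 f g :
  norm_le n M1 f -> norm_le n M2 g -> norm_le n (M1 + M2) (fun x => f x + g x).
Proof.
  revert f g; induction n as [|n IH]; intros f g [Hf Hf'] [Hg Hg'].
  - split; [|exact I]. intros x; eapply Rle_trans; [apply Rabs_triang|].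
    apply Rplus_le_compat; auto.
  - apply norm_le_intro with (fun x => Derive f x + Derive g x).
    + intros x; eapply Rle_trans; [apply Rabs_triang|].
      apply Rplus_le_compat; auto.
    + intros x; apply (is_derive_plus f g x); apply Derive_correct; [apply Hf'|apply Hg'].
    + apply IH; [apply Hf'|apply Hg'].
Qed.

Lemma norm_le_scal n M c f :
  norm_le n M f -> norm_le n (Rabs c * M) (fun x => c * f x).
Proof.
  revert f; induction n as [|n IH]; intros f [Hf Hf'].
  - split; [|exact I]. intros x; rewrite Rabs_mult.
    apply Rmult_le_compat_l; [apply Rabs_pos|auto].
  - apply norm_le_intro with (fun x => c * Derive f x).
    + intros x; rewrite Rabs_mult. apply Rmult_le_compat_l; [apply Rabs_pos|auto].
    + intros x; apply (is_derive_scal f x c); apply Derive_correct; apply Hf'.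
    + apply IH, Hf'.
Qed.

Lemma norm_le_reflect n M c f :
  norm_le n M f -> norm_le n M (fun x => f (c - x)).
Proof.
  revert f; induction n as [|n IH]; intros f [Hf Hf'].
  - split; [|exact I]. auto.
  - apply norm_le_intro with (fun x => -1 * Derive f (c - x)).
    + auto.
    + intros x.
      assert (H : is_derive f (c - x) (Derive f (c - x))) by apply Derive_correct, Hf'.
      evar_last.
      * apply (is_derive_comp f (fun x => c - x)); [exact H|].
        auto_derive; [exact I|reflexivity].
      * unfold scal; simpl; unfold mult; simpl; ring.
    + replace M with (Rabs (-1) * M).
      * apply norm_le_scal. apply IH, Hf'.
      * rewrite Rabs_left by lra. ring.
Qed.

Lemma norm_le_sum (f : nat -> R -> R) (c : nat -> R) (M : nat -> R) n N :
  (forall i, (i <= n)%nat -> norm_le N (M i) (f i)) ->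
  norm_le N (sum_f_R0 (fun i => Rabs (c i) * M i) n)
    (fun x => sum_f_R0 (fun i => c i * f i x) n).
Proof.
  intros H; induction n as [|n IH]; simpl.
  - apply norm_le_scal, H; lia.
  - apply norm_le_plus; [apply IH; intros; apply H; lia|].
    apply norm_le_scal, H; lia.
Qed.

(** * Functions vanishing outside an interval *)

Definition supported (a b : R) (f : R -> R) : Prop :=
  forall x, x < a \/ b < x -> f x = 0.

Lemma locally_lt (a x : R) : x < a -> locally x (fun y => y < a).
Proof. intros H; apply (open_lt a x H). Qed.

Lemma locally_gt (a x : R) : a < x -> locally x (fun y => a < y).
Proof. intros H; apply (open_gt a x H). Qed.

Lemma supported_locally a b f x :
  supported a b f -> x < a \/ b < x -> locally x (fun y => f y = 0).
Proof.
  intros H [Hx|Hx].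
  - generalize (locally_lt _ _ Hx); apply filter_imp; auto.
  - generalize (locally_gt _ _ Hx); apply filter_imp; auto.
Qed.

Lemma supported_Derive a b f : supported a b f -> supported a b (Derive f).
Proof.
  intros H x Hx. apply is_derive_unique.
  apply is_derive_ext_loc with (fun _ => 0); [|apply (is_derive_const 0 x)].
  generalize (supported_locally _ _ _ _ H Hx); apply filter_imp; auto.
Qed.

(** The vanishing at the two end points themselves comes from continuity. *)
Lemma supported_closed a b f x :
  (forall y, continuous f y) -> supported a b f -> x <= a \/ b <= x -> f x = 0.
Proof.
  intros Hc H Hx.
  destruct (Req_dec (f x) 0) as [E|E]; [exact E|exfalso].
  assert (Hn : locally x (fun y => f y <> 0)).
  { apply (Hc x (fun z => z <> 0)). now apply open_neq. }
  destruct Hn as [e He].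
  destruct Hx as [Hx|Hx].
  - apply (He (x - e / 2)).
    + unfold ball; simpl; unfold AbsRing_ball, abs, minus, plus, opp; simpl.
      rewrite Rabs_left; pose proof (cond_pos e); lra.
    + apply H; pose proof (cond_pos e); lra.
  - apply (He (x + e / 2)).
    + unfold ball; simpl; unfold AbsRing_ball, abs, minus, plus, opp; simpl.
      rewrite Rabs_right; pose proof (cond_pos e); lra.
    + apply H; pose proof (cond_pos e); lra.
Qed.

Lemma supported_bounded a b f :
  (forall x, continuous f x) -> supported a b f -> exists M, forall x, Rabs (f x) <= M.
Proof.
  intros Hc H.
  destruct (Rle_lt_dec a b) as [Hab|Hab].
  - destruct (continuity_ab_maj (fun x => Rabs (f x)) a b Hab) as [m [Hm _]].
    + intros c _. apply continuity_pt_filterlim.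
      apply (continuous_comp f Rabs); [apply Hc|apply continuous_Rabs].
    + exists (Rabs (f m)). intros x.
      destruct (Rlt_le_dec x a); [|destruct (Rlt_le_dec b x)].
      * rewrite H, Rabs_R0 by auto. apply Rabs_pos.
      * rewrite H, Rabs_R0 by auto. apply Rabs_pos.
      * apply Hm; lra.
  - exists 0. intros x. rewrite H, Rabs_R0 by lra. lra.
Qed.

Lemma supported_norm a b f n :
  smooth1 f -> supported a b f -> exists M, 0 < M /\ norm_le n M f.
Proof.
  revert f; induction n as [|n IH]; intros f Hf Hs.
  - destruct (supported_bounded a b f) as [M HM]; auto.
    { intros x; now apply smooth1_continuous. }
    exists (Rabs M + 1). pose proof (Rabs_pos M); pose proof (Rle_abs M).
    split; [lra|]. split; [|exact I]. intros x; generalize (HM x); lra.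
  - destruct (supported_bounded a b f) as [M HM]; auto.
    { intros x; now apply smooth1_continuous. }
    destruct (IH (Derive f)) as [M' [HM' HD]].
    { now apply smooth1_Derive. }
    { now apply supported_Derive. }
    exists (Rabs M + M'). pose proof (Rabs_pos M); pose proof (Rle_abs M).
    split; [lra|]. split; [intros x; generalize (HM x); lra|].
    split; [intros x; exists (Derive f x); now apply smooth1_derive|].
    apply norm_le_weaken with M'; [lra|exact HD].
Qed.

(** * Bump functions *)

(** The functions x^-n exp(-1/x), extended by 0: derivatives of these are
    combinations of two others, so that the smoothness of exp(-1/x) at 0 becomes
    an induction over the family. *)
Definition flat_exp (n : nat) (x : R) : R :=
  if Rlt_dec 0 x then (/ x) ^ n * exp (- / x) else 0.

Lemma pow_le_exp n t : 0 <= t -> t ^ n <= INR (fact n) * exp t.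
Proof.
  revert t; induction n as [|n IH]; intros t Ht.
  - simpl. generalize (exp_ineq1_le t). lra.
  - set (h := fun t => INR (fact (S n)) * exp t - t ^ S n).
    assert (Hd : forall s, is_derive h s (INR (fact (S n)) * exp s - INR (S n) * s ^ n)).
    { intros s. unfold h. auto_derive; [exact I|].
      change (fact n + n * fact n)%nat with (fact (S n)).
      change (match n with O => 1 | S _ => INR n + 1 end) with (INR (S n)).
      generalize (INR (S n)) (INR (fact (S n))) (exp s) (s ^ n). intros. ring. }
    destruct (Req_dec t 0) as [->|Ht0].
    + rewrite pow_i by lia. rewrite exp_0. generalize (INR_fact_lt_0 (S n)). lra.
    + destruct (MVT_gen h 0 t (fun s => INR (fact (S n)) * exp s - INR (S n) * s ^ n))
        as [c [Hc E]].
      * intros; apply Hd.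
      * intros s _. apply continuity_pt_filterlim.
        apply (ex_derive_continuous h s). eexists; apply Hd.
      * rewrite Rmin_left, Rmax_right in Hc by lra.
        assert (h 0 = INR (fact (S n))).
        { unfold h. rewrite exp_0, pow_i by lia. ring. }
        assert (0 <= INR (fact (S n)) * exp c - INR (S n) * c ^ n).
        { generalize (IH c (proj1 Hc)). rewrite fact_simpl, mult_INR.
          generalize (pos_INR (S n)). intros. nra. }
        assert (0 <= h t).
        { generalize (INR_fact_lt_0 (S n)). nra. }
        unfold h in *. lra.
Qed.

(** The quadratic bound, from t^(n+2) <= (n+2)! exp t at t = 1/x, yields the
    zero derivative at the origin. *)
Lemma flat_exp_bound n x : Rabs (flat_exp n x) <= INR (fact (n + 2)) * x ^ 2.
Proof.
  unfold flat_exp; destruct (Rlt_dec 0 x) as [Hx|Hx].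
  - assert (Hi : 0 < / x) by now apply Rinv_0_lt_compat.
    rewrite Rabs_right.
    2:{ apply Rle_ge, Rmult_le_pos; [apply pow_le; lra|left; apply exp_pos]. }
    pose proof (pow_le_exp (n + 2) (/ x) (Rlt_le _ _ Hi)) as H.
    rewrite pow_add in H.
    rewrite exp_Ropp.
    pose proof (exp_pos (/ x)) as He.
    apply Rmult_le_reg_r with ((/ x) ^ 2 * exp (/ x)).
    { apply Rmult_lt_0_compat; [apply pow_lt|]; lra. }
    replace ((/ x) ^ n * / exp (/ x) * ((/ x) ^ 2 * exp (/ x)))
      with ((/ x) ^ n * (/ x) ^ 2) by (field; split; lra).
    replace (INR (fact (n + 2)) * x ^ 2 * ((/ x) ^ 2 * exp (/ x)))
      with (INR (fact (n + 2)) * exp (/ x)) by (field; lra).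
    exact H.
  - rewrite Rabs_R0. apply Rmult_le_pos; [apply pos_INR|nra].
Qed.

Lemma flat_exp_derive (n : nat) (x : R) :
  is_derive (flat_exp n) x (flat_exp (n + 2) x - INR n * flat_exp (n + 1) x).
Proof.
  destruct (Rtotal_order x 0) as [Hx|[Hx|Hx]].
  - apply is_derive_ext_loc with (fun _ => 0).
    + generalize (locally_lt _ _ Hx). apply filter_imp. intros y Hy.
      unfold flat_exp; destruct (Rlt_dec 0 y); [lra|reflexivity].
    + evar_last; [apply (is_derive_const 0 x)|].
      unfold flat_exp; destruct (Rlt_dec 0 x); [lra|]. unfold zero; simpl; ring.
  - subst x. evar_last.
    + apply is_derive_Reals. intros eps Heps.
      set (C := INR (fact (n + 2))).
      assert (HC : 0 < C) by apply INR_fact_lt_0.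
      assert (Hd : 0 < eps / (2 * C)) by (apply Rdiv_lt_0_compat; lra).
      exists (mkposreal _ Hd). simpl. intros h Hh Hh2.
      instantiate (1 := 0).
      rewrite Rplus_0_l, Rminus_0_r.
      replace (flat_exp n 0) with 0.
      2:{ unfold flat_exp; destruct (Rlt_dec 0 0); [lra|reflexivity]. }
      rewrite Rminus_0_r. unfold Rdiv. rewrite Rabs_mult, Rabs_inv.
      apply Rmult_lt_reg_r with (Rabs h); [now apply Rabs_pos_lt|].
      rewrite Rmult_assoc, Rinv_l, Rmult_1_r by (now apply Rabs_no_R0).
      eapply Rle_lt_trans; [apply flat_exp_bound|]. fold C.
      rewrite <- pow2_abs. assert (0 < Rabs h) by now apply Rabs_pos_lt.
      assert (E : C * Rabs h < C * (eps / (2 * C))) by (apply Rmult_lt_compat_l; lra).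
      replace (C * (eps / (2 * C))) with (eps / 2) in E by (field; lra). nra.
    + unfold flat_exp; destruct (Rlt_dec 0 0); [lra|]. ring.
  - apply is_derive_ext_loc with (fun y => (/ y) ^ n * exp (- / y)).
    + generalize (locally_gt _ _ Hx). apply filter_imp. intros y Hy.
      unfold flat_exp; destruct (Rlt_dec 0 y); [reflexivity|lra].
    + unfold flat_exp; destruct (Rlt_dec 0 x); [|lra].
      auto_derive; [lra|].
      rewrite !pow_add. destruct n as [|n]; [simpl; field; lra|].
      replace (Init.Nat.pred (S n)) with n by reflexivity.
      rewrite <- !tech_pow_Rmult. simpl (_ ^ 1). simpl (_ ^ 2). field. lra.
Qed.

Lemma flat_exp_smooth n : smooth1 (flat_exp n).
Proof.
  intros N; revert n; induction N as [|N IH]; intros n; [exact I|].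
  apply diffn_intro with (fun x => flat_exp (n + 2) x + - INR n * flat_exp (n + 1) x).
  - intros x. replace (_ + - INR n * flat_exp (n + 1) x)
      with (flat_exp (n + 2) x - INR n * flat_exp (n + 1) x) by ring.
    apply flat_exp_derive.
  - apply diffn_plus; [apply IH|]. apply diffn_mult; [apply diffn_const|apply IH].
Qed.

Definition bump (a b x : R) : R := flat_exp 0 (x - a) * flat_exp 0 (b - x).

Lemma bump_smooth a b : smooth1 (bump a b).
Proof.
  unfold bump. apply smooth1_mult.
  - apply smooth1_ext with (fun x => flat_exp 0 (1 * x + - a)).
    { intros x; f_equal; ring. }
    apply (smooth1_affine (flat_exp 0)), flat_exp_smooth.
  - apply smooth1_ext with (fun x => flat_exp 0 (-1 * x + b)).
    { intros x; f_equal; ring. }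
    apply (smooth1_affine (flat_exp 0)), flat_exp_smooth.
Qed.

Lemma bump_supported a b : supported a b (bump a b).
Proof.
  intros x Hx. unfold bump, flat_exp.
  destruct (Rlt_dec 0 (x - a)); destruct (Rlt_dec 0 (b - x)); try lra; ring.
Qed.

Lemma bump_pos a b x : a < x < b -> 0 < bump a b x.
Proof.
  intros Hx. unfold bump, flat_exp.
  destruct (Rlt_dec 0 (x - a)); [|lra]; destruct (Rlt_dec 0 (b - x)); [|lra].
  simpl. rewrite !Rmult_1_l. apply Rmult_lt_0_compat; apply exp_pos.
Qed.

Lemma bump_nonneg a b x : 0 <= bump a b x.
Proof.
  unfold bump, flat_exp.
  destruct (Rlt_dec 0 (x - a)); destruct (Rlt_dec 0 (b - x)); try lra.
  simpl. rewrite !Rmult_1_l. left; apply Rmult_lt_0_compat; apply exp_pos.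
Qed.

Lemma bump_le_1 a b x : bump a b x <= 1.
Proof.
  assert (H : forall y, 0 <= flat_exp 0 y <= 1).
  { intros y; unfold flat_exp; destruct (Rlt_dec 0 y); [|lra].
    simpl; rewrite Rmult_1_l. split; [left; apply exp_pos|].
    rewrite <- exp_0. left; apply exp_increasing.
    assert (0 < / y) by now apply Rinv_0_lt_compat. lra. }
  unfold bump. generalize (H (x - a)) (H (b - x)). nra.
Qed.

Lemma choose_fun (A B : Type) (P : A -> B -> Prop) :
  (forall x, exists y, P x y) -> exists f, forall x, P x (f x).
Proof.
  intros H. exists (fun x => proj1_sig (constructive_indefinite_description _ (H x))).
  intros x. apply proj2_sig.
Qed.

(** * Series of smooth functions *)

Lemma derive_bound_lip (g g' : R -> R) B a b :
  a <= b -> (forall x, a <= x <= b -> is_derive g x (g' x)) ->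
  (forall x, a <= x <= b -> Rabs (g' x) <= B) ->
  Rabs (g b - g a) <= B * (b - a).
Proof.
  intros Hab Hd HB.
  destruct (MVT_gen g a b g') as [c [Hc E]].
  - rewrite Rmin_left, Rmax_right by lra. intros; apply Hd; lra.
  - rewrite Rmin_left, Rmax_right by lra. intros x Hx. apply continuity_pt_filterlim.
    apply (ex_derive_continuous g x). eexists; apply Hd; lra.
  - rewrite Rmin_left, Rmax_right in Hc by lra.
    rewrite E, Rabs_mult, (Rabs_right (b - a)) by lra.
    apply Rmult_le_compat_r; [lra|now apply HB].
Qed.

Lemma derive_bound_lip_abs (g g' : R -> R) B x y :
  (forall x, is_derive g x (g' x)) -> (forall x, Rabs (g' x) <= B) ->
  Rabs (g y - g x) <= B * Rabs (y - x).
Proof.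
  intros Hd HB. destruct (Rle_dec x y) as [H|H].
  - rewrite (Rabs_right (y - x)) by lra. apply derive_bound_lip with g'; auto.
  - rewrite (Rabs_left (y - x)), Rabs_minus_sym by lra.
    replace (- (y - x)) with (x - y) by ring.
    apply derive_bound_lip with g'; auto; lra.
Qed.

Lemma taylor_bound (g g' g'' : R -> R) B x y :
  (forall x, is_derive g x (g' x)) -> (forall x, is_derive g' x (g'' x)) ->
  (forall x, Rabs (g'' x) <= B) ->
  Rabs (g y - g x - g' x * (y - x)) <= B * (y - x) ^ 2.
Proof.
  intros H1 H2 HB.
  destruct (MVT_gen (fun t => g t - g' x * t) x y (fun t => g' t - g' x))
    as [c [Hc E]].
  - intros t _. apply (is_derive_minus g (fun t => g' x * t)); [apply H1|].
    auto_derive; [exact I|ring].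
  - intros t _. apply continuity_pt_filterlim.
    apply (ex_derive_continuous (fun t => g t - g' x * t) t).
    exists (g' t - g' x). apply (is_derive_minus g (fun t => g' x * t)); [apply H1|].
    auto_derive; [exact I|ring].
  - replace (g y - g x - g' x * (y - x)) with ((g' c - g' x) * (y - x)) by (rewrite <- E; ring).
    rewrite Rabs_mult.
    pose proof (derive_bound_lip_abs g' g'' B x c H2 HB) as H.
    assert (Hcx : Rabs (c - x) <= Rabs (y - x)).
    { unfold Rmin, Rmax in Hc; destruct (Rle_dec x y);
      unfold Rabs; destruct (Rcase_abs (c - x)); destruct (Rcase_abs (y - x)); lra. }
    assert (0 <= B) by (eapply Rle_trans; [apply Rabs_pos|apply (HB x)]).
    rewrite <- pow2_abs. pose proof (Rabs_pos (y - x)).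
    pose proof (Rabs_pos (c - x)).
    apply Rle_trans with (B * Rabs (c - x) * Rabs (y - x)).
    + apply Rmult_le_compat_r; auto.
    + replace (B * Rabs (y - x) ^ 2) with (B * Rabs (y - x) * Rabs (y - x)) by ring.
      apply Rmult_le_compat_r; auto. apply Rmult_le_compat_l; auto.
Qed.

Lemma is_series_half A : is_series (fun m => A * (1 / 2) ^ m) (2 * A).
Proof.
  replace (2 * A) with (A * / (1 - 1 / 2)) by field.
  apply (is_series_scal A (fun m => (1 / 2) ^ m)).
  apply is_series_geom. rewrite Rabs_right; lra.
Qed.

Lemma ex_series_half (u : nat -> R) A :
  (forall m, Rabs (u m) <= A * (1 / 2) ^ m) -> ex_series u.
Proof.
  intros H. apply (ex_series_le u (fun m => A * (1 / 2) ^ m)); [exact H|].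
  eexists; apply is_series_half.
Qed.

Lemma Series_half_bound (u : nat -> R) A :
  (forall m, Rabs (u m) <= A * (1 / 2) ^ m) -> Rabs (Series u) <= 2 * A.
Proof.
  intros H.
  assert (E : ex_series (fun m => Rabs (u m))).
  { apply ex_series_half with A. intros m; rewrite Rabs_Rabsolu; apply H. }
  eapply Rle_trans; [now apply Series_Rabs|].
  rewrite <- (is_series_unique _ _ (is_series_half A)).
  apply Series_le; [|eexists; apply is_series_half].
  intros m; split; [apply Rabs_pos|apply H].
Qed.

Lemma geometric_limit (u : nat -> R) A :
  (forall n, Rabs (u (S n) - u n) <= A * (1 / 2) ^ n) ->
  exists l : R, is_lim_seq u l /\ forall n, Rabs (l - u n) <= 2 * A * (1 / 2) ^ n.
Proof.
  intros H.
  set (l := u 0%nat + Series (fun n => u (S n) - u n)).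
  assert (L : is_lim_seq u l).
  { apply is_lim_seq_incr_1.
    apply is_lim_seq_ext with (fun n => u 0%nat + sum_n (fun n => u (S n) - u n) n).
    - intros n. rewrite sum_n_Reals. induction n as [|n IH]; [simpl; ring|].
      rewrite tech5, <- Rplus_assoc, IH. ring.
    - apply (is_lim_seq_plus' (fun _ => u 0%nat)); [apply is_lim_seq_const|].
      apply Series_correct. now apply ex_series_half with A. }
  exists l. split; [exact L|]. intros n.
  assert (HA : 0 <= A).
  { generalize (H 0%nat) (Rabs_pos (u 1%nat - u 0%nat)). simpl. lra. }
  assert (B : forall p, Rabs (u (p + n)%nat - u n) <= 2 * A * (1 / 2) ^ n).
  { intros p.
    assert (B : Rabs (u (p + n)%nat - u n) <= 2 * A * (1 / 2) ^ n - 2 * A * (1 / 2) ^ (p + n)).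
    { induction p as [|p IH].
      - simpl. rewrite Rminus_diag, Rabs_R0. lra.
      - replace (u (S p + n)%nat - u n) with
          ((u (S (p + n)) - u (p + n)%nat) + (u (p + n)%nat - u n)) by (simpl; ring).
        eapply Rle_trans; [apply Rabs_triang|].
        generalize (H (p + n)%nat) IH. simpl. lra. }
    assert (0 < (1 / 2) ^ (p + n)) by (apply pow_lt; lra). nra. }
  apply (is_lim_seq_le (fun p => Rabs (u (p + n)%nat - u n)) (fun _ => 2 * A * (1 / 2) ^ n)
    (Rabs (l - u n)) (2 * A * (1 / 2) ^ n)).
  - exact B.
  - apply (is_lim_seq_abs _ (l - u n)).
    apply is_lim_seq_minus'; [|apply is_lim_seq_const].
    now apply is_lim_seq_incr_n with (u := u).
  - apply is_lim_seq_const.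
Qed.

(** With one derivative more than the one to be computed under bounded control,
    Taylor's remainder is at most A 2^-m h^2 for the m-th term.  These bounds add
    up, so the series can be differentiated term by term. *)
Lemma Series_diffn (w : nat -> R -> R) A n :
  (forall m, norm_le (n + 2) (A * (1 / 2) ^ m) (w m)) ->
  diffn n (fun x => Series (fun m => w m x)).
Proof.
  revert w; induction n as [|n IH]; intros w H; [exact I|].
  apply diffn_intro with (fun x => Series (fun m => Derive (w m) x)).
  2:{ apply IH. intros m; apply (H m). }
  assert (B0 : forall x m, Rabs (w m x) <= A * (1 / 2) ^ m).
  { intros x m; apply (H m). }
  assert (B1 : forall x m, Rabs (Derive (w m) x) <= A * (1 / 2) ^ m).
  { intros x m. destruct (H m) as [_ [_ H1]]. exact (norm_le_0 _ _ _ x H1). }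
  assert (B2 : forall x m, Rabs (Derive (Derive (w m)) x) <= A * (1 / 2) ^ m).
  { intros x m. destruct (H m) as [_ [_ H1]]. change (norm_le (n + 2) (A * (1 / 2) ^ m) (Derive (w m))) in H1.
    replace (n + 2)%nat with (S (S n)) in H1 by lia.
    destruct H1 as [_ [_ H1]]. exact (norm_le_0 _ _ _ x H1). }
  assert (D1 : forall m x, is_derive (w m) x (Derive (w m) x)).
  { intros m x. apply Derive_correct. apply (H m). }
  assert (D2 : forall m x, is_derive (Derive (w m)) x (Derive (Derive (w m)) x)).
  { intros m x. apply Derive_correct. destruct (H m) as [_ [_ H1]].
    change (norm_le (n + 2) (A * (1 / 2) ^ m) (Derive (w m))) in H1.
    replace (n + 2)%nat with (S (S n)) in H1 by lia. apply H1. }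
  assert (HA : 0 <= A).
  { generalize (B0 0 0%nat) (Rabs_pos (w 0%nat 0)). simpl. lra. }
  intros x. apply is_derive_Reals. intros eps Heps.
  assert (Hd : 0 < eps / (2 * A + 1)) by (apply Rdiv_lt_0_compat; lra).
  exists (mkposreal _ Hd). simpl. intros h Hh Hh2.
  assert (E : Series (fun m => w m (x + h)) - Series (fun m => w m x)
     - h * Series (fun m => Derive (w m) x)
    = Series (fun m => w m (x + h) - w m x - h * Derive (w m) x)).
  { assert (X : forall y, ex_series (fun m => w m y)).
    { intros y; apply ex_series_half with A; auto. }
    rewrite <- Series_scal_l, <- (Series_minus _ _ (X _) (X _)), <- Series_minus.
    - reflexivity.
    - apply (ex_series_minus (fun m => w m (x + h)) (fun m => w m x)); apply X.
    - apply (ex_series_scal h (fun m => Derive (w m) x)). apply ex_series_half with A; auto. }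
  assert (F : Rabs (Series (fun m => w m (x + h) - w m x - h * Derive (w m) x)) <= 2 * (A * h ^ 2)).
  { apply Series_half_bound. intros m.
    replace (A * h ^ 2 * (1 / 2) ^ m) with (A * (1 / 2) ^ m * (x + h - x) ^ 2) by ring.
    replace (h * Derive (w m) x) with (Derive (w m) x * (x + h - x)) by ring.
    apply taylor_bound with (Derive (Derive (w m))); auto. }
  rewrite <- E in F.
  assert (Hp : 0 < Rabs h) by now apply Rabs_pos_lt.
  apply Rmult_lt_reg_r with (Rabs h); [exact Hp|].
  rewrite <- Rabs_mult.
  replace (((Series (fun m => w m (x + h)) - Series (fun m => w m x)) / h -
    Series (fun m => Derive (w m) x)) * h) with
   (Series (fun m => w m (x + h)) - Series (fun m => w m x)
     - h * Series (fun m => Derive (w m) x)) by (field; exact Hh).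
  eapply Rle_lt_trans; [exact F|].
  rewrite <- pow2_abs.
  assert (G : (2 * A + 1) * Rabs h < eps).
  { apply Rmult_lt_reg_r with (/ (2 * A + 1)); [apply Rinv_0_lt_compat; lra|].
    replace ((2 * A + 1) * Rabs h * / (2 * A + 1)) with (Rabs h) by (field; lra). exact Hh2. }
  nra.
Qed.

(** The m-th term is controlled only up to order m; for a given order n the
    terms that are not controlled are finitely many, and each of them is smooth. *)
Lemma Series_smooth (w : nat -> R -> R) A :
  (forall m, smooth1 (w m)) ->
  (forall m, norm_le m (A * (1 / 2) ^ m) (w m)) ->
  smooth1 (fun x => Series (fun m => w m x)).
Proof.
  intros Hs H n.
  assert (E : (fun x => Series (fun m => w m x)) =
    (fun x => sum_f_R0 (fun m => w m x) (n + 1) +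
              Series (fun m => w (m + (n + 2))%nat x))).
  { apply functional_extensionality; intros x.
    rewrite (Series_incr_n _ (n + 2)).
    - replace (Init.Nat.pred (n + 2)) with (n + 1)%nat by lia. f_equal.
      apply Series_ext. intros m; f_equal; lia.
    - lia.
    - apply ex_series_half with A. intros m; now apply norm_le_0 with m. }
  rewrite E. apply diffn_plus; [now apply smooth1_sum|].
  apply Series_diffn with A. intros m.
  assert (HA : 0 <= A).
  { generalize (norm_le_0 _ _ _ 0 (H 0%nat)) (Rabs_pos (w 0%nat 0)). simpl. lra. }
  apply norm_le_order with (m + (n + 2))%nat; [lia|].
  apply norm_le_weaken with (A * (1 / 2) ^ (m + (n + 2))); [|apply H].
  apply Rmult_le_compat_l; [exact HA|].
  rewrite pow_add. assert (0 < (1 / 2) ^ m) by (apply pow_lt; lra).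
  assert ((1 / 2) ^ (n + 2) <= 1 ^ (n + 2)) by (apply pow_incr; lra).
  rewrite pow1 in *. nra.
Qed.

(** Used for sums of functions with disjoint supports, of which at most one is
    nonzero at a given point. *)
Lemma Series_single (u : nat -> R) m0 :
  (forall m, m <> m0 -> u m = 0) -> Series u = u m0.
Proof.
  intros H. apply is_series_unique.
  apply (is_lim_seq_ext_loc (fun _ => u m0) _ (u m0)); [|apply is_lim_seq_const].
  exists m0. intros n Hn. rewrite sum_n_Reals.
  induction n as [|n IH].
  - replace m0 with 0%nat by lia. reflexivity.
  - simpl. destruct (Nat.eq_dec m0 (S n)) as [->|E].
    + rewrite sum_eq_R0; [ring|]. intros; apply H; lia.
    + rewrite <- IH by lia. rewrite (H (S n)) by lia. ring.
Qed.

Lemma Series_zero (u : nat -> R) : (forall m, u m = 0) -> Series u = 0.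
Proof. intros H. rewrite (Series_single u 0%nat); auto. Qed.

(** * Periodization *)

Definition frac (x : R) : R := x - IZR (Int_part x).

Lemma frac_bounds x : 0 <= frac x < 1.
Proof. unfold frac. generalize (base_Int_part x). lra. Qed.

Lemma frac_eq x n : IZR n <= x < IZR n + 1 -> frac x = x - IZR n.
Proof.
  intros H. unfold frac. do 2 f_equal.
  generalize (base_Int_part x). intros [H1 H2].
  assert (IZR (Int_part x) < IZR (n + 1)) by (rewrite plus_IZR; lra).
  assert (IZR n < IZR (Int_part x + 1)) by (rewrite plus_IZR; lra).
  apply lt_IZR in H0. apply lt_IZR in H3. lia.
Qed.

Lemma frac_id x : 0 <= x < 1 -> frac x = x.
Proof. intros H. rewrite (frac_eq x 0) by (simpl; lra). simpl; ring. Qed.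

Lemma frac_add1 x : frac (x + 1) = frac x.
Proof.
  rewrite (frac_eq (x + 1) (Int_part x + 1)).
  - unfold frac. rewrite plus_IZR. ring.
  - rewrite plus_IZR. generalize (base_Int_part x). lra.
Qed.

Lemma frac_opp x : frac x <> 0 -> frac (- x) = 1 - frac x.
Proof.
  intros H. rewrite (frac_eq (- x) (- Int_part x - 1)).
  - unfold frac. rewrite minus_IZR, opp_IZR. ring.
  - rewrite minus_IZR, opp_IZR. generalize (frac_bounds x). unfold frac in *. lra.
Qed.

Lemma frac_opp_0 x : frac x = 0 -> frac (- x) = 0.
Proof.
  unfold frac at 1; intros H. rewrite (frac_eq (- x) (- Int_part x)); rewrite opp_IZR; lra.
Qed.

(** The only doubtful points are the integers, where the fractional part jumps;
    near them h vanishes. *)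
Lemma periodize_derive (h : R -> R) (a b x : R) :
  smooth1 h -> 0 < a -> b < 1 -> supported a b h ->
  is_derive (fun x => h (frac x)) x (Derive h (frac x)).
Proof.
  intros Hh Ha Hb Hs.
  destruct (Req_dec (frac x) 0) as [E|E].
  - (* near an integer the function vanishes *)
    rewrite E. rewrite (supported_Derive a b h Hs 0) by lra.
    apply is_derive_ext_loc with (fun _ => 0); [|apply (is_derive_const 0 x)].
    assert (Hd : 0 < Rmin 1 (Rmin a (1 - b))) by (repeat apply Rmin_glb_lt; lra).
    exists (mkposreal _ Hd). intros y Hy.
    unfold ball in Hy; simpl in Hy; unfold AbsRing_ball, abs, minus, plus, opp in Hy; simpl in Hy.
    assert (H1 := Rmin_l a (1 - b)). assert (H2 := Rmin_r a (1 - b)).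
    assert (H3 := Rmin_l 1 (Rmin a (1 - b))). assert (H4 := Rmin_r 1 (Rmin a (1 - b))).
    apply Rabs_def2 in Hy.
    unfold frac in E. symmetry. apply Hs.
    destruct (Rle_lt_dec x y) as [L|L].
    + left. rewrite (frac_eq y (Int_part x)); lra.
    + right. rewrite (frac_eq y (Int_part x - 1)); rewrite minus_IZR; lra.
  - apply is_derive_ext_loc with (fun y => h (1 * y + - IZR (Int_part x))).
    + generalize (frac_bounds x). intros Hx. unfold frac in Hx, E.
      assert (H1 : IZR (Int_part x) < x) by lra.
      assert (H2 : x < IZR (Int_part x) + 1) by lra.
      generalize (filter_and _ _ (locally_gt _ _ H1) (locally_lt _ _ H2)).
      apply filter_imp. intros y Hy. rewrite (frac_eq y (Int_part x)) by lra. f_equal; ring.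
    + assert (H : is_derive h (1 * x + - IZR (Int_part x)) (Derive h (frac x))).
      { replace (1 * x + - IZR (Int_part x)) with (frac x) by (unfold frac; ring).
        now apply smooth1_derive. }
      evar_last.
      * apply (is_derive_comp h (fun y => 1 * y + - IZR (Int_part x))); [exact H|].
        auto_derive; [exact I|reflexivity].
      * unfold scal; simpl; unfold mult; simpl; ring.
Qed.

Lemma periodize_smooth h a b :
  smooth1 h -> 0 < a -> b < 1 -> supported a b h -> smooth1 (fun x => h (frac x)).
Proof.
  intros Hh Ha Hb Hs n. revert h Hh Hs.
  induction n as [|n IH]; intros h Hh Hs; [exact I|].
  apply diffn_intro with (fun x => Derive h (frac x)).
  - intros x. now apply periodize_derive with a b.
  - apply IH; [now apply smooth1_Derive|now apply supported_Derive].
Qed.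

Lemma periodize_norm h a b n M :
  smooth1 h -> 0 < a -> b < 1 -> supported a b h -> norm_le n M h ->
  norm_le n M (fun x => h (frac x)).
Proof.
  intros Hh Ha Hb Hs. revert h Hh Hs.
  induction n as [|n IH]; intros h Hh Hs H.
  - split; [|exact I]. intros x; apply H.
  - apply norm_le_intro with (fun x => Derive h (frac x)).
    + intros x; apply H.
    + intros x. now apply periodize_derive with a b.
    + apply IH; [now apply smooth1_Derive|now apply supported_Derive|apply H].
Qed.

Definition even_periodic (w : R -> R) : Prop :=
  (forall x, w (- x) = w x) /\ (forall x, w (x + 1) = w x).

(** For g supported inside [0, 1/2] this is its even periodic extension. *)
Definition unfold_circle (g : R -> R) (x : R) : R := g (frac x) + g (1 - frac x).

Lemma symmetric_even_periodic h :
  h 0 = 0 -> (forall x, h (1 - x) = h x) -> even_periodic (fun x => h (frac x)).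
Proof.
  intros H0 Hs. split; intros x.
  - destruct (Req_dec (frac x) 0) as [E|E].
    + now rewrite E, frac_opp_0.
    + rewrite frac_opp by exact E. apply Hs.
  - now rewrite frac_add1.
Qed.

Lemma unfold_circle_spec g a b n M :
  smooth1 g -> 0 < a -> b < 1 -> supported a b g -> norm_le n M g ->
  smooth1 (unfold_circle g) /\ even_periodic (unfold_circle g) /\
  norm_le n (M + M) (unfold_circle g).
Proof.
  intros Hg Ha Hb Hs HM.
  set (h := fun x => g x + g (1 - x)).
  assert (Hh : smooth1 h).
  { apply smooth1_plus; [exact Hg|].
    apply smooth1_ext with (fun x => g (-1 * x + 1)); [intros; f_equal; ring|].
    now apply (smooth1_affine g). }
  assert (Hhs : supported (Rmin a (1 - b)) (Rmax b (1 - a)) h).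
  { intros x Hx. unfold h.
    assert (H1 := Rmin_l a (1 - b)). assert (H2 := Rmin_r a (1 - b)).
    assert (H3 := Rmax_l b (1 - a)). assert (H4 := Rmax_r b (1 - a)).
    rewrite !Hs by lra. ring. }
  assert (P1 : 0 < Rmin a (1 - b)) by (apply Rmin_glb_lt; lra).
  assert (P2 : Rmax b (1 - a) < 1) by (apply Rmax_lub_lt; lra).
  split; [|split].
  - exact (periodize_smooth h _ _ Hh P1 P2 Hhs).
  - apply (symmetric_even_periodic h).
    + apply Hhs; lra.
    + intros x; unfold h. replace (1 - (1 - x)) with x by ring. ring.
  - refine (periodize_norm h _ _ n (M + M) Hh P1 P2 Hhs _).
    apply norm_le_plus; [exact HM|]. now apply (norm_le_reflect n M 1).
Qed.

Lemma unfold_circle_eq g a b x :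
  b < 1 / 2 -> supported a b g -> 0 <= x <= 1 / 2 -> unfold_circle g x = g x.
Proof.
  intros Hb Hs Hx. unfold unfold_circle. rewrite frac_id by lra.
  rewrite (Hs (1 - x)) by lra. ring.
Qed.

(** * The phase equation *)

(** The Pruefer equation of f'' = - k^2 (1 + V) f: if f = rho cos th and
    f' = - k rho sin th with rho > 0, then th satisfies it. *)
Definition is_phase (k : R) (V th : R -> R) : Prop :=
  forall x, is_derive th x (k * (1 + V x * cos (th x) ^ 2)).

Lemma cos2_lip x y : Rabs (cos x ^ 2 - cos y ^ 2) <= Rabs (x - y).
Proof.
  rewrite <- (Rmult_1_l (Rabs (x - y))).
  apply (derive_bound_lip_abs (fun x => cos x ^ 2) (fun x => - (2 * sin x * cos x))).
  - intros z. auto_derive; [exact I|]. simpl. ring.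
  - intros z. rewrite Rabs_Ropp. rewrite <- sin_2a.
    apply Rabs_le. generalize (SIN_bound (2 * z)). lra.
Qed.

Lemma cos2_bounds x : 0 <= cos x ^ 2 <= 1.
Proof. generalize (COS_bound x). nra. Qed.

Lemma derive_nonneg_incr (g g' : R -> R) a b :
  a <= b -> (forall x, a <= x <= b -> is_derive g x (g' x)) ->
  (forall x, a <= x <= b -> 0 <= g' x) -> g a <= g b.
Proof.
  intros Hab Hd HB.
  destruct (MVT_gen g a b g') as [c [Hc E]].
  - rewrite Rmin_left, Rmax_right by lra. intros; apply Hd; lra.
  - rewrite Rmin_left, Rmax_right by lra. intros x Hx. apply continuity_pt_filterlim.
    apply (ex_derive_continuous g x). eexists; apply Hd; lra.
  - rewrite Rmin_left, Rmax_right in Hc by lra.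
    generalize (HB c Hc). nra.
Qed.

(** [RInt] lands in a normed module; [ring] and [lra] need a real number. *)
Definition integral (h : R -> R) (a b : R) : R := RInt h a b.

Lemma continuous_ex_RInt (h : R -> R) a b :
  (forall x, continuous h x) -> ex_RInt h a b.
Proof. intros H. apply (ex_RInt_continuous h). intros; apply H. Qed.

Lemma integral_derive (h : R -> R) (a x : R) :
  (forall x, continuous h x) -> is_derive (fun x => integral h a x) x (h x).
Proof.
  intros H. apply (is_derive_RInt h (fun x => RInt h a x) a x); [|apply H].
  apply filter_forall. intros y. apply (RInt_correct h). now apply continuous_ex_RInt.
Qed.

Lemma integral_point (h : R -> R) a : integral h a a = 0.
Proof. apply (RInt_point a h). Qed.

Lemma integral_sub (f g : R -> R) (a b : R) :
  (forall x, continuous f x) -> (forall x, continuous g x) ->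
  integral (fun t => f t - g t) a b = integral f a b - integral g a b.
Proof.
  intros Hf Hg. apply (RInt_minus f g); now apply continuous_ex_RInt.
Qed.

(** In norms weighted by exp(c |x - x0|), integration from x0 gains a factor
    1 / c.  This makes the Picard map contract on the whole line at once. *)
Lemma integral_exp_bound (h : R -> R) x0 A c x :
  0 < c -> (forall x, continuous h x) ->
  (forall t, Rabs (h t) <= A * exp (c * Rabs (t - x0))) ->
  Rabs (integral h x0 x) <= A / c * exp (c * Rabs (x - x0)).
Proof.
  intros Hc Hh HA.
  assert (HA0 : 0 <= A).
  { generalize (HA x0). rewrite Rminus_diag, Rabs_R0, Rmult_0_r, exp_0.
    generalize (Rabs_pos (h x0)). lra. }
  assert (HAc : 0 <= A / c) by (apply Rdiv_le_0_compat; lra).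
  assert (H0 : integral h x0 x0 = 0) by apply (integral_point h x0).
  assert (D : forall s t, Rabs s = 1 -> is_derive (fun x => A / c * exp (c * t * (x - x0)) + s * integral h x0 x) x
     (A * t * exp (c * t * (x - x0)) + s * h x)).
  { intros s t Hs.
    apply (is_derive_plus (fun x => A / c * exp (c * t * (x - x0))) (fun x => s * integral h x0 x)).
    - auto_derive; [exact I|]. unfold Rminus. field. lra.
    - apply (is_derive_scal (fun x => integral h x0 x)). now apply integral_derive. }
  assert (K : forall s, Rabs s = 1 -> s * integral h x0 x <= A / c * exp (c * Rabs (x - x0))).
  { intros s Hs. clear D.
    assert (B : forall t, s * h t <= A * exp (c * Rabs (t - x0))).
    { intros t. eapply Rle_trans; [apply Rle_abs|]. rewrite Rabs_mult, Hs, Rmult_1_l. apply HA. }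
    assert (B' : forall t, - (s * h t) <= A * exp (c * Rabs (t - x0))).
    { intros t. eapply Rle_trans; [apply Rle_abs|]. rewrite Rabs_Ropp, Rabs_mult, Hs, Rmult_1_l. apply HA. }
    destruct (Rle_dec x0 x) as [L|L].
    - rewrite (Rabs_right (x - x0)) by lra.
      assert (G : A / c * exp (c * (x0 - x0)) - s * integral h x0 x0 <= A / c * exp (c * (x - x0)) - s * integral h x0 x).
      { apply (derive_nonneg_incr (fun x => A / c * exp (c * (x - x0)) - s * integral h x0 x)
          (fun x => A * exp (c * (x - x0)) - s * h x)); [exact L| |].
        - intros y _. apply (is_derive_minus (fun x => A / c * exp (c * (x - x0))) (fun x => s * integral h x0 x)).
          + auto_derive; [exact I|]. unfold Rminus. field. lra.
          + apply (is_derive_scal (fun x => integral h x0 x)). now apply integral_derive.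
        - intros y Hy. generalize (B y). rewrite (Rabs_right (y - x0)) by lra. lra. }
      rewrite H0 in G. generalize (exp_pos (c * (x0 - x0))). nra.
    - rewrite (Rabs_left (x - x0)) by lra.
      assert (G : A / c * exp (c * - (x0 - x0)) - s * integral h x0 x0 <= A / c * exp (c * - (x - x0)) - s * integral h x0 x).
      { apply Ropp_le_cancel.
        apply (derive_nonneg_incr (fun x => - (A / c * exp (c * - (x - x0)) - s * integral h x0 x))
          (fun x => - (- A * exp (c * - (x - x0)) - s * h x))); [lra| |].
        - intros y _. apply (is_derive_opp (fun x => A / c * exp (c * - (x - x0)) - s * integral h x0 x)).
          apply (is_derive_minus (fun x => A / c * exp (c * - (x - x0))) (fun x => s * integral h x0 x)).
          + auto_derive; [exact I|]. unfold Rminus. field. lra.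
          + apply (is_derive_scal (fun x => integral h x0 x)). now apply integral_derive.
        - intros y Hy. generalize (B' y). rewrite (Rabs_left1 (y - x0)) by lra. lra. }
      rewrite H0 in G. generalize (exp_pos (c * - (x0 - x0))). nra. }
  clear D. unfold Rabs at 1. destruct (Rcase_abs (integral h x0 x)).
  - generalize (K (-1)). rewrite Rabs_left by lra. lra.
  - generalize (K 1). rewrite Rabs_R1. lra.
Qed.

Section Picard.
Variables (k M x0 alpha : R) (V : R -> R).
Hypothesis Vc : forall x, continuous V x.
Hypothesis VM : forall x, Rabs (V x) <= M.

Let rhs (y : R -> R) (t : R) : R := k * (1 + V t * cos (y t) ^ 2).

Fixpoint picard (n : nat) (x : R) : R :=
  match n with
  | O => alpha
  | S n => alpha + integral (rhs (picard n)) x0 x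
  end.

Lemma rhs_continuous y : (forall x, continuous y x) -> forall x, continuous (rhs y) x.
Proof.
  intros Hy x. unfold rhs.
  apply (continuous_scal_r k (fun t => 1 + V t * cos (y t) ^ 2)).
  apply (continuous_plus (fun _ => 1) (fun t => V t * cos (y t) ^ 2)); [apply continuous_const|].
  apply (continuous_mult V (fun t => cos (y t) ^ 2)); [apply Vc|].
  apply (continuous_comp (fun t => y t) (fun z => cos z ^ 2)); [apply Hy|].
  apply (ex_derive_continuous (fun z => cos z ^ 2)). now auto_derive.
Qed.

Lemma rhs_bound y t : Rabs (rhs y t) <= Rabs k * (1 + M).
Proof.
  unfold rhs. rewrite Rabs_mult. apply Rmult_le_compat_l; [apply Rabs_pos|].
  eapply Rle_trans; [apply Rabs_triang|]. rewrite Rabs_R1.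
  apply Rplus_le_compat_l. rewrite Rabs_mult.
  generalize (cos2_bounds (y t)) (VM t) (Rabs_pos (V t)). intros H1 H2 H3.
  rewrite (Rabs_right (cos (y t) ^ 2)) by lra. nra.
Qed.

Lemma rhs_lip y z t : Rabs (rhs y t - rhs z t) <= Rabs k * M * Rabs (y t - z t).
Proof.
  unfold rhs.
  replace (k * (1 + V t * cos (y t) ^ 2) - k * (1 + V t * cos (z t) ^ 2))
    with (k * V t * (cos (y t) ^ 2 - cos (z t) ^ 2)) by ring.
  rewrite !Rabs_mult.
  apply Rmult_le_compat; try apply cos2_lip; try apply Rabs_pos.
  - apply Rmult_le_pos; apply Rabs_pos.
  - apply Rmult_le_compat_l; [apply Rabs_pos|apply VM].
Qed.

Lemma picard_continuous n x : continuous (picard n) x.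
Proof.
  revert x; induction n as [|n IH]; intros x.
  - apply continuous_const.
  - apply (continuous_plus (fun _ => alpha) (fun x => integral (rhs (picard n)) x0 x)).
    + apply continuous_const.
    + apply (ex_derive_continuous (fun x => integral (rhs (picard n)) x0 x)).
      eexists. apply integral_derive. now apply rhs_continuous.
Qed.

(** The slopes of the iterates are bounded uniformly, so that their limit is
    Lipschitz, hence continuous. *)
Lemma picard_lip n x z : Rabs (picard n z - picard n x) <= Rabs k * (1 + M) * Rabs (z - x).
Proof.
  destruct n as [|n].
  - simpl. rewrite Rminus_diag, Rabs_R0.
    apply Rmult_le_pos; [|apply Rabs_pos]. eapply Rle_trans; [apply Rabs_pos|apply (rhs_bound (fun _ => 0) 0)].
  - apply (derive_bound_lip_abs (picard (S n)) (rhs (picard n))).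
    + intros y. simpl. evar_last.
      * apply (is_derive_plus (fun _ => alpha) (fun x => integral (rhs (picard n)) x0 x)).
        -- apply (is_derive_const alpha y).
        -- apply integral_derive. apply rhs_continuous, picard_continuous.
      * unfold plus, zero; simpl. ring.
    + intros y; apply rhs_bound.
Qed.

Let c := 2 * (Rabs k * M) + 1.
Let C := Rabs k * (1 + M).

Lemma M_nonneg : 0 <= M.
Proof. eapply Rle_trans; [apply Rabs_pos|apply (VM 0)]. Qed.

Lemma c_pos : 1 <= c.
Proof. unfold c. generalize (Rabs_pos k) M_nonneg. intros. nra. Qed.

(** The constant c is at least twice the Lipschitz constant |k| M of the
    right-hand side, which gives the ratio 1/2. *)
Lemma picard_step n x :
  Rabs (picard (S n) x - picard n x) <= C * exp (c * Rabs (x - x0)) * (1 / 2) ^ n.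
Proof.
  revert x; induction n as [|n IH]; intros x.
  - simpl. rewrite Rmult_1_r.
    replace (alpha + integral (rhs (fun _ => alpha)) x0 x - alpha)
      with (integral (rhs (fun _ => alpha)) x0 x) by ring.
    assert (HC : 0 <= C) by (eapply Rle_trans; [apply Rabs_pos|apply (rhs_bound (fun _ => 0) 0)]).
    pose proof c_pos as Hc.
    assert (H1 : forall t, 1 <= exp (c * Rabs (t - x0))).
    { intros t. generalize (exp_ineq1_le (c * Rabs (t - x0))) (Rabs_pos (t - x0)). nra. }
    eapply Rle_trans.
    + apply (integral_exp_bound _ x0 C c); [lra| |].
      * apply rhs_continuous. intros y; apply continuous_const.
      * intros t. eapply Rle_trans; [apply rhs_bound|]. fold C.
        generalize (H1 t). nra.
    + apply Rmult_le_compat_r; [generalize (H1 x); lra|].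
      unfold Rdiv. rewrite <- (Rmult_1_r C) at 2. apply Rmult_le_compat_l; [exact HC|].
      rewrite <- Rinv_1. apply Rinv_le_contravar; lra.
  - assert (Hc := c_pos).
    change (picard (S (S n)) x) with (alpha + integral (rhs (picard (S n))) x0 x).
    change (picard (S n) x) with (alpha + integral (rhs (picard n)) x0 x).
    replace (alpha + integral (rhs (picard (S n))) x0 x - (alpha + integral (rhs (picard n)) x0 x))
      with (integral (fun t => rhs (picard (S n)) t - rhs (picard n) t) x0 x).
    2:{ rewrite integral_sub; [ring| |]; apply rhs_continuous, picard_continuous. }
    eapply Rle_trans.
    + apply (integral_exp_bound _ x0 (Rabs k * M * C * (1 / 2) ^ n) c); [lra| |].
      * intros y. apply (continuous_minus (rhs (picard (S n))) (rhs (picard n)));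
          apply rhs_continuous, picard_continuous.
      * intros t. eapply Rle_trans; [apply rhs_lip|].
        replace (Rabs k * M * C * (1 / 2) ^ n * exp (c * Rabs (t - x0)))
          with (Rabs k * M * (C * exp (c * Rabs (t - x0)) * (1 / 2) ^ n)) by ring.
        apply Rmult_le_compat_l; [|apply IH].
        apply Rmult_le_pos; [apply Rabs_pos|apply M_nonneg].
    + replace (C * exp (c * Rabs (x - x0)) * (1 / 2) ^ S n)
        with (C * (1 / 2) ^ n / 2 * exp (c * Rabs (x - x0))) by (simpl; field).
      apply Rmult_le_compat_r; [left; apply exp_pos|].
      assert (HC : 0 <= C) by (eapply Rle_trans; [apply Rabs_pos|apply (rhs_bound (fun _ => 0) 0)]).
      assert (Hp : 0 < (1 / 2) ^ n) by (apply pow_lt; lra).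
      replace (Rabs k * M * C * (1 / 2) ^ n / c) with (C * (1 / 2) ^ n * (Rabs k * M / c)) by (field; lra).
      replace (C * (1 / 2) ^ n / 2) with (C * (1 / 2) ^ n * (1 / 2)) by field.
      apply Rmult_le_compat_l; [apply Rmult_le_pos; lra|].
      apply Rmult_le_reg_r with c; [lra|]. unfold Rdiv. rewrite Rmult_assoc, Rinv_l by lra.
      unfold c. lra.
Qed.

Variable sol : R -> R.
Hypothesis picard_limit : forall x, is_lim_seq (fun n => picard n x) (sol x).
Hypothesis picard_error : forall x n,
  Rabs (sol x - picard n x) <= 2 * (C * exp (c * Rabs (x - x0))) * (1 / 2) ^ n.

Lemma sol_continuous x : continuous sol x.
Proof.
  assert (L : forall z, Rabs (sol z - sol x) <= C * Rabs (z - x)).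
  { intros z.
    apply (is_lim_seq_le (fun n => Rabs (picard n z - picard n x)) (fun _ => C * Rabs (z - x))
      (Rabs (sol z - sol x)) (C * Rabs (z - x))).
    - intros n; apply picard_lip.
    - apply (is_lim_seq_abs _ (sol z - sol x)). apply is_lim_seq_minus'; apply picard_limit.
    - apply is_lim_seq_const. }
  assert (HC : 0 <= C) by (eapply Rle_trans; [apply Rabs_pos|apply (rhs_bound (fun _ => 0) 0)]).
  apply continuity_pt_filterlim. intros eps Heps.
  exists (eps / (C + 1)). split; [apply Rdiv_lt_0_compat; lra|].
  intros z [_ Hz]. simpl in *. unfold R_dist in *.
  eapply Rle_lt_trans; [apply L|].
  assert (H : (C + 1) * Rabs (z - x) < eps).
  { apply Rmult_lt_reg_r with (/ (C + 1)); [apply Rinv_0_lt_compat; lra|].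
    replace ((C + 1) * Rabs (z - x) * / (C + 1)) with (Rabs (z - x)) by (field; lra). exact Hz. }
  generalize (Rabs_pos (z - x)). nra.
Qed.

Lemma sol_integral x : sol x = alpha + integral (rhs sol) x0 x.
Proof.
  set (E := exp (c * Rabs (x - x0))).
  assert (Hc := c_pos).
  assert (H : forall n, Rabs (sol x - (alpha + integral (rhs sol) x0 x)) <=
     (2 * C * E + Rabs k * M * (2 * C) * E) * (1 / 2) ^ n).
  { intros n.
    replace (sol x - (alpha + integral (rhs sol) x0 x)) with
     ((sol x - picard (S n) x) + (integral (rhs (picard n)) x0 x - integral (rhs sol) x0 x)) by (simpl; ring).
    eapply Rle_trans; [apply Rabs_triang|]. rewrite Rmult_plus_distr_r.
    apply Rplus_le_compat.
    - eapply Rle_trans; [apply picard_error|]. fold E.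
      assert (0 <= C * E).
      { generalize (picard_step 0 x) (Rabs_pos (picard 1 x - picard 0 x)). fold E. simpl. lra. }
      assert (0 < (1 / 2) ^ n) by (apply pow_lt; lra). simpl. nra.
    - replace (integral (rhs (picard n)) x0 x - integral (rhs sol) x0 x)
      with (integral (fun t => rhs (picard n) t - rhs sol t) x0 x).
      2:{ apply integral_sub; apply rhs_continuous; [apply picard_continuous|apply sol_continuous]. }
      assert (B : forall t, Rabs (rhs (picard n) t - rhs sol t) <=
         Rabs k * M * (2 * C) * (1 / 2) ^ n * exp (c * Rabs (t - x0))).
      { intros t. eapply Rle_trans; [apply rhs_lip|].
        replace (Rabs k * M * (2 * C) * (1 / 2) ^ n * exp (c * Rabs (t - x0))) with
          (Rabs k * M * (2 * (C * exp (c * Rabs (t - x0))) * (1 / 2) ^ n)) by ring.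
        apply Rmult_le_compat_l.
        - apply Rmult_le_pos; [apply Rabs_pos|apply M_nonneg].
        - rewrite Rabs_minus_sym. apply picard_error. }
      eapply Rle_trans.
      + apply (integral_exp_bound _ x0 (Rabs k * M * (2 * C) * (1 / 2) ^ n) c); [lra| |exact B].
        intros y. apply (continuous_minus (rhs (picard n)) (rhs sol)); apply rhs_continuous;
          [apply picard_continuous|apply sol_continuous].
      + fold E. replace (Rabs k * M * (2 * C) * E * (1 / 2) ^ n) with
          (Rabs k * M * (2 * C) * (1 / 2) ^ n * E) by ring.
        apply Rmult_le_compat_r; [left; apply exp_pos|].
        assert (0 <= Rabs k * M * (2 * C) * (1 / 2) ^ n).
        { generalize (B x0) (Rabs_pos (rhs (picard n) x0 - rhs sol x0)).
          rewrite Rminus_diag, Rabs_R0, Rmult_0_r, exp_0. lra. }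
        apply Rmult_le_reg_r with c; [lra|]. unfold Rdiv. rewrite Rmult_assoc, Rinv_l by lra. nra. }
  assert (L : Rabs (sol x - (alpha + integral (rhs sol) x0 x)) <= 0).
  { apply (is_lim_seq_le (fun _ => Rabs (sol x - (alpha + integral (rhs sol) x0 x)))
      (fun n => (2 * C * E + Rabs k * M * (2 * C) * E) * (1 / 2) ^ n)
      (Rabs (sol x - (alpha + integral (rhs sol) x0 x))) 0 H).
    - apply is_lim_seq_const.
    - replace (Finite 0) with (Rbar_mult (2 * C * E + Rabs k * M * (2 * C) * E) 0)
        by (simpl; f_equal; ring).
      apply is_lim_seq_scal_l. apply is_lim_seq_geom. rewrite Rabs_right; lra. }
  assert (Z : Rabs (sol x - (alpha + integral (rhs sol) x0 x)) = 0)
    by (generalize (Rabs_pos (sol x - (alpha + integral (rhs sol) x0 x))); lra).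
  destruct (Req_dec (sol x - (alpha + integral (rhs sol) x0 x)) 0) as [E0|E0]; [lra|].
  now apply Rabs_no_R0 in E0.
Qed.

Lemma sol_is_phase : is_phase k V sol /\ sol x0 = alpha.
Proof.
  split.
  - intros x.
    apply is_derive_ext with (fun x => alpha + integral (rhs sol) x0 x).
    { intros t; now rewrite <- sol_integral. }
    evar_last.
    + apply (is_derive_plus (fun _ => alpha) (fun x => integral (rhs sol) x0 x)).
      * apply (is_derive_const alpha x).
      * apply integral_derive, rhs_continuous, sol_continuous.
    + unfold plus, zero, rhs; simpl. ring.
  - rewrite sol_integral, integral_point. ring.
Qed.

End Picard.

Lemma phase_exists k M x0 alpha V :
  (forall x, continuous V x) -> (forall x, Rabs (V x) <= M) ->
  exists th, is_phase k V th /\ th x0 = alpha.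
Proof.
  intros Vc VM.
  destruct (choose_fun _ _ _ (fun x => geometric_limit _ _
    (fun n => picard_step k M x0 alpha V Vc VM n x))) as [sol H].
  exists sol. apply (sol_is_phase k M x0 alpha V Vc VM); intros x; apply H.
Qed.

(** Gronwall's inequality for the square of D = th1 - th2: from
    |D'| <= k eta + k M |D| one gets (D^2)' <= (k eta)^2 + (1 + 2 k M) D^2, and no
    absolute value has to be differentiated. *)
Lemma phase_compare k V1 V2 th1 th2 a b eta M :
  0 < k -> a <= b <= a + 1 -> 0 <= M -> 0 <= eta ->
  is_phase k V1 th1 -> is_phase k V2 th2 -> th1 a = th2 a ->
  (forall x, a <= x <= b -> Rabs (V1 x - V2 x) <= eta) ->
  (forall x, a <= x <= b -> Rabs (V2 x) <= M) ->
  forall x, a <= x <= b -> Rabs (th1 x - th2 x) <= k * eta * exp (1 + 2 * k * M).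
Proof.
  intros Hk Hab HM Heta H1 H2 Ha Hd HV x Hx.
  set (c := 1 + 2 * k * M). assert (Hc : 1 <= c) by (unfold c; nra).
  (* nondecreasing by Gronwall's argument *)
  set (G := fun x => (k * eta) ^ 2 * (x - a) - (th1 x - th2 x) ^ 2 * exp (- c * (x - a))).
  set (D := fun x => k * (1 + V1 x * cos (th1 x) ^ 2) - k * (1 + V2 x * cos (th2 x) ^ 2)).
  assert (G0 : G a <= G x).
  { apply derive_nonneg_incr with (fun x => (k * eta) ^ 2 -
      (2 * (th1 x - th2 x) * D x - c * (th1 x - th2 x) ^ 2) * exp (- c * (x - a))); [lra| |].
    - intros y _. unfold G, D.
      generalize (H1 y) (H2 y). intros D1 D2.
      auto_derive.
      + repeat split; [eexists; apply D1|eexists; apply D2].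
      + change (Derive (fun x => th1 x) y) with (Derive th1 y).
        change (Derive (fun x => th2 x) y) with (Derive th2 y).
        apply is_derive_unique in D1. apply is_derive_unique in D2.
        rewrite D1, D2. unfold Rminus. ring.
    - intros y Hy.
      set (d := th1 y - th2 y).
      assert (B : Rabs (D y) <= k * eta + k * M * Rabs d).
      { unfold D.
        replace (k * (1 + V1 y * cos (th1 y) ^ 2) - k * (1 + V2 y * cos (th2 y) ^ 2)) with
          (k * ((V1 y - V2 y) * cos (th1 y) ^ 2) + k * (V2 y * (cos (th1 y) ^ 2 - cos (th2 y) ^ 2))) by ring.
        eapply Rle_trans; [apply Rabs_triang|]. rewrite !Rabs_mult, (Rabs_right k) by lra.
        rewrite (Rmult_assoc k M).
        apply Rplus_le_compat; apply Rmult_le_compat_l; try lra.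
        - generalize (cos2_bounds (th1 y)) (Hd y ltac:(lra)) (Rabs_pos (V1 y - V2 y)). intros.
          rewrite (Rabs_right (cos (th1 y) ^ 2)) by lra. nra.
        - apply Rmult_le_compat; try apply Rabs_pos; [apply HV; lra|apply cos2_lip]. }
      assert (B2 : 2 * d * D y <= (k * eta) ^ 2 + c * d ^ 2).
      { apply Rle_trans with (2 * (Rabs d * Rabs (D y))).
        - rewrite Rmult_assoc. apply Rmult_le_compat_l; [lra|].
          rewrite <- Rabs_mult. apply Rle_abs.
        - rewrite <- (pow2_abs d). generalize (Rabs_pos d). intros Hp.
          unfold c.
          assert (Rabs d * Rabs (D y) <= Rabs d * (k * eta + k * M * Rabs d))
            by (apply Rmult_le_compat_l; auto).
          assert (0 <= (k * eta - Rabs d) ^ 2) by apply pow2_ge_0. nra. }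
      assert (B3 : 0 < exp (- c * (y - a)) <= 1).
      { split; [apply exp_pos|]. rewrite <- exp_0. destruct (Req_dec y a) as [->|].
        - rewrite Rminus_diag, Rmult_0_r. lra.
        - left; apply exp_increasing. nra. }
      fold d. assert (0 <= (k * eta) ^ 2) by apply pow2_ge_0.
      set (u := (k * eta) ^ 2) in *. set (v := 2 * d * D y - c * d ^ 2) in *.
      assert (v <= u) by (unfold v; lra). destruct (Rle_dec 0 v); nra. }
  unfold G in G0. rewrite Ha, !Rminus_diag in G0.
  set (d := th1 x - th2 x) in *.
  assert (E : d ^ 2 * exp (- c * (x - a)) <= (k * eta) ^ 2).
  { assert (0 <= (k * eta) ^ 2) by apply pow2_ge_0.
    rewrite Rmult_0_r in G0. replace (0 ^ 2) with 0 in G0 by ring. rewrite Rmult_0_l in G0.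
    set (u := (k * eta) ^ 2) in *. nra. }
  assert (F : exp (- c * (x - a)) * exp c * exp c >= 1).
  { rewrite <- !exp_plus. apply Rle_ge. rewrite <- exp_0 at 1.
    destruct (Req_dec (- c * (x - a) + c + c) 0) as [->|]; [lra|].
    left; apply exp_increasing. nra. }
  assert (Q : d ^ 2 <= (k * eta * exp c) ^ 2).
  { replace ((k * eta * exp c) ^ 2) with ((k * eta) ^ 2 * (exp c * exp c)) by ring.
    apply Rle_trans with (d ^ 2 * exp (- c * (x - a)) * (exp c * exp c)).
    - rewrite (Rmult_assoc (d ^ 2)), <- (Rmult_assoc (exp (- c * (x - a)))).
      rewrite <- (Rmult_1_r (d ^ 2)) at 1. apply Rmult_le_compat_l; [apply pow2_ge_0|lra].
    - apply Rmult_le_compat_r; [|exact E]. generalize (exp_pos c). nra. }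
  rewrite <- (Rabs_right (k * eta * exp c)).
  - apply Rsqr_le_abs_0. unfold Rsqr. lra.
  - apply Rle_ge. generalize (exp_pos c). intros. apply Rmult_le_pos; [nra|lra].
Qed.

(** Case eta = 0 of [phase_compare]. *)
Lemma phase_unique k V1 V2 th1 th2 a b M :
  0 < k -> a <= b <= a + 1 ->
  is_phase k V1 th1 -> is_phase k V2 th2 -> th1 a = th2 a ->
  (forall x, a <= x <= b -> V1 x = V2 x) ->
  (forall x, a <= x <= b -> Rabs (V2 x) <= M) ->
  th1 b = th2 b.
Proof.
  intros Hk Hab H1 H2 Ha HV HM.
  assert (H : Rabs (th1 b - th2 b) <= k * 0 * exp (1 + 2 * k * Rabs M)).
  { apply phase_compare with V1 V2 a b; auto; try lra.
    - apply Rabs_pos.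
    - intros x Hx. rewrite HV, Rminus_diag, Rabs_R0 by auto. lra.
    - intros x Hx. eapply Rle_trans; [now apply HM|apply Rle_abs]. }
  rewrite Rmult_0_r, Rmult_0_l in H.
  assert (Rabs (th1 b - th2 b) = 0) by (generalize (Rabs_pos (th1 b - th2 b)); lra).
  destruct (Req_dec (th1 b - th2 b) 0) as [E|E]; [lra|].
  now apply Rabs_no_R0 in E.
Qed.

Lemma free_phase k c : is_phase k (fun _ => 0) (fun x => k * x + c).
Proof. intros x. auto_derive; [exact I|]. ring. Qed.

(** * Test functions dual to finitely many frequencies *)

Lemma derive_zero_eq (g : R -> R) a b :
  a <= b -> (forall x, a <= x <= b -> is_derive g x 0) -> g a = g b.
Proof.
  intros Hab H. apply Rle_antisym.
  - apply derive_nonneg_incr with (fun _ => 0); auto. intros; lra.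
  - apply Ropp_le_cancel.
    apply (derive_nonneg_incr (fun x => - g x) (fun _ => 0)); auto; [|intros; lra].
    intros x Hx. rewrite <- Ropp_0. now apply (is_derive_opp g x 0), H.
Qed.

Lemma integral_scal (c : R) (h : R -> R) (a b : R) :
  (forall x, continuous h x) -> integral (fun x => c * h x) a b = c * integral h a b.
Proof.
  intros Hc. apply (RInt_scal h a b c). now apply continuous_ex_RInt.
Qed.

Lemma integral_add (f g : R -> R) (a b : R) :
  (forall x, continuous f x) -> (forall x, continuous g x) ->
  integral (fun t => f t + g t) a b = integral f a b + integral g a b.
Proof.
  intros Hf Hg. apply (RInt_plus f g); now apply continuous_ex_RInt.
Qed.

Lemma integral_ext (f g : R -> R) (a b : R) :
  (forall x, f x = g x) -> integral f a b = integral g a b.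
Proof. intros H. now rewrite (functional_extensionality _ _ H). Qed.

Lemma integral_sum (c : nat -> R) (d : nat -> R -> R) (h : R -> R) a b n :
  (forall i x, continuous (d i) x) -> (forall x, continuous h x) ->
  integral (fun x => sum_f_R0 (fun i => c i * d i x) n * h x) a b =
  sum_f_R0 (fun i => c i * integral (fun x => d i x * h x) a b) n.
Proof.
  intros Hd Hh.
  assert (Hdh : forall i x, continuous (fun x => d i x * h x) x).
  { intros i x. apply (continuous_mult (d i) h); auto. }
  assert (Hs : forall i x, continuous (fun x => c i * (d i x * h x)) x).
  { intros i x. apply (continuous_scal_r (c i) (fun x => d i x * h x)); auto. }
  induction n as [|n IH].
  - simpl. rewrite <- integral_scal by auto. apply integral_ext; intros; ring.
  - rewrite tech5, <- IH, <- integral_scal, <- integral_add; auto.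
    + apply integral_ext; intros; rewrite tech5; ring.
    + clear IH. intros x.
      apply continuous_ext with (fun x => sum_f_R0 (fun i => c i * (d i x * h x)) n).
      * intros y. rewrite Rmult_comm, scal_sum. apply sum_eq; intros; ring.
      * induction n as [|n IHn]; simpl; [apply Hs|].
        apply (continuous_plus (fun x => sum_f_R0 (fun i => c i * (d i x * h x)) n)
          (fun x => c (S n) * (d (S n) x * h x))); auto.
Qed.

Lemma smooth1_mult_cos h k c x : smooth1 h -> continuous (fun x => h x * cos (k * x + c)) x.
Proof.
  intros Hh. apply smooth1_continuous, smooth1_mult; [exact Hh|apply smooth1_cos].
Qed.

(** The operator h'' + mu^2 h is symmetric, and cos(kappa x + phi) is an
    eigenfunction of it; the boundary terms vanish with h and h'. *)
Lemma integral_parts h a b mu kappa phi :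
  a <= b -> smooth1 h -> supported a b h ->
  integral (fun x => (Derive (Derive h) x + mu ^ 2 * h x) * cos (kappa * x + phi)) a b =
  (mu ^ 2 - kappa ^ 2) * integral (fun x => h x * cos (kappa * x + phi)) a b.
Proof.
  intros Hab Hh Hs.
  assert (Hh' : smooth1 (Derive h)) by now apply smooth1_Derive.
  assert (Hh'' : smooth1 (Derive (Derive h))) by now apply smooth1_Derive.
  assert (Hs' : supported a b (Derive h)) by now apply supported_Derive.
  set (F := fun x => (Derive (Derive h) x + mu ^ 2 * h x) * cos (kappa * x + phi)).
  set (f := fun x => h x * cos (kappa * x + phi)).
  assert (CF : forall x, continuous F x).
  { intros x. apply smooth1_mult_cos. apply smooth1_plus; [exact Hh''|now apply smooth1_scal]. }
  assert (Cf : forall x, continuous f x).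
  { intros x. now apply smooth1_mult_cos. }
  set (G := fun x => integral F a x - (mu ^ 2 - kappa ^ 2) * integral f a x
     - (Derive h x * cos (kappa * x + phi) + kappa * (h x * sin (kappa * x + phi)))).
  assert (E : G a = G b).
  { apply derive_zero_eq; [exact Hab|]. intros x _. unfold G.
    replace 0 with (F x - (mu ^ 2 - kappa ^ 2) * f x
      - ((Derive (Derive h) x * cos (kappa * x + phi) + Derive h x * (- kappa * sin (kappa * x + phi)))
         + kappa * (Derive h x * sin (kappa * x + phi) + h x * (kappa * cos (kappa * x + phi)))))
      by (unfold F, f; ring).
    assert (DC : is_derive (fun x => cos (kappa * x + phi)) x (- kappa * sin (kappa * x + phi))).
    { auto_derive; [exact I|ring]. }
    assert (DS : is_derive (fun x => sin (kappa * x + phi)) x (kappa * cos (kappa * x + phi))).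
    { auto_derive; [exact I|ring]. }
    apply (is_derive_minus (fun x => integral F a x - (mu ^ 2 - kappa ^ 2) * integral f a x)
      (fun x => Derive h x * cos (kappa * x + phi) + kappa * (h x * sin (kappa * x + phi)))).
    - apply (is_derive_minus (fun x => integral F a x) (fun x => (mu ^ 2 - kappa ^ 2) * integral f a x)).
      + now apply integral_derive.
      + apply (is_derive_scal (fun x => integral f a x)). now apply integral_derive.
    - apply (is_derive_plus (fun x => Derive h x * cos (kappa * x + phi))
        (fun x => kappa * (h x * sin (kappa * x + phi)))).
      + apply (is_derive_mult (Derive h) (fun x => cos (kappa * x + phi))); auto.
        * now apply smooth1_derive.
        * intros; apply Rmult_comm.
      + apply (is_derive_scal (fun x => h x * sin (kappa * x + phi))).
        apply (is_derive_mult h (fun x => sin (kappa * x + phi))); auto.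
        * now apply smooth1_derive.
        * intros; apply Rmult_comm. }
  assert (Z : forall x, x = a \/ x = b -> h x = 0 /\ Derive h x = 0).
  { intros x Hx. split; apply (supported_closed a b); auto.
    - intros; now apply smooth1_continuous.
    - destruct Hx; lra.
    - intros; now apply smooth1_continuous.
    - destruct Hx; lra. }
  unfold G in E. rewrite !integral_point in E.
  destruct (Z a (or_introl eq_refl)) as [Za Za'].
  destruct (Z b (or_intror eq_refl)) as [Zb Zb'].
  rewrite Za, Za', Zb, Zb' in E. lra.
Qed.

(** Applying h'' + kappa_l^2 h for every l other than i makes the function
    orthogonal to the frequencies kappa_l, whatever their phases, and multiplies
    the component at frequency k by the polynomial P(k), nonzero at kappa_i. *)
Lemma kill_frequencies h a b (kappa : nat -> R) i N :
  a <= b -> smooth1 h -> supported a b h ->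
  (forall l, (l < N)%nat -> 0 <= kappa l) -> 0 <= kappa i ->
  (forall l, (l < N)%nat -> l <> i -> kappa l <> kappa i) ->
  exists g P, smooth1 g /\ supported a b g /\
    (forall k phi, integral (fun x => g x * cos (k * x + phi)) a b =
       P k * integral (fun x => h x * cos (k * x + phi)) a b) /\
    (forall l, (l < N)%nat -> l <> i -> P (kappa l) = 0) /\ P (kappa i) <> 0.
Proof.
  intros Hab Hh Hs Hpos Hi Hdist. induction N as [|N IH].
  - exists h, (fun _ => 1). repeat split; auto.
    + intros; ring.
    + intros; lia.
  - destruct IH as [g [P [Hg [Hgs [HP [HP0 HP1]]]]]]; auto.
    destruct (Nat.eq_dec N i) as [E|E].
    + exists g, P. repeat split; auto. intros l Hl Hli. apply HP0; lia.
    + exists (fun x => Derive (Derive g) x + kappa N ^ 2 * g x),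
        (fun k => (kappa N ^ 2 - k ^ 2) * P k).
      repeat split.
      * apply smooth1_plus; [now do 2 apply smooth1_Derive|now apply smooth1_scal].
      * intros x Hx. rewrite (Hgs x Hx).
        rewrite (supported_Derive a b (Derive g)); auto; [ring|now apply supported_Derive].
      * intros k phi. rewrite integral_parts by auto. rewrite HP. ring.
      * intros l Hl Hli. destruct (Nat.eq_dec l N) as [->|HlN]; [ring|].
        rewrite HP0 by lia. ring.
      * apply Rmult_integral_contrapositive_currified; [|exact HP1].
        assert (Hd := Hdist N ltac:(lia) E). assert (HN := Hpos N ltac:(lia)).
        intros Z. apply Hd.
        assert (Z' : (kappa N - kappa i) * (kappa N + kappa i) = 0) by (rewrite <- Z; ring).
        apply Rmult_integral in Z'. destruct Z'; lra.
Qed.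

Lemma integral_pos (f : R -> R) a b x0 :
  (forall x, continuous f x) -> (forall x, 0 <= f x) -> a < x0 < b -> 0 < f x0 ->
  0 < integral f a b.
Proof.
  intros Hc Hf Hx H0.
  assert (Hl : locally x0 (fun x => f x > 0)).
  { apply (Hc x0 (fun y => y > 0)). now apply (open_gt 0). }
  destruct Hl as [e He].
  set (d := Rmin (e / 2) (Rmin ((x0 - a) / 2) ((b - x0) / 2))).
  assert (Hd : 0 < d).
  { pose proof (cond_pos e). unfold d. repeat apply Rmin_glb_lt; lra. }
  assert (D1 : d <= e / 2) by apply Rmin_l.
  assert (D2 : d <= (x0 - a) / 2) by (unfold d; eapply Rle_trans; [apply Rmin_r|apply Rmin_l]).
  assert (D3 : d <= (b - x0) / 2) by (unfold d; eapply Rle_trans; [apply Rmin_r|apply Rmin_r]).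
  assert (Dv : forall x, is_derive (fun x => integral f a x) x (f x)) by (intros; now apply integral_derive).
  assert (I1 : integral f a a <= integral f a x0).
  { apply (derive_nonneg_incr (fun x => integral f a x) f); auto; lra. }
  assert (I3 : integral f a (x0 + d) <= integral f a b).
  { apply (derive_nonneg_incr (fun x => integral f a x) f); auto; lra. }
  rewrite integral_point in I1.
  destruct (MVT_gen (fun x => integral f a x) x0 (x0 + d) f) as [c [Hcc E]].
  - intros; apply Dv.
  - intros x _. apply continuity_pt_filterlim.
    apply (ex_derive_continuous (fun x => integral f a x) x). eexists; apply Dv.
  - rewrite Rmin_left, Rmax_right in Hcc by lra.
    assert (Hfc : f c > 0).
    { apply He. unfold ball; simpl; unfold AbsRing_ball, abs, minus, plus, opp; simpl.
      pose proof (cond_pos e). rewrite Rabs_right; lra. }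
    nra.
Qed.

(** Start from a bump times cos(kappa_i x + phi_i), whose component at kappa_i
    is positive, and kill the other frequencies.  The constant function is
    included as the frequency 0 with phase 0. *)
Lemma dual_functions n (kappa phi : nat -> R) a b :
  a < b ->
  (forall i, (i <= n)%nat -> 0 <= kappa i) ->
  (forall i j, (i <= n)%nat -> (j <= n)%nat -> i <> j -> kappa i <> kappa j) ->
  (forall i, (i <= n)%nat -> kappa i = 0 -> phi i = 0) ->
  exists d : nat -> R -> R,
    (forall i, smooth1 (d i)) /\ (forall i, supported a b (d i)) /\
    (forall i j, (i <= n)%nat -> (j <= n)%nat ->
       integral (fun x => d i x * cos (kappa j * x + phi j)) a b = if Nat.eq_dec i j then 1 else 0).
Proof.
  intros Hab Hpos Hdist Hphi.
  assert (H : forall i, exists d, smooth1 d /\ supported a b d /\ ((i <= n)%nat ->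
     forall j, (j <= n)%nat -> integral (fun x => d x * cos (kappa j * x + phi j)) a b =
       if Nat.eq_dec i j then 1 else 0)).
  { intros i. destruct (Compare_dec.le_lt_dec i n) as [Hi|Hi].
    2:{ exists (fun _ => 0). split; [apply smooth1_const|]. split; [now intros x _|]. lia. }
    set (h := fun x => bump a b x * cos (kappa i * x + phi i)).
    assert (Hh : smooth1 h) by (apply smooth1_mult; [apply bump_smooth|apply smooth1_cos]).
    assert (Hs : supported a b h).
    { intros x Hx. unfold h. rewrite bump_supported by exact Hx. ring. }
    destruct (kill_frequencies h a b kappa i (S n)) as [g [P [Hg [Hgs [HP [HP0 HP1]]]]]]; auto.
    { lra. }
    { intros l Hl; apply Hpos; lia. }
    { intros l Hl Hli; apply Hdist; auto; lia. }
    set (J := integral (fun x => h x * cos (kappa i * x + phi i)) a b).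
    assert (HJ : 0 < J).
    { assert (X : exists x0, a < x0 < b /\ cos (kappa i * x0 + phi i) <> 0).
      { apply NNPP. intros HN.
        assert (Z : forall x, a < x < b -> cos (kappa i * x + phi i) = 0).
        { intros x Hx. apply NNPP. intros HZ. apply HN. now exists x. }
        set (m := (a + b) / 2). assert (Hm : a < m < b) by (unfold m; lra).
        assert (D1 : Derive (fun x => cos (kappa i * x + phi i)) m = 0).
        { apply is_derive_unique. apply is_derive_ext_loc with (fun _ => 0); [|apply (is_derive_const 0 m)].
          generalize (filter_and _ _ (locally_gt a m (proj1 Hm)) (locally_lt b m (proj2 Hm))).
          apply filter_imp. intros y Hy. symmetry; now apply Z. }
        assert (D2 : Derive (fun x => cos (kappa i * x + phi i)) m = - kappa i * sin (kappa i * m + phi i)).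
        { apply is_derive_unique. auto_derive; [exact I|ring]. }
        assert (Zm := Z m Hm). assert (S := sin2_cos2 (kappa i * m + phi i)).
        rewrite Zm in S. unfold Rsqr in S.
        destruct (Req_dec (kappa i) 0) as [K|K].
        - rewrite K, (Hphi i Hi K), Rmult_0_l, Rplus_0_l, cos_0 in Zm. lra.
        - assert (sin (kappa i * m + phi i) = 0).
          { rewrite D2 in D1. apply Rmult_integral in D1. destruct D1; lra. }
          rewrite H in S. lra. }
      destruct X as [x0 [Hx0 Hc0]].
      apply integral_pos with x0; auto.
      - intros x. now apply smooth1_mult_cos.
      - intros x. unfold h. generalize (bump_nonneg a b x). nra.
      - unfold h. rewrite Rmult_assoc. apply Rmult_lt_0_compat; [now apply bump_pos|].
        assert (0 < (cos (kappa i * x0 + phi i))²) by now apply Rlt_0_sqr. exact H. }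
    exists (fun x => / (P (kappa i) * J) * g x).
    split; [now apply smooth1_scal|]. split.
    { intros x Hx. rewrite (Hgs x Hx). ring. }
    intros _ j Hj.
    rewrite (integral_ext _ (fun x => / (P (kappa i) * J) * (g x * cos (kappa j * x + phi j))))
      by (intros; ring).
    rewrite integral_scal by (intros; now apply smooth1_mult_cos).
    rewrite HP. destruct (Nat.eq_dec i j) as [<-|Hij].
    - fold J. field. split; lra.
    - rewrite (HP0 j) by lia. ring. }
  destruct (choose_fun _ _ _ H) as [d Hd].
  exists d. repeat split.
  - intros i; apply Hd.
  - intros i; apply Hd.
  - intros i j Hi Hj. destruct (Hd i) as [_ [_ Hd']]. now apply Hd'.
Qed.

(** * Perturbing the phase equation on a block *)

(** First variation of the exit phase around the unperturbed phase
    k x + psi.  The error carries both factors M and eta: it is quadratic, and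
    also Lipschitz in the perturbation with a small constant. *)
Lemma phase_response k psi w1 w2 th1 th2 a b M eta :
  0 < k -> a <= b <= a + 1 -> 0 <= M <= 1 -> 0 <= eta ->
  (forall x, continuous w1 x) -> (forall x, continuous w2 x) ->
  (forall x, Rabs (w1 x) <= M) -> (forall x, Rabs (w2 x) <= M) ->
  (forall x, Rabs (w1 x - w2 x) <= eta) ->
  is_phase k w1 th1 -> is_phase k w2 th2 ->
  th1 a = k * a + psi -> th2 a = k * a + psi ->
  Rabs (th1 b - th2 b - k * integral (fun x => (w1 x - w2 x) * cos (k * x + psi) ^ 2) a b)
    <= 2 * k ^ 2 * exp (1 + 2 * k) * M * eta.
Proof.
  intros Hk Hab HM Heta C1 C2 B1 B2 B12 P1 P2 A1 A2.
  set (F := fun x => k * x + psi).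
  set (h := fun x => (w1 x - w2 x) * cos (F x) ^ 2).
  set (K := exp (1 + 2 * k)).
  assert (HK : 0 < K) by apply exp_pos.
  assert (Ch : forall x, continuous h x).
  { intros x. apply (continuous_mult (fun x => w1 x - w2 x) (fun x => cos (F x) ^ 2)).
    - apply (continuous_minus w1 w2); auto.
    - apply (ex_derive_continuous (fun x => cos (F x) ^ 2)). unfold F. now auto_derive. }
  assert (EM : forall m, 0 <= m <= 1 -> exp (1 + 2 * k * m) <= K).
  { intros m Hm. unfold K. destruct (Req_dec m 1) as [->|]; [rewrite Rmult_1_r; lra|].
    left. apply exp_increasing. nra. }
  assert (S1 : forall x, a <= x <= b -> Rabs (th1 x - F x) <= k * M * K).
  { intros x Hx. eapply Rle_trans.
    - apply (phase_compare k w1 (fun _ => 0) th1 F a b M 0); auto; try lra.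
      + apply free_phase.
      + intros y _. now rewrite Rminus_0_r.
      + intros y _. rewrite Rabs_R0; lra.
    - apply Rmult_le_compat_l; [nra|]. apply EM; lra. }
  assert (S12 : forall x, a <= x <= b -> Rabs (th1 x - th2 x) <= k * eta * K).
  { intros x Hx. eapply Rle_trans.
    - apply (phase_compare k w1 w2 th1 th2 a b eta M); auto; try lra.
    - apply Rmult_le_compat_l; [nra|]. now apply EM. }
  set (G := fun x => th1 x - th2 x - k * integral h a x).
  set (G' := fun x => k * (1 + w1 x * cos (th1 x) ^ 2) - k * (1 + w2 x * cos (th2 x) ^ 2) - k * h x).
  assert (E : Rabs (G b - G a) <= 2 * k ^ 2 * K * M * eta * (b - a)).
  { apply derive_bound_lip with G'; [lra| |].
    - intros x _. unfold G, G'.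
      apply (is_derive_minus (fun x => th1 x - th2 x) (fun x => k * integral h a x)).
      + apply (is_derive_minus th1 th2); auto.
      + apply (is_derive_scal (fun x => integral h a x)). now apply integral_derive.
    - intros x Hx. unfold G', h.
      replace (k * (1 + w1 x * cos (th1 x) ^ 2) - k * (1 + w2 x * cos (th2 x) ^ 2) -
        k * ((w1 x - w2 x) * cos (F x) ^ 2)) with
        (k * ((w1 x - w2 x) * (cos (th1 x) ^ 2 - cos (F x) ^ 2)) +
         k * (w2 x * (cos (th1 x) ^ 2 - cos (th2 x) ^ 2))) by ring.
      replace (2 * k ^ 2 * K * M * eta) with
        (k * (eta * (k * M * K)) + k * (M * (k * eta * K))) by ring.
      eapply Rle_trans; [apply Rabs_triang|]. rewrite !Rabs_mult, (Rabs_right k) by lra.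
      apply Rplus_le_compat; apply Rmult_le_compat_l; try lra;
        apply Rmult_le_compat; try apply Rabs_pos; auto;
        (eapply Rle_trans; [apply cos2_lip|]); auto. }
  unfold G in E. rewrite integral_point, A1, A2 in E.
  replace (th1 b - th2 b - k * integral h a b - (k * a + psi - (k * a + psi) - k * 0))
    with (th1 b - th2 b - k * integral h a b) in E by ring.
  eapply Rle_trans; [exact E|].
  assert (0 <= 2 * k ^ 2 * K * M * eta).
  { repeat apply Rmult_le_pos; try lra; try (apply pow_le; lra). }
  rewrite <- (Rmult_1_r (2 * k ^ 2 * K * M * eta)) at 2.
  apply Rmult_le_compat_l; [auto|lra].
Qed.

Lemma is_lim_seq_eq (u : nat -> R) (a b : R) : is_lim_seq u a -> is_lim_seq u b -> a = b.
Proof.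
  intros Ha Hb. apply is_lim_seq_unique in Ha. apply is_lim_seq_unique in Hb. congruence.
Qed.

(** The map p |-> (s, - s - Rm_j p) contracts the ball of radius 2 s, because
    the Lipschitz constant of Rm is proportional to the radius of the ball.  The
    contraction factor 1/2 also bounds the dependence on s. *)
Lemma fixed_point_family (n : nat) (Rm : nat -> (nat -> R) -> R) (L r s0 : R) :
  0 <= L -> 2 * s0 <= r -> 4 * L * s0 <= 1 -> 0 < s0 ->
  (forall M eta p q, 0 <= M <= r ->
    (forall i, (i <= n)%nat -> Rabs (p i) <= M) ->
    (forall i, (i <= n)%nat -> Rabs (q i) <= M) ->
    (forall i, (i <= n)%nat -> Rabs (p i - q i) <= eta) ->
    forall j, (1 <= j <= n)%nat -> Rabs (Rm j p - Rm j q) <= L * M * eta) ->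
  (forall j, (1 <= j <= n)%nat -> Rm j (fun _ => 0) = 0) ->
  exists c : R -> nat -> R,
    (forall s, 0 <= s <= s0 ->
       c s 0%nat = s /\ (forall i, (i <= n)%nat -> Rabs (c s i) <= 2 * s) /\
       (forall j, (1 <= j <= n)%nat -> c s j = - s - Rm j (c s))) /\
    (forall s t i, 0 <= s <= s0 -> 0 <= t <= s0 -> (i <= n)%nat ->
       Rabs (c s i - c t i) <= 2 * Rabs (s - t)).
Proof.
  intros HL Hr HLs Hs0 Hlip H0.
  assert (X : forall s, exists p : nat -> R, 0 <= s <= s0 ->
     p 0%nat = s /\ (forall i, (i <= n)%nat -> Rabs (p i) <= 2 * s) /\
     (forall j, (1 <= j <= n)%nat -> p j = - s - Rm j p)).
  { intros s. destruct (classic (0 <= s <= s0)) as [Hs|Hs].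
    2:{ exists (fun _ => 0). tauto. }
    set (it := nat_rect (fun _ => nat -> R) (fun i => match i with O => s | S _ => 0 end)
      (fun _ p i => match i with O => s | S j => - s - Rm (S j) p end)).
    assert (ITS : forall m i, it (S m) i = match i with O => s | S j => - s - Rm (S j) (it m) end)
      by reflexivity.
    assert (B : forall m i, (i <= n)%nat -> Rabs (it m i) <= 2 * s).
    { induction m as [|m IH]; intros i Hi.
      - simpl. destruct i; [rewrite Rabs_right|rewrite Rabs_R0]; lra.
      - rewrite ITS. destruct i as [|i]; [rewrite Rabs_right; lra|].
        assert (Hm : Rabs (Rm (S i) (it m) - Rm (S i) (fun _ => 0)) <= L * (2 * s) * (2 * s)).
        { apply Hlip; try lra; auto; try lia.
          - intros l Hl. rewrite Rabs_R0; lra.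
          - intros l Hl. rewrite Rminus_0_r; auto. }
        rewrite H0, Rminus_0_r in Hm by lia.
        assert (L * (2 * s) * (2 * s) <= s) by nra.
        replace (- s - Rm (S i) (it m)) with (- (s + Rm (S i) (it m))) by ring.
        rewrite Rabs_Ropp. eapply Rle_trans; [apply Rabs_triang|]. rewrite (Rabs_right s); lra. }
    assert (D : forall m i, (i <= n)%nat -> Rabs (it (S m) i - it m i) <= 4 * s * (1 / 2) ^ m).
    { induction m as [|m IH]; intros i Hi.
      - generalize (B 1%nat i Hi) (B 0%nat i Hi).
        unfold Rabs; repeat destruct Rcase_abs; simpl pow; lra.
      - rewrite (ITS (S m)). rewrite (ITS m). destruct i as [|i].
        + rewrite Rminus_diag, Rabs_R0. apply Rmult_le_pos; [lra|apply pow_le; lra].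
        + replace (- s - Rm (S i) (it (S m)) - (- s - Rm (S i) (it m)))
            with (- (Rm (S i) (it (S m)) - Rm (S i) (it m))) by ring.
          rewrite Rabs_Ropp.
          eapply Rle_trans.
          * apply (Hlip (2 * s) (4 * s * (1 / 2) ^ m)); auto; try lra; try lia.
          * simpl pow. assert (0 <= (1 / 2) ^ m) by (apply pow_le; lra).
            assert (L * (2 * s) <= 1 / 2) by nra.
            replace (4 * s * (1 / 2 * (1 / 2) ^ m)) with (1 / 2 * (4 * s * (1 / 2) ^ m)) by ring.
            apply Rmult_le_compat_r; [|auto]. apply Rmult_le_pos; [lra|auto]. }
    assert (Y : forall i, exists l : R, (i <= n)%nat -> is_lim_seq (fun m => it m i) l /\
       forall m, Rabs (l - it m i) <= 2 * (4 * s) * (1 / 2) ^ m).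
    { intros i. destruct (le_lt_dec i n) as [Hi|Hi].
      - destruct (geometric_limit (fun m => it m i) (4 * s)) as [l Hl]; [auto|].
        exists l; auto.
      - exists 0. lia. }
    destruct (choose_fun _ _ _ Y) as [p Hp].
    assert (Bp : forall i, (i <= n)%nat -> Rabs (p i) <= 2 * s).
    { intros i Hi. destruct (Hp i Hi) as [Lp _].
      apply (is_lim_seq_le (fun m => Rabs (it m i)) (fun _ => 2 * s) (Rabs (p i)) (2 * s)).
      - intros m; auto.
      - now apply (is_lim_seq_abs _ (p i)).
      - apply is_lim_seq_const. }
    assert (G0 : is_lim_seq (fun m => L * (2 * s) * (2 * (4 * s) * (1 / 2) ^ m)) 0).
    { replace (Finite 0) with (Rbar_mult (L * (2 * s) * (2 * (4 * s))) 0) by (simpl; f_equal; ring).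
      apply is_lim_seq_ext with (fun m => L * (2 * s) * (2 * (4 * s)) * (1 / 2) ^ m).
      - intros; ring.
      - apply is_lim_seq_scal_l. apply is_lim_seq_geom. rewrite Rabs_right; lra. }
    exists p. intros _. split; [|split]; auto.
    - destruct (Hp 0%nat ltac:(lia)) as [Lp _].
      assert (E : is_lim_seq (fun m => it m 0%nat) s).
      { apply is_lim_seq_ext with (fun _ => s); [|apply is_lim_seq_const].
        intros [|m]; reflexivity. }
      exact (is_lim_seq_eq _ _ _ Lp E).
    - intros j Hj. destruct (Hp j ltac:(lia)) as [Lp _].
      assert (E : is_lim_seq (fun m => it (S m) j) (- s - Rm j p)).
      { apply is_lim_seq_ext with (fun m => - s - Rm j (it m)).
        { intros m. rewrite ITS. destruct j; [lia|reflexivity]. }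
        apply is_lim_seq_minus'; [apply is_lim_seq_const|].
        apply is_lim_seq_spec. intros eps.
        apply is_lim_seq_spec in G0. destruct (G0 eps) as [N HN].
        exists N. intros m Hm. specialize (HN m Hm). rewrite Rminus_0_r in HN.
        eapply Rle_lt_trans; [|exact HN].
        eapply Rle_trans; [|apply Rle_abs].
        apply Hlip; auto; try lra.
        intros i Hi. rewrite Rabs_minus_sym. now apply (Hp i Hi). }
      apply (is_lim_seq_incr_1 (fun m => it m j)) in E.
      exact (is_lim_seq_eq _ _ _ Lp E). }
  destruct (choose_fun _ _ _ X) as [c Hc].
  exists c. split; [exact Hc|].
  intros s t i Hs Ht Hi.
  destruct (Hc s Hs) as [S1 [S2 S3]]. destruct (Hc t Ht) as [T1 [T2 T3]].
  assert (It : forall N i, (i <= n)%nat ->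
    Rabs (c s i - c t i) <= 2 * Rabs (s - t) + 4 * s0 * (1 / 2) ^ N).
  { induction N as [|N IH]; intros l Hl.
    - generalize (S2 l Hl) (T2 l Hl) (Rabs_pos (s - t)). simpl.
      unfold Rabs; repeat destruct Rcase_abs; lra.
    - destruct l as [|l].
      + rewrite S1, T1. assert (0 <= (1 / 2) ^ S N) by (apply pow_le; lra).
        generalize (Rabs_pos (s - t)). nra.
      + rewrite S3, T3 by lia.
        replace (- s - Rm (S l) (c s) - (- t - Rm (S l) (c t))) with
         (- ((s - t) + (Rm (S l) (c s) - Rm (S l) (c t)))) by ring.
        rewrite Rabs_Ropp. eapply Rle_trans; [apply Rabs_triang|].
        assert (Q : Rabs (Rm (S l) (c s) - Rm (S l) (c t)) <=
          L * (2 * s0) * (2 * Rabs (s - t) + 4 * s0 * (1 / 2) ^ N)).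
        { apply Hlip; auto; try lra; try lia.
          - intros j Hj. generalize (S2 j Hj); lra.
          - intros j Hj. generalize (T2 j Hj); lra. }
        assert (0 <= (1 / 2) ^ N) by (apply pow_le; lra).
        assert (L * (2 * s0) <= 1 / 2) by lra.
        assert (L * (2 * s0) * (2 * Rabs (s - t) + 4 * s0 * (1 / 2) ^ N) <=
          1 / 2 * (2 * Rabs (s - t) + 4 * s0 * (1 / 2) ^ N)).
        { apply Rmult_le_compat_r; [|auto]. generalize (Rabs_pos (s - t)). nra. }
        simpl pow. lra. }
  apply (is_lim_seq_le (fun _ => Rabs (c s i - c t i))
    (fun N => 2 * Rabs (s - t) + 4 * s0 * (1 / 2) ^ N)
    (Rabs (c s i - c t i)) (2 * Rabs (s - t))).
  - intros N; auto.
  - apply is_lim_seq_const.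
  - replace (2 * Rabs (s - t)) with (2 * Rabs (s - t) + 4 * s0 * 0) at 1 by ring.
    apply is_lim_seq_plus'; [apply is_lim_seq_const|].
    apply (is_lim_seq_scal_l _ (4 * s0) 0). apply is_lim_seq_geom. rewrite Rabs_right; lra.
Qed.

(** Averaging cos^2 to 1/2 predicts the gain k/2 int w.  Subtracting
    w/4 sin(2 th) from the phase removes the oscillating term of order k w; what
    is left is of order k w^2 or of order w', and the correction vanishes at
    both ends of the block. *)
Lemma phase_gain k w th a b M M' :
  0 < k -> a <= b -> smooth1 w -> supported a b w ->
  (forall x, Rabs (w x) <= M) -> (forall x, Rabs (Derive w x) <= M') ->
  is_phase k w th ->
  k / 2 * integral w a b - (b - a) * (k * M ^ 2 / 2 + M' / 4) <= th b - th a - k * (b - a).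
Proof.
  intros Hk Hab Hw Hs HM HM' Hth.
  assert (Cw : forall x, continuous w x) by (intros; now apply smooth1_continuous).
  set (Y := fun x => th x - k * x - k / 2 * integral w a x - / 4 * (w x * sin (2 * th x))).
  set (Y' := fun x => k * (1 + w x * cos (th x) ^ 2) - k - k / 2 * w x
     - / 4 * (Derive w x * sin (2 * th x) + w x * (2 * (k * (1 + w x * cos (th x) ^ 2)) * cos (2 * th x)))).
  assert (E : Rabs (Y b - Y a) <= (k * M ^ 2 / 2 + M' / 4) * (b - a)).
  { apply derive_bound_lip with Y'; [lra| |].
    - intros x _. unfold Y, Y'.
      apply (is_derive_minus (fun x => th x - k * x - k / 2 * integral w a x)
        (fun x => / 4 * (w x * sin (2 * th x)))).
      + apply (is_derive_minus (fun x => th x - k * x) (fun x => k / 2 * integral w a x)).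
        * apply (is_derive_minus th (fun x => k * x)); [apply Hth|].
          auto_derive; [exact I|ring].
        * apply (is_derive_scal (fun x => integral w a x)). now apply integral_derive.
      + apply (is_derive_scal (fun x => w x * sin (2 * th x))).
        apply (is_derive_mult w (fun x => sin (2 * th x))).
        * now apply smooth1_derive.
        * generalize (Hth x). intros D. auto_derive.
          -- exists (k * (1 + w x * cos (th x) ^ 2)); exact D.
          -- change (Derive (fun x => th x) x) with (Derive th x).
             apply is_derive_unique in D. rewrite D. ring.
        * intros; apply Rmult_comm.
    - intros x _. unfold Y'.
      replace (k * (1 + w x * cos (th x) ^ 2) - k - k / 2 * w x -
        / 4 * (Derive w x * sin (2 * th x) +
         w x * (2 * (k * (1 + w x * cos (th x) ^ 2)) * cos (2 * th x)))) with
        (- (k * (w x ^ 2 * (cos (th x) ^ 2 * cos (2 * th x))) / 2 + Derive w x * sin (2 * th x) / 4)).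
      2:{ rewrite cos_2a_cos. field. }
      rewrite Rabs_Ropp. eapply Rle_trans; [apply Rabs_triang|].
      unfold Rdiv. rewrite !Rabs_mult, (Rabs_right k), (Rabs_right (/ 2)), (Rabs_right (/ 4)) by lra.
      assert (Q1 : Rabs (w x ^ 2) <= M ^ 2).
      { rewrite <- RPow_abs. apply pow_incr. split; [apply Rabs_pos|apply HM]. }
      assert (Q2 : Rabs (cos (th x) ^ 2) <= 1).
      { generalize (cos2_bounds (th x)). intros. rewrite Rabs_right; lra. }
      assert (Q3 : Rabs (cos (2 * th x)) <= 1) by (apply Rabs_le, COS_bound).
      assert (Q4 : Rabs (sin (2 * th x)) <= 1) by (apply Rabs_le, SIN_bound).
      assert (Q5 := HM' x).
      assert (N1 := Rabs_pos (w x ^ 2)). assert (N2 := Rabs_pos (cos (th x) ^ 2)).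
      assert (N3 := Rabs_pos (cos (2 * th x))). assert (N4 := Rabs_pos (sin (2 * th x))).
      assert (N5 := Rabs_pos (Derive w x)).
      apply Rplus_le_compat; apply Rmult_le_compat_r; try lra.
      + apply Rmult_le_compat_l; [lra|].
        rewrite <- (Rmult_1_r (M ^ 2)). apply Rmult_le_compat; auto; [now apply Rmult_le_pos|].
        rewrite <- (Rmult_1_r 1). now apply Rmult_le_compat.
      + rewrite <- (Rmult_1_r M'). now apply Rmult_le_compat. }
  unfold Y in E. rewrite integral_point in E.
  rewrite !(supported_closed a b w) in E by (auto; lra).
  apply Rabs_le_between in E. lra.
Qed.

(** An interval of length pi contains a multiple of pi. *)
Lemma sin_hits_zero (v : R -> R) tau s0 :
  0 < s0 -> (forall s, continuous v s) -> v 0 + PI <= v s0 ->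
  exists s, 0 <= s <= s0 /\ sin (v s - tau) = 0.
Proof.
  intros Hs0 Hv Hg.
  set (m := up ((v 0 - tau) / PI)).
  destruct (archimed ((v 0 - tau) / PI)) as [A1 A2]. fold m in A1, A2.
  assert (HP := PI_RGT_0).
  assert (B1 : v 0 - tau < IZR m * PI).
  { apply Rmult_lt_reg_r with (/ PI); [now apply Rinv_0_lt_compat|].
    rewrite Rmult_assoc, Rinv_r, Rmult_1_r by lra. exact A1. }
  assert (B2 : IZR m * PI <= v 0 - tau + PI).
  { apply Rmult_le_reg_r with (/ PI); [now apply Rinv_0_lt_compat|].
    replace (IZR m * PI * / PI) with (IZR m) by (field; lra).
    replace ((v 0 - tau + PI) * / PI) with ((v 0 - tau) / PI + 1) by (field; lra). lra. }
  destruct (IVT_gen v 0 s0 (IZR m * PI + tau)) as [s [Hs E]].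
  - intros x. apply continuity_pt_filterlim, Hv.
  - rewrite Rmin_left, Rmax_right by lra. lra.
  - rewrite Rmin_left, Rmax_right in Hs by lra.
    exists s. split; [exact Hs|]. rewrite E.
    apply sin_eq_0_1. exists m. ring.
Qed.

Lemma sum_abs_bound (p : nat -> R) (u D : nat -> R) M n :
  (forall i, (i <= n)%nat -> Rabs (p i) <= M) -> (forall i, (i <= n)%nat -> Rabs (u i) <= D i) ->
  Rabs (sum_f_R0 (fun i => p i * u i) n) <= M * sum_f_R0 D n.
Proof.
  intros Hp Hu.
  eapply Rle_trans; [apply Rsum_abs|].
  rewrite scal_sum. apply sum_Rle. intros i Hi. rewrite Rabs_mult, (Rmult_comm (D i)).
  apply Rmult_le_compat; auto; apply Rabs_pos.
Qed.

Lemma sum_term_le (u : nat -> R) n j :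
  (forall i, 0 <= u i) -> (j <= n)%nat -> u j <= sum_f_R0 u n.
Proof.
  intros Hu. induction n as [|n IH]; intros Hj.
  - replace j with 0%nat by lia. simpl; lra.
  - rewrite tech5. destruct (Nat.eq_dec j (S n)) as [->|E].
    + generalize (cond_pos_sum u n Hu). lra.
    + generalize (IH ltac:(lia)) (Hu (S n)). lra.
Qed.

Lemma cos2_half x : cos x ^ 2 = / 2 * (1 + cos (2 * x)).
Proof. rewrite cos_2a_cos. field. Qed.

Lemma integral_cos2 h k c a b : smooth1 h ->
  integral (fun x => h x * cos (k * x + c) ^ 2) a b =
  / 2 * (integral h a b + integral (fun x => h x * cos (2 * k * x + 2 * c)) a b).
Proof.
  intros Hh.
  rewrite <- integral_add, <- integral_scal.
  - apply integral_ext. intros x. rewrite cos2_half.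
    replace (2 * (k * x + c)) with (2 * k * x + 2 * c) by ring. ring.
  - intros x. apply smooth1_continuous, smooth1_plus; [exact Hh|].
    apply smooth1_mult; [exact Hh|apply smooth1_cos].
  - intros x. now apply smooth1_continuous.
  - intros x. now apply smooth1_mult_cos.
Qed.

(** The perturbation is a combination of the dual functions, p_0 being the
    integral of w and p_(j+1) its component at 2 k_j.  As
    cos^2 = (1 + cos(2 .)) / 2, the exit phase of k_j moves by
    k_j / 2 (p_0 + p_(j+1) + Rm), with a remainder Rm that is quadratic in p.  So
    p_0 = s is free, the other p_j are solved for, and s is left to adjust the
    phase of the new frequency kk. *)
Lemma block_perturbation (n : nat) (k psi : nat -> R) (a b eps : R) (N : nat) :
  a < b <= a + 1 -> 0 < eps ->
  (forall j, (j < n)%nat -> 0 < k j) ->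
  (forall i j, (i < n)%nat -> (j < n)%nat -> i <> j -> k i <> k j) ->
  exists k0, forall kk, 0 < kk -> k0 <= kk -> forall alpha tau, exists w,
    smooth1 w /\ supported a b w /\ norm_le N eps w /\
    (forall j th, (j < n)%nat -> is_phase (k j) w th -> th a = k j * a + psi j ->
       th b = k j * b + psi j) /\
    (exists th, is_phase kk w th /\ th a = alpha /\ sin (th b - tau) = 0).
Proof.
  intros Hab Heps Hk Hdist.
  set (kappa := fun i => match i with O => 0 | S j => 2 * k j end).
  set (phi := fun i => match i with O => 0 | S j => 2 * psi j end).
  destruct (dual_functions n kappa phi a b) as [d [Hd [Hds Hdual]]].
  { lra. }
  { intros [|i] Hi; simpl; [lra|]. generalize (Hk i ltac:(lia)); lra. }
  { intros [|i] [|j] Hi Hj Hij; simpl.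
    - congruence.
    - generalize (Hk j ltac:(lia)); lra.
    - generalize (Hk i ltac:(lia)); lra.
    - intros E. apply (Hdist i j); try lia; lra. }
  { intros [|i] Hi E; simpl in *; [reflexivity|]. generalize (Hk i ltac:(lia)); lra. }
  destruct (choose_fun _ _ _ (fun i => supported_norm a b (d i) (S N) (Hd i) (Hds i))) as [D HD].
  set (B := sum_f_R0 D n).
  assert (HB : 0 < B).
  { unfold B. apply Rlt_le_trans with (D 0%nat); [apply HD|].
    apply (sum_term_le D n 0); [intros i; left; apply HD|lia]. }
  set (w := fun (p : nat -> R) x => sum_f_R0 (fun i => p i * d i x) n).
  assert (Ws : forall p, smooth1 (w p)).
  { intros p. apply (smooth1_sum (fun i x => p i * d i x)). intros i; now apply smooth1_scal. }
  assert (Wc : forall p x, continuous (w p) x) by (intros; now apply smooth1_continuous).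
  assert (Wsup : forall p, supported a b (w p)).
  { intros p x Hx. unfold w. apply sum_eq_R0. intros i _. rewrite (Hds i x Hx). ring. }
  assert (Wb : forall p M x, (forall i, (i <= n)%nat -> Rabs (p i) <= M) -> Rabs (w p x) <= M * B).
  { intros p M x Hp. unfold w, B. apply (sum_abs_bound p (fun i => d i x)); auto.
    intros i _. apply (norm_le_0 (S N)). apply HD. }
  assert (Wd : forall p q M x, (forall i, (i <= n)%nat -> Rabs (p i - q i) <= M) ->
     Rabs (w p x - w q x) <= M * B).
  { intros p q M x Hpq. unfold w.
    rewrite <- minus_sum.
    rewrite (sum_eq _ (fun i => (p i - q i) * d i x)) by (intros; ring).
    apply (sum_abs_bound (fun i => p i - q i) (fun i => d i x)); auto.
    intros i _. apply (norm_le_0 (S N)). apply HD. }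
  assert (Wn : forall p M, (forall i, (i <= n)%nat -> Rabs (p i) <= M) -> norm_le (S N) (M * B) (w p)).
  { intros p M Hp. apply norm_le_weaken with (sum_f_R0 (fun i => Rabs (p i) * D i) n).
    - unfold B. rewrite scal_sum. apply sum_Rle. intros i Hi. rewrite (Rmult_comm (D i)).
      apply Rmult_le_compat_r; [left; apply HD|auto].
    - apply (norm_le_sum d p D). intros i _; apply HD. }
  assert (Wi : forall p j, (j <= n)%nat ->
     integral (fun x => w p x * cos (kappa j * x + phi j)) a b = p j).
  { intros p j Hj. unfold w. rewrite integral_sum.
    - rewrite (sum_eq _ (fun i => if Nat.eq_dec i j then p j else 0)).
      + clear - Hj. induction n as [|n IH]; cbn [sum_f_R0].
        * destruct (Nat.eq_dec 0 j); [reflexivity|lia].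
        * destruct (Nat.eq_dec (S n) j) as [<-|E].
          -- rewrite sum_eq_R0; [ring|]. intros i Hi. destruct (Nat.eq_dec i (S n)); [lia|reflexivity].
          -- rewrite IH by lia. ring.
      + intros i Hi. rewrite Hdual by auto. destruct (Nat.eq_dec i j) as [->|]; ring.
    - intros; now apply smooth1_continuous.
    - intros x. apply smooth1_continuous, smooth1_cos. }
  assert (Wi0 : forall p, integral (w p) a b = p 0%nat).
  { intros p. rewrite <- (Wi p 0%nat) by lia. apply integral_ext. intros x. simpl.
    rewrite Rmult_0_l, Rplus_0_l, cos_0. ring. }
  assert (Wi2 : forall p q j, (j < n)%nat ->
     integral (fun x => (w p x - w q x) * cos (k j * x + psi j) ^ 2) a b =
     / 2 * ((p 0%nat - q 0%nat) + (p (S j) - q (S j)))).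
  { intros p q j Hj.
    rewrite (integral_ext _ (fun x => w (fun i => p i - q i) x * cos (k j * x + psi j) ^ 2)).
    - rewrite integral_cos2, Wi0 by auto. f_equal. f_equal.
      exact (Wi (fun i => p i - q i) (S j) ltac:(lia)).
    - intros x. f_equal. unfold w. rewrite <- minus_sum. apply sum_eq. intros; ring. }
  assert (Ph : forall (z : R * R * (nat -> R)), exists th,
     is_phase (fst (fst z)) (w (snd z)) th /\ th a = snd (fst z)).
  { intros [[k1 al] p]. simpl. destruct (supported_bounded a b (w p)) as [M HM]; auto.
    now apply phase_exists with M. }
  destruct (choose_fun _ _ _ Ph) as [TH HTH].
  set (Th := fun k1 al p => TH (k1, al, p)).
  assert (HTh : forall k1 al p, is_phase k1 (w p) (Th k1 al p) /\ Th k1 al p a = al).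
  { intros k1 al p. exact (HTH (k1, al, p)). }
  clearbody Th. clear HTH TH Ph.
  set (Rm := fun j (p : nat -> R) => match j with O => 0 | S j =>
     2 / k j * (Th (k j) (k j * a + psi j) p b - (k j * b + psi j)) - (p 0%nat + p (S j)) end).
  set (Lj := fun j => Rabs (4 * k j * exp (1 + 2 * k j) * B ^ 2)).
  set (L := sum_f_R0 Lj n).
  assert (HL : 0 <= L).
  { apply cond_pos_sum. intros; apply Rabs_pos. }
  set (r := / (B + 1)).
  assert (Hr : 0 < r) by (apply Rinv_0_lt_compat; lra).
  assert (HrB : r * B <= 1).
  { apply Rmult_le_reg_l with (B + 1); [lra|]. unfold r.
    rewrite <- Rmult_assoc, Rinv_r by lra. lra. }
  (* in this order: perturbations at most 1, C^N norm at most eps, contraction,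
     and a gain k s / 2 that dominates the quadratic loss in phase_gain *)
  set (s0 := Rmin (Rmin (r / 2) (eps / (2 * B))) (Rmin (/ (4 * L + 1)) (/ (8 * B ^ 2)))).
  assert (HB2 : 0 < B ^ 2) by (apply pow_lt; lra).
  assert (S0 : 0 < s0).
  { unfold s0. repeat apply Rmin_glb_lt; try lra.
    - apply Rdiv_lt_0_compat; lra.
    - apply Rinv_0_lt_compat; lra.
    - apply Rinv_0_lt_compat; lra. }
  assert (S1 : 2 * s0 <= r).
  { assert (s0 <= r / 2) by (unfold s0; eapply Rle_trans; [apply Rmin_l|apply Rmin_l]). lra. }
  assert (S2 : 2 * s0 * B <= eps).
  { assert (E : s0 <= eps / (2 * B)) by (unfold s0; eapply Rle_trans; [apply Rmin_l|apply Rmin_r]).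
    apply Rmult_le_compat_r with (r := 2 * B) in E; [|lra].
    replace (eps / (2 * B) * (2 * B)) with eps in E by (field; lra). lra. }
  assert (S3 : 4 * L * s0 <= 1).
  { assert (E : s0 <= / (4 * L + 1)) by (unfold s0; eapply Rle_trans; [apply Rmin_r|apply Rmin_l]).
    apply Rmult_le_compat_l with (r := 4 * L + 1) in E; [|lra].
    rewrite Rinv_r in E by lra. lra. }
  assert (S4 : 8 * B ^ 2 * s0 <= 1).
  { assert (E : s0 <= / (8 * B ^ 2)) by (unfold s0; eapply Rle_trans; [apply Rmin_r|apply Rmin_r]).
    apply Rmult_le_compat_l with (r := 8 * B ^ 2) in E; [|lra].
    rewrite Rinv_r in E by lra. lra. }
  destruct (fixed_point_family n Rm L r s0) as [c [Hc Hclip]]; auto.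
  { intros M eta p q HM Hp Hq Hpq [|j] Hj; [lia|].
    assert (Heta : 0 <= eta).
    { eapply Rle_trans; [apply Rabs_pos|apply (Hpq 0%nat); lia]. }
    assert (Hkj := Hk j ltac:(lia)).
    destruct (HTh (k j) (k j * a + psi j) p) as [P1 A1].
    destruct (HTh (k j) (k j * a + psi j) q) as [P2 A2].
    set (th1 := Th (k j) (k j * a + psi j) p) in *.
    set (th2 := Th (k j) (k j * a + psi j) q) in *.
    assert (E : Rabs (th1 b - th2 b - k j * (/ 2 * ((p 0%nat - q 0%nat) + (p (S j) - q (S j)))))
      <= 2 * k j ^ 2 * exp (1 + 2 * k j) * (M * B) * (eta * B)).
    { rewrite <- Wi2 by lia. apply phase_response; auto; try lra; try nra. }
    unfold Rm. fold th1 th2.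
    replace (2 / k j * (th1 b - (k j * b + psi j)) - (p 0%nat + p (S j)) -
      (2 / k j * (th2 b - (k j * b + psi j)) - (q 0%nat + q (S j)))) with
      (2 / k j * (th1 b - th2 b - k j * (/ 2 * (p 0%nat - q 0%nat + (p (S j) - q (S j)))))) by (field; lra).
    rewrite Rabs_mult, (Rabs_right (2 / k j)) by (apply Rle_ge, Rlt_le, Rdiv_lt_0_compat; lra).
    apply Rle_trans with (2 / k j * (2 * k j ^ 2 * exp (1 + 2 * k j) * (M * B) * (eta * B))).
    - apply Rmult_le_compat_l; [|exact E]. apply Rlt_le, Rdiv_lt_0_compat; lra.
    - replace (2 / k j * (2 * k j ^ 2 * exp (1 + 2 * k j) * (M * B) * (eta * B))) with
        ((4 * k j * exp (1 + 2 * k j) * B ^ 2) * (M * eta)) by (field; lra).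
      replace (L * M * eta) with (L * (M * eta)) by ring.
      apply Rmult_le_compat_r; [apply Rmult_le_pos; lra|].
      eapply Rle_trans; [apply Rle_abs|]. apply (sum_term_le Lj n j); [intros; apply Rabs_pos|lia]. }
  { intros [|j] Hj; [lia|]. unfold Rm.
    destruct (HTh (k j) (k j * a + psi j) (fun _ => 0)) as [P1 A1].
    rewrite (phase_unique (k j) (w (fun _ => 0)) (fun _ => 0)
      (Th (k j) (k j * a + psi j) (fun _ => 0)) (fun x => k j * x + psi j) a b 0); auto.
    - ring.
    - apply Hk; lia.
    - lra.
    - apply free_phase.
    - intros x _. unfold w. apply sum_eq_R0. intros; ring.
    - intros x _. rewrite Rabs_R0; lra. }
  set (M' := 2 * s0 * B).
  exists (4 / s0 * (PI + M' / 4)).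
  intros kk Hkk Hk0 alpha tau.
  (* s is clamped to [0, s0] to have a function continuous on the whole line *)
  set (cl := fun s => Rmax 0 (Rmin s s0)).
  assert (Hcl : forall s, 0 <= cl s <= s0).
  { intros s. unfold cl. split; [apply Rmax_l|]. apply Rmax_lub; [lra|apply Rmin_r]. }
  assert (Hcl2 : forall s, 0 <= s <= s0 -> cl s = s).
  { intros s Hs. unfold cl. rewrite Rmin_left, Rmax_right by lra. reflexivity. }
  assert (Hcll : forall s t, Rabs (cl s - cl t) <= Rabs (s - t)).
  { intros s t. unfold cl, Rmax, Rmin.
    repeat destruct Rle_dec; unfold Rabs; repeat destruct Rcase_abs; lra. }
  assert (Wc1 : forall s x, Rabs (w (c (cl s)) x) <= 1).
  { intros s x. apply Rle_trans with (r * B); [|exact HrB].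
    apply Wb. intros i Hi. destruct (Hc (cl s) (Hcl s)) as [_ [H _]].
    generalize (H i Hi) (Hcl s). lra. }
  set (v := fun s => Th kk alpha (c (cl s)) b).
  destruct (sin_hits_zero v tau s0) as [s [Hs Hsin]]; auto.
  { intros s.
    set (C := kk * (2 * B) * exp (1 + 2 * kk * 1)).
    assert (HC : 0 < C).
    { unfold C. apply Rmult_lt_0_compat; [nra|apply exp_pos]. }
    assert (Lip : forall t, Rabs (v t - v s) <= C * Rabs (t - s)).
    { intros t. unfold v.
      destruct (HTh kk alpha (c (cl t))) as [P1 A1].
      destruct (HTh kk alpha (c (cl s))) as [P2 A2].
      replace (C * Rabs (t - s)) with (kk * (2 * Rabs (t - s) * B) * exp (1 + 2 * kk * 1)) by (unfold C; ring).
      apply (phase_compare kk (w (c (cl t))) (w (c (cl s))) _ _ a b); auto; try lra.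
      - generalize (Rabs_pos (t - s)). nra.
      - intros x _. apply Wd. intros i Hi.
        eapply Rle_trans; [apply Hclip; auto|]. generalize (Hcll t s). lra. }
    apply continuity_pt_filterlim. intros e He.
    exists (e / C). split; [apply Rdiv_lt_0_compat; lra|].
    intros t [_ Ht]. simpl in *. unfold R_dist in *.
    eapply Rle_lt_trans; [apply Lip|].
    apply Rmult_lt_reg_r with (/ C); [now apply Rinv_0_lt_compat|].
    replace (C * Rabs (t - s) * / C) with (Rabs (t - s)) by (field; lra). exact Ht. }
  { (* the phase gained at s0 is at least kk s0 / 4 - O(1) *)
    assert (V0 : v 0 = alpha + kk * (b - a)).
    { unfold v. rewrite Hcl2 by lra.
      destruct (HTh kk alpha (c 0)) as [P1 A1].
      rewrite (phase_unique kk (w (c 0)) (fun _ => 0) (Th kk alpha (c 0))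
        (fun x => kk * x + (alpha - kk * a)) a b 0); auto.
      - ring.
      - lra.
      - apply free_phase.
      - rewrite A1. ring.
      - intros x _. destruct (Hc 0 ltac:(lra)) as [_ [Hc0 _]].
        assert (E : Rabs (w (c 0) x) <= 2 * 0 * B) by (apply Wb; auto).
        rewrite Rmult_0_r, Rmult_0_l in E.
        destruct (Req_dec (w (c 0) x) 0) as [Z|Z]; [exact Z|].
        apply Rabs_pos_lt in Z. lra.
      - intros x _. rewrite Rabs_R0; lra. }
    rewrite V0. unfold v. rewrite Hcl2 by lra.
    destruct (HTh kk alpha (c s0)) as [P1 A1].
    destruct (Hc s0 ltac:(lra)) as [C0 [C1 _]].
    assert (NW := Wn (c s0) (2 * s0) C1).
    assert (G := phase_gain kk (w (c s0)) (Th kk alpha (c s0)) a b (2 * s0 * B) M'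
       Hkk ltac:(lra) (Ws _) (Wsup _)
       (fun x => norm_le_0 _ _ _ x NW)
       (fun x => norm_le_0 _ _ _ x (proj2 (proj2 NW))) P1).
    rewrite Wi0, C0, A1 in G.
    assert (Q1 : (2 * s0 * B) ^ 2 <= s0 / 2).
    { replace ((2 * s0 * B) ^ 2) with (8 * B ^ 2 * s0 * (s0 / 2)) by field. nra. }
    assert (HM' : 0 <= M') by (unfold M'; nra).
    assert (Q2 : (b - a) * (kk * (2 * s0 * B) ^ 2 / 2 + M' / 4) <= kk * s0 / 4 + M' / 4).
    { assert (kk * (2 * s0 * B) ^ 2 / 2 <= kk * s0 / 4) by nra.
      assert (0 <= kk * (2 * s0 * B) ^ 2 / 2).
      { apply Rmult_le_pos; [|lra]. apply Rmult_le_pos; [lra|apply pow2_ge_0]. }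
      nra. }
    assert (Q3 : PI + M' / 4 <= kk * s0 / 4).
    { apply Rmult_le_compat_l with (r := s0 / 4) in Hk0; [|lra].
      replace (s0 / 4 * (4 / s0 * (PI + M' / 4))) with (PI + M' / 4) in Hk0 by (field; lra).
      lra. }
    lra. }
  exists (w (c s)). destruct (Hc s Hs) as [C0 [C1 C2]].
  split; [apply Ws|]. split; [apply Wsup|]. split; [|split].
  - apply norm_le_order with (S N); [lia|].
    apply norm_le_weaken with (2 * s * B); [nra|]. now apply Wn.
  - intros j th Hj Hth Ha.
    destruct (HTh (k j) (k j * a + psi j) (c s)) as [P1 A1].
    rewrite (phase_unique (k j) (w (c s)) (w (c s)) th (Th (k j) (k j * a + psi j) (c s)) a b 1); auto.
    + assert (E := C2 (S j) ltac:(lia)). unfold Rm in E. rewrite C0 in E.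
      assert (Hkj := Hk j Hj).
      assert (Z : 2 / k j * (Th (k j) (k j * a + psi j) (c s) b - (k j * b + psi j)) = 0) by lra.
      apply Rmult_integral in Z. destruct Z as [Z|Z]; [|lra].
      assert (0 < 2 / k j) by (apply Rdiv_lt_0_compat; lra). lra.
    + lra.
    + congruence.
    + intros x _. rewrite <- (Hcl2 s Hs). apply Wc1.
  - exists (Th kk alpha (c s)). destruct (HTh kk alpha (c s)) as [P1 A1].
    split; [exact P1|]. split; [exact A1|].
    unfold v in Hsin. now rewrite Hcl2 in Hsin.
Qed.

(** * The fixed part of the conformal factor *)

Lemma bump_zero a b x : x <= a \/ b <= x -> bump a b x = 0.
Proof.
  intros Hx. unfold bump, flat_exp.
  destruct (Rlt_dec 0 (x - a)); destruct (Rlt_dec 0 (b - x)); try lra; ring.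
Qed.

Lemma bump_continuous a b x : continuous (bump a b) x.
Proof. apply smooth1_continuous, bump_smooth. Qed.

Lemma bump_integral_pos a b : a < b -> 0 < integral (bump a b) a b.
Proof.
  intros Hab. apply integral_pos with ((a + b) / 2).
  - apply bump_continuous.
  - apply bump_nonneg.
  - lra.
  - apply bump_pos; lra.
Qed.

Lemma smooth_step a b : a < b -> exists S,
  smooth1 S /\ (forall x, 0 <= S x <= 1) /\
  (forall x, x <= a -> S x = 0) /\ (forall x, b <= x -> S x = 1).
Proof.
  intros Hab.
  set (q := integral (bump a b) a b). assert (Hq : 0 < q) by now apply bump_integral_pos.
  assert (D : forall x, is_derive (fun x => / q * integral (bump a b) a x) x (/ q * bump a b x)).
  { intros x. apply (is_derive_scal (fun x => integral (bump a b) a x)).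
    apply integral_derive, bump_continuous. }
  assert (Ea : / q * integral (bump a b) a a = 0) by (rewrite integral_point; ring).
  assert (Eb : / q * integral (bump a b) a b = 1) by (fold q; field; lra).
  assert (Hi : 0 < / q) by now apply Rinv_0_lt_compat.
  assert (L : forall x, x <= a -> / q * integral (bump a b) a x = 0).
  { intros x Hx. rewrite <- Ea.
    apply (derive_zero_eq (fun x => / q * integral (bump a b) a x)); [exact Hx|].
    intros y Hy. evar_last; [apply D|]. rewrite bump_zero by lra. ring. }
  assert (R : forall x, b <= x -> / q * integral (bump a b) a x = 1).
  { intros x Hx. rewrite <- Eb. symmetry.
    apply (derive_zero_eq (fun x => / q * integral (bump a b) a x)); [exact Hx|].
    intros y Hy. evar_last; [apply D|]. rewrite bump_zero by lra. ring. }
  exists (fun x => / q * integral (bump a b) a x). split; [|split; [|split]]; auto.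
  - apply smooth1_primitive with (fun x => / q * bump a b x); [exact D|].
    apply smooth1_scal, bump_smooth.
  - intros x.
    assert (I : forall u v, u <= v -> / q * integral (bump a b) a u <= / q * integral (bump a b) a v).
    { intros u v Huv. apply (derive_nonneg_incr (fun x => / q * integral (bump a b) a x)
        (fun x => / q * bump a b x)); auto.
      intros y _. generalize (bump_nonneg a b y). nra. }
    split.
    + destruct (Rle_dec x a); [rewrite L; lra|]. rewrite <- Ea. apply I; lra.
    + destruct (Rle_dec b x); [rewrite R; lra|]. rewrite <- Eb. apply I; lra.
Qed.

(** This is U without its perturbations: it leaves [0, 1/8] free for the
    oscillations and equals 1 where the phases of the free equation are
    explicit. *)
Lemma plateau_exists : exists P, smooth1 P /\ even_periodic P /\
  (forall x, 0 <= P x <= 1) /\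
  (forall x, 0 <= x <= 1 / 8 -> P x = 0) /\ (forall x, 1 / 4 <= x <= 1 / 2 -> P x = 1).
Proof.
  destruct (smooth_step (1 / 8) (1 / 4)) as [S [HS [HB [H0 H1]]]]; [lra|].
  set (h := fun x => S x * S (1 - x)).
  assert (Hh : smooth1 h).
  { apply smooth1_mult; [exact HS|].
    apply smooth1_ext with (fun x => S (-1 * x + 1)); [intros; f_equal; ring|].
    now apply smooth1_affine. }
  assert (Hs : supported (1 / 8) (7 / 8) h).
  { intros x [Hx|Hx]; unfold h; [rewrite (H0 x)|rewrite (H0 (1 - x))]; lra. }
  exists (fun x => h (frac x)). split; [|split; [|split; [|split]]].
  - apply periodize_smooth with (1 / 8) (7 / 8); auto; lra.
  - apply symmetric_even_periodic.
    + apply Hs; lra.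
    + intros x; unfold h. replace (1 - (1 - x)) with x by ring. ring.
  - intros x. unfold h. generalize (HB (frac x)) (HB (1 - frac x)). nra.
  - intros x Hx. rewrite frac_id by lra. unfold h. rewrite H0 by lra. ring.
  - intros x Hx. rewrite frac_id by lra. unfold h. rewrite !H1 by lra. ring.
Qed.

Definition lft (m : nat) : R := (1 / 2) ^ (m + 4).
Definition rgt (m : nat) : R := (1 / 2) ^ (m + 3).

Lemma pow_half_le m n : (m <= n)%nat -> (1 / 2) ^ n <= (1 / 2) ^ m.
Proof.
  intros H. replace n with (m + (n - m))%nat by lia. rewrite pow_add.
  assert (0 < (1 / 2) ^ m) by (apply pow_lt; lra).
  assert ((1 / 2) ^ (n - m) <= 1 ^ (n - m)) by (apply pow_incr; lra).
  rewrite pow1 in *. nra.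
Qed.

Lemma lft_S m : lft m = rgt (S m).
Proof. unfold lft, rgt. f_equal. lia. Qed.

Lemma lft_rgt m : 0 < lft m < rgt m.
Proof.
  unfold lft, rgt. assert (0 < (1 / 2) ^ (m + 3)) by (apply pow_lt; lra).
  replace (m + 4)%nat with (S (m + 3)) by lia. simpl. lra.
Qed.

Lemma rgt_le m : rgt m <= 1 / 8.
Proof.
  unfold rgt. replace (1 / 8) with ((1 / 2) ^ 3) by (simpl; lra). apply pow_half_le; lia.
Qed.

Lemma rgt_lft m n : (m < n)%nat -> rgt n <= lft m.
Proof. intros H. unfold rgt, lft. apply pow_half_le; lia. Qed.

Lemma bump_disjoint m n x : m <> n -> lft m <= x <= rgt m -> bump (lft n) (rgt n) x = 0.
Proof.
  intros Hmn Hx. apply bump_zero.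
  destruct (Nat.lt_ge_cases m n).
  - right. generalize (rgt_lft m n H). lra.
  - left. assert (Q : (n < m)%nat) by lia. generalize (rgt_lft n m Q). lra.
Qed.

(** Bumps of alternating sign on the blocks [lft m, rgt m], which accumulate at
    0.  The amplitudes are chosen one after the other: small in C^m for the sake
    of smoothness, and so small that the m-th bump has more mass than everything
    on [0, lft m]. *)
Lemma oscillation_exists : exists (U : R -> R) (eps : nat -> R),
  smooth1 U /\ even_periodic U /\ (forall x, Rabs (U x) <= 1 / 4) /\
  (forall x, 1 / 8 <= x <= 1 / 2 -> U x = 0) /\
  (forall m, 0 < eps m) /\
  (forall m x, lft m <= x <= rgt m -> U x = (-1) ^ m * eps m * bump (lft m) (rgt m) x) /\
  (forall m, 4 * eps (S m) < eps m * integral (bump (lft m) (rgt m)) (lft m) (rgt m)) /\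
  (forall m x, 0 <= x <= lft m -> Rabs (U x) <= eps (S m)).
Proof.
  set (be := fun m => bump (lft m) (rgt m)).
  destruct (choose_fun _ _ _ (fun m => supported_norm (lft m) (rgt m) (be m) m
    (bump_smooth _ _) (bump_supported _ _))) as [B HB].
  set (q := fun m => integral (be m) (lft m) (rgt m)).
  assert (Hq : forall m, 0 < q m).
  { intros m. apply bump_integral_pos, lft_rgt. }
  assert (Hq1 : forall m, q m <= 1).
  { intros m. unfold q.
    assert (G : Rabs (integral (be m) (lft m) (rgt m) - integral (be m) (lft m) (lft m)) <= 1 * (rgt m - lft m)).
    { apply (derive_bound_lip (fun x => integral (be m) (lft m) x) (be m)).
      - generalize (lft_rgt m); lra.
      - intros x _. apply integral_derive, bump_continuous.
      - intros x _. rewrite Rabs_right; [apply bump_le_1|apply Rle_ge, bump_nonneg]. }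
    rewrite integral_point in G. apply Rabs_le_between in G.
    generalize (lft_rgt m) (rgt_le m). lra. }
  set (delta := fun m => 1 / 8 * (1 / 2) ^ m / (2 * B m)).
  assert (Hdelta : forall m, 0 < delta m).
  { intros m. apply Rdiv_lt_0_compat; [|generalize (proj1 (HB m)); lra].
    apply Rmult_lt_0_compat; [lra|apply pow_lt; lra]. }
  set (eps := nat_rect (fun _ => R) (delta 0%nat) (fun m e => Rmin (delta (S m)) (e * q m / 8))).
  assert (ES : forall m, eps (S m) = Rmin (delta (S m)) (eps m * q m / 8)) by reflexivity.
  assert (Hpos : forall m, 0 < eps m).
  { induction m as [|m IH]; [apply Hdelta|]. rewrite ES. apply Rmin_glb_lt; [apply Hdelta|].
    generalize (Hq m). intros. apply Rdiv_lt_0_compat; [nra|lra]. }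
  assert (Hle : forall m, eps m <= delta m).
  { destruct m as [|m]; [apply Rle_refl|]. rewrite ES. apply Rmin_l. }
  assert (Hdec : forall m, eps (S m) <= eps m * q m / 8) by (intros m; rewrite ES; apply Rmin_r).
  assert (Hmono : forall m n, (m <= n)%nat -> eps n <= eps m).
  { intros m n H. induction H as [|n H IH]; [lra|].
    generalize (Hdec n) (Hpos n) (Hq1 n) (Hq n). nra. }
  set (g := fun m x => (-1) ^ m * eps m * be m x).
  assert (Hsgn : forall m, Rabs ((-1) ^ m * eps m) = eps m).
  { intros m. rewrite Rabs_mult, pow_1_abs, Rmult_1_l. apply Rabs_right. generalize (Hpos m); lra. }
  assert (Hg : forall m, smooth1 (unfold_circle (g m)) /\ even_periodic (unfold_circle (g m)) /\
     norm_le m (1 / 8 * (1 / 2) ^ m) (unfold_circle (g m))).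
  { intros m.
    assert (Bm := proj1 (HB m)).
    replace (1 / 8 * (1 / 2) ^ m) with (delta m * B m + delta m * B m) by (unfold delta; field; lra).
    apply unfold_circle_spec with (lft m) (rgt m).
    - apply smooth1_scal, bump_smooth.
    - apply lft_rgt.
    - generalize (rgt_le m); lra.
    - intros x Hx. unfold g, be. rewrite bump_supported by exact Hx. ring.
    - apply norm_le_weaken with (Rabs ((-1) ^ m * eps m) * B m).
      + rewrite Hsgn. generalize (Hle m). nra.
      + apply norm_le_scal, HB. }
  assert (Hval : forall m x, 0 <= x <= 1 / 2 -> unfold_circle (g m) x = g m x).
  { intros m x Hx. apply unfold_circle_eq with (lft m) (rgt m); auto.
    - generalize (rgt_le m); lra.
    - intros y Hy. unfold g, be. rewrite bump_supported by exact Hy. ring. }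
  assert (Hgabs : forall m x, Rabs (g m x) <= eps m).
  { intros m x. unfold g. rewrite Rabs_mult, Hsgn.
    assert (be m x <= 1) by apply bump_le_1. assert (0 <= be m x) by apply bump_nonneg.
    rewrite Rabs_right by lra. generalize (Hpos m). nra. }
  set (U := fun x => Series (fun m => unfold_circle (g m) x)).
  assert (HJ : forall m x, lft m <= x <= rgt m -> U x = g m x).
  { intros m x Hx. unfold U.
    assert (Hx2 : 0 <= x <= 1 / 2) by (generalize (lft_rgt m) (rgt_le m); lra).
    rewrite (Series_single _ m).
    - now apply Hval.
    - intros n Hn. rewrite Hval by exact Hx2. unfold g, be. rewrite (bump_disjoint m n); auto. ring. }
  exists U, eps. split; [|split; [|split; [|split; [|split; [|split; [|split]]]]]].
  - apply Series_smooth with (1 / 8); intros m; apply Hg.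
  - split; intros x; unfold U; apply Series_ext; intros m; apply (Hg m).
  - intros x. replace (1 / 4) with (2 * (1 / 8)) by field. apply Series_half_bound.
    intros m. apply (norm_le_0 m). apply Hg.
  - intros x Hx. apply Series_zero. intros m. rewrite Hval by lra. unfold g, be.
    rewrite bump_zero; [ring|]. generalize (rgt_le m); lra.
  - exact Hpos.
  - exact HJ.
  - intros m. generalize (Hdec m) (Hpos m) (Hq m). change (integral (bump (lft m) (rgt m)) (lft m) (rgt m)) with (q m). nra.
  - intros m x Hx.
    assert (Hx2 : 0 <= x <= 1 / 2) by (generalize (lft_rgt m) (rgt_le m); lra).
    destruct (classic (exists n, be n x <> 0)) as [[n Hn]|Hn].
    + assert (Hxn : lft n <= x <= rgt n).
      { destruct (Rle_dec (lft n) x) as [L|L].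
        - split; [exact L|]. destruct (Rle_dec x (rgt n)); [auto|].
          exfalso; apply Hn; apply bump_zero; lra.
        - exfalso; apply Hn; apply bump_zero; lra. }
      assert (Hmn : (m < n)%nat).
      { apply Nat.nle_gt. intros Q. apply Hn.
        destruct (Nat.eq_dec n m) as [->|E].
        - apply bump_zero; lra.
        - assert (Q' : (n < m)%nat) by lia.
          apply bump_zero. left. generalize (rgt_lft n m Q') (lft_rgt m). lra. }
      rewrite (HJ n x Hxn). eapply Rle_trans; [apply Hgabs|]. apply Hmono; lia.
    + replace (U x) with 0; [rewrite Rabs_R0; left; apply Hpos|].
      symmetry. apply Series_zero. intros n. rewrite Hval by auto. unfold g.
      destruct (Req_dec (be n x) 0) as [->|E]; [ring|]. exfalso; apply Hn; eauto.
Qed.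

(** * From phases to solutions of the linear equation *)

(** The amplitude is rho = exp (int k (U - 1) sin th cos th); the derivative of
    rho cos th is then - k rho sin th. *)
Lemma solution_of_phase U k th :
  smooth1 U -> is_phase k (fun x => U x - 1) th -> th 0 = 0 ->
  exists f, smooth1 f /\ f 0 = 1 /\ Derive f 0 = 0 /\
    (forall x, is_derive (Derive f) x (- k ^ 2 * U x * f x)) /\
    (sin (th (1 / 2)) = 0 -> Derive f (1 / 2) = 0).
Proof.
  intros HU Hth H0.
  assert (Cth : forall x, continuous th x).
  { intros x. apply (ex_derive_continuous th x). eexists; apply Hth. }
  set (a := fun x => k * (U x - 1) * (sin (th x) * cos (th x))).
  assert (Ca : forall x, continuous a x).
  { intros x. apply (continuous_mult (fun x => k * (U x - 1)) (fun x => sin (th x) * cos (th x))).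
    - apply smooth1_continuous. apply smooth1_scal.
      apply (smooth1_plus U (fun _ => - (1))); [exact HU|apply smooth1_const].
    - apply (continuous_comp th (fun z => sin z * cos z)); [apply Cth|].
      apply (ex_derive_continuous (fun z => sin z * cos z)). now auto_derive. }
  set (rho := fun x => exp (integral a 0 x)).
  assert (Drho : forall x, is_derive rho x (a x * rho x)).
  { intros x. unfold rho. apply (is_derive_comp exp (fun x => integral a 0 x)).
    - apply is_derive_exp.
    - now apply integral_derive. }
  set (f := fun x => rho x * cos (th x)).
  assert (D1 : forall x, is_derive f x (- k * (rho x * sin (th x)))).
  { intros x. generalize (Drho x) (Hth x). intros E1 E2. unfold f. auto_derive.
    - split; [exists (a x * rho x); exact E1|]. split; [|exact I].
      exists (k * (1 + (U x - 1) * cos (th x) ^ 2)); exact E2.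
    - change (Derive (fun x => rho x) x) with (Derive rho x).
      change (Derive (fun x => th x) x) with (Derive th x).
      apply is_derive_unique in E1. apply is_derive_unique in E2. rewrite E1, E2.
      unfold a.
      (* multiply by sin^2 + cos^2 = 1 to make it an identity of polynomials *)
      replace (- k * (rho x * sin (th x))) with
        (- k * rho x * sin (th x) * ((sin (th x))² + (cos (th x))² + (cos (th x))^2 - (cos (th x)) ^ 2))
        by (rewrite sin2_cos2; ring).
      rewrite sin2_cos2. ring. }
  assert (E1 : Derive f = fun x => - k * (rho x * sin (th x))) by now apply Derive_fun.
  assert (D2 : forall x, is_derive (Derive f) x (- k ^ 2 * U x * f x)).
  { intros x. rewrite E1. generalize (Drho x) (Hth x). intros F1 F2. unfold f. auto_derive.
    - split; [exists (a x * rho x); exact F1|]. split; [|exact I].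
      exists (k * (1 + (U x - 1) * cos (th x) ^ 2)); exact F2.
    - change (Derive (fun x => rho x) x) with (Derive rho x).
      change (Derive (fun x => th x) x) with (Derive th x).
      apply is_derive_unique in F1. apply is_derive_unique in F2. rewrite F1, F2.
      unfold a.
      assert (S : sin (th x) * sin (th x) = 1 - cos (th x) * cos (th x)).
      { generalize (sin2_cos2 (th x)). unfold Rsqr. lra. }
      match goal with |- ?l = _ => replace l with
        (- k ^ 2 * rho x * cos (th x) * ((U x - 1) * (sin (th x) * sin (th x)) + (1 + (U x - 1) * cos (th x) ^ 2)))
        by ring end.
      rewrite S. ring. }
  exists f. split; [|split; [|split; [|split]]]; auto.
  - apply smooth1_of_ode with (fun x => - k ^ 2 * U x).
    + now apply smooth1_scal.
    + intros x; eexists; apply D1.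
    + exact D2.
  - unfold f, rho. rewrite H0, integral_point, exp_0, cos_0. ring.
  - rewrite E1, H0, sin_0. ring.
  - intros Hs. rewrite E1, Hs. ring.
Qed.

(** The energy d^2 + d'^2 grows at most exponentially, so it stays 0. *)
Lemma linear_unique (d q : R -> R) c M :
  (forall x, ex_derive d x) -> (forall x, is_derive (Derive d) x (q x * d x)) ->
  (forall x, Rabs (q x) <= M) -> d c = 0 -> Derive d c = 0 ->
  forall x, c <= x -> d x = 0.
Proof.
  intros H1 H2 HM Hc Hc' x Hx.
  set (L := 1 + M).
  set (E := fun x => (d x ^ 2 + Derive d x ^ 2) * exp (- L * (x - c))).
  assert (HE : 0 - E c <= 0 - E x).
  { apply (derive_nonneg_incr (fun x => 0 - E x) (fun x =>
      - ((2 * d x * Derive d x * (1 + q x) - L * (d x ^ 2 + Derive d x ^ 2)) * exp (- L * (x - c)))));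
      [exact Hx| |].
    - intros y _. unfold E.
      assert (D1 : is_derive d y (Derive d y)) by now apply Derive_correct.
      generalize (H2 y). intros D2. auto_derive.
      + split; [exists (Derive d y); exact D1|].
        split; [exists (q y * d y); exact D2|exact I].
      + change (Derive (fun x => d x) y) with (Derive d y).
        change (Derive (fun x => Derive (fun x => d x) x) y) with (Derive (Derive d) y).
        apply is_derive_unique in D2.
        change (Derive (fun x => Derive d x) y) with (Derive (Derive d) y).
        rewrite D2. unfold Rminus. ring.
    - intros y _. set (u := d y). set (v := Derive d y).
      assert (Q : 2 * u * v * (1 + q y) <= L * (u ^ 2 + v ^ 2)).
      { assert (A : Rabs (1 + q y) <= L).
        { eapply Rle_trans; [apply Rabs_triang|]. rewrite Rabs_R1. unfold L.
          generalize (HM y). lra. }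
        apply Rle_trans with (Rabs (2 * u * v) * Rabs (1 + q y)).
        - rewrite <- Rabs_mult. apply Rle_abs.
        - assert (B : Rabs (2 * u * v) <= u ^ 2 + v ^ 2).
          { apply Rabs_le. generalize (pow2_ge_0 (u - v)) (pow2_ge_0 (u + v)). lra. }
          rewrite (Rmult_comm L). apply Rmult_le_compat; auto; apply Rabs_pos. }
      generalize (exp_pos (- L * (y - c))). nra. }
  unfold E in HE. rewrite Hc, Hc' in HE.
  assert (G := exp_pos (- L * (x - c))).
  generalize (pow2_ge_0 (d x)) (pow2_ge_0 (Derive d x)). intros P1 P2.
  assert (Z : d x ^ 2 = 0) by nra. simpl in Z. nra.
Qed.

(** The difference of f and its reflection solves the same equation, with zero
    initial data at the centre. *)
Lemma solution_reflect f q c M :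
  smooth1 f -> (forall x, is_derive (Derive f) x (q x * f x)) ->
  (forall x, Rabs (q x) <= M) -> (forall x, q (2 * c - x) = q x) ->
  Derive f c = 0 -> forall x, f (2 * c - x) = f x.
Proof.
  intros Hf H2 HM Hq Hc.
  set (d := fun x => f x - f (2 * c - x)).
  assert (R1 : forall (g : R -> R) x l, is_derive g (2 * c - x) l -> is_derive (fun x => g (2 * c - x)) x (- l)).
  { intros g x l Hg. evar_last.
    - apply (is_derive_comp g (fun x => 2 * c - x)); [exact Hg|].
      auto_derive; [exact I|reflexivity].
    - unfold scal; simpl; unfold mult; simpl; ring. }
  assert (D1 : forall x, is_derive d x (Derive f x + Derive f (2 * c - x))).
  { intros x. replace (Derive f x + Derive f (2 * c - x)) with (Derive f x - (- Derive f (2 * c - x))) by ring.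
    apply (is_derive_minus f (fun x => f (2 * c - x))); [now apply smooth1_derive|].
    apply R1. now apply smooth1_derive. }
  assert (E1 := Derive_fun _ _ D1).
  assert (D2 : forall x, is_derive (Derive d) x (q x * d x)).
  { intros x. rewrite E1. unfold d.
    replace (q x * (f x - f (2 * c - x))) with (q x * f x + - (q (2 * c - x) * f (2 * c - x)))
      by (rewrite Hq; ring).
    apply (is_derive_plus (Derive f) (fun x => Derive f (2 * c - x))); [apply H2|].
    apply R1, H2. }
  assert (Z : forall x, c <= x -> d x = 0).
  { apply linear_unique with q M; auto.
    - intros x; eexists; apply D1.
    - unfold d. replace (2 * c - c) with c by ring. ring.
    - rewrite E1. replace (2 * c - c) with c by ring. rewrite Hc. ring. }
  intros x. destruct (Rle_dec c x) as [L|L].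
  - generalize (Z x L). unfold d. lra.
  - assert (L' : c <= 2 * c - x) by lra.
    generalize (Z _ L'). unfold d. replace (2 * c - (2 * c - x)) with x by ring. lra.
Qed.

(** * Infinitely many zeros of the derivative *)

Lemma is_lim_seq_rgt : is_lim_seq rgt 0.
Proof.
  unfold rgt. apply (is_lim_seq_incr_n (fun m => (1 / 2) ^ m) 3 0).
  apply is_lim_seq_geom. rewrite Rabs_right; lra.
Qed.

(** Where 1/2 <= f <= 2, the change of f' across the m-th block is at least
    k^2 eps_m q_m / 2 in absolute value, q_m being the mass of the bump, and
    |f'(lft m)| <= 2 k^2 eps_(m+1) is less.  So f' has the sign - (-1)^m at rgt m,
    and the opposite sign at lft m, which is rgt (m+1). *)
Lemma derivative_zeros (U f : R -> R) (eps : nat -> R) k :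
  0 < k -> smooth1 f -> f 0 = 1 -> Derive f 0 = 0 ->
  (forall x, is_derive (Derive f) x (- k ^ 2 * U x * f x)) ->
  (forall m, 0 < eps m) ->
  (forall m x, lft m <= x <= rgt m -> U x = (-1) ^ m * eps m * bump (lft m) (rgt m) x) ->
  (forall m, 4 * eps (S m) < eps m * integral (bump (lft m) (rgt m)) (lft m) (rgt m)) ->
  (forall m x, 0 <= x <= lft m -> Rabs (U x) <= eps (S m)) ->
  exists m0, forall m, (m0 <= m)%nat ->
    exists x, lft m < x < rgt m /\ Derive f x = 0 /\ U x <> 0 /\ f x <> 0.
Proof.
  intros Hk Hf H0 H0' H2 Hpos HJ Hdec Hsm.
  assert (Hloc : exists r, 0 < r /\ forall x, 0 <= x <= r -> 1 / 2 <= f x <= 2).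
  { assert (Hl : locally 0 (fun x => 1 / 2 < f x /\ f x < 2)).
    { apply filter_and.
      - apply (smooth1_continuous f 0 Hf (fun y => 1 / 2 < y)). apply (open_gt (1 / 2)). lra.
      - apply (smooth1_continuous f 0 Hf (fun y => y < 2)). apply (open_lt 2). lra. }
    destruct Hl as [e He]. exists (e / 2). pose proof (cond_pos e). split; [lra|].
    intros x Hx. assert (1 / 2 < f x /\ f x < 2); [|lra].
    apply He. unfold ball; simpl; unfold AbsRing_ball, abs, minus, plus, opp; simpl.
    rewrite Rabs_right; lra. }
  destruct Hloc as [r [Hr Hfr]].
  assert (Hm0 : exists m0, forall m, (m0 <= m)%nat -> rgt m <= r).
  { generalize is_lim_seq_rgt. intros L. apply is_lim_seq_spec in L.
    destruct (L (mkposreal r Hr)) as [N HN]. exists N. intros m Hm.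
    specialize (HN m Hm). simpl in HN. rewrite Rminus_0_r in HN.
    generalize (Rle_abs (rgt m)). lra. }
  destruct Hm0 as [m0 Hm0].
  assert (Hk2 : 0 < k ^ 2) by (apply pow_lt; lra).
  set (D := fun m x => (-1) ^ m * Derive f x).
  assert (Hsq : forall m, (-1) ^ m * (-1) ^ m = 1).
  { intros m. rewrite <- Rpow_mult_distr. replace (-1 * -1) with 1 by ring. apply pow1. }
  (* the last block before rgt m decides the sign of the derivative there *)
  assert (Hsign : forall m, (m0 <= m)%nat -> D m (rgt m) < 0).
  { intros m Hm.
    assert (HL := lft_rgt m). assert (HR := rgt_le m). specialize (Hm0 m Hm).
    assert (B1 : Rabs (Derive f (lft m) - Derive f 0) <= k ^ 2 * eps (S m) * 2 * (lft m - 0)).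
    { apply derive_bound_lip with (fun x => - k ^ 2 * U x * f x); [lra| |].
      - intros; apply H2.
      - intros x Hx. rewrite !Rabs_mult, Rabs_Ropp, (Rabs_right (k ^ 2)) by lra.
        assert (F := Hfr x ltac:(lra)). rewrite (Rabs_right (f x)) by lra.
        assert (Q := Hsm m x Hx). assert (Q' := Rabs_pos (U x)).
        apply Rmult_le_compat; try lra; [apply Rmult_le_pos; lra|].
        apply Rmult_le_compat_l; lra. }
    rewrite H0', Rminus_0_r in B1.
    assert (B2 : - D m (lft m) - k ^ 2 / 2 * eps m * integral (bump (lft m) (rgt m)) (lft m) (lft m)
       <= - D m (rgt m) - k ^ 2 / 2 * eps m * integral (bump (lft m) (rgt m)) (lft m) (rgt m)).
    { apply (derive_nonneg_incr (fun x => - D m x - k ^ 2 / 2 * eps m * integral (bump (lft m) (rgt m)) (lft m) x)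
        (fun x => - ((-1) ^ m * (- k ^ 2 * U x * f x)) - k ^ 2 / 2 * eps m * bump (lft m) (rgt m) x)); [lra| |].
      - intros x _. unfold D.
        apply (is_derive_minus (fun x => - ((-1) ^ m * Derive f x))
          (fun x => k ^ 2 / 2 * eps m * integral (bump (lft m) (rgt m)) (lft m) x)).
        + apply (is_derive_opp (fun x => (-1) ^ m * Derive f x)).
          apply (is_derive_scal (Derive f)). apply H2.
        + apply (is_derive_scal (fun x => integral (bump (lft m) (rgt m)) (lft m) x)).
          apply integral_derive, bump_continuous.
      - intros x Hx. rewrite (HJ m x Hx).
        replace (- ((-1) ^ m * (- k ^ 2 * ((-1) ^ m * eps m * bump (lft m) (rgt m) x) * f x))) with
          (((-1) ^ m * (-1) ^ m) * (k ^ 2 * eps m * bump (lft m) (rgt m) x * f x)) by ring.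
        rewrite Hsq.
        assert (F := Hfr x ltac:(lra)). assert (Q := bump_nonneg (lft m) (rgt m) x). specialize (Hpos m).
        assert (0 <= k ^ 2 * eps m * bump (lft m) (rgt m) x).
        { apply Rmult_le_pos; [apply Rmult_le_pos; lra|exact Q]. }
        nra. }
    rewrite integral_point, Rmult_0_r, Rminus_0_r in B2.
    assert (B3 : D m (lft m) <= Rabs (Derive f (lft m))).
    { unfold D. eapply Rle_trans; [apply Rle_abs|]. rewrite Rabs_mult, pow_1_abs. lra. }
    assert (B4 := Hdec m). assert (P1 := Hpos m). assert (P2 := Hpos (S m)).
    set (q := integral (bump (lft m) (rgt m)) (lft m) (rgt m)) in *.
    assert (B5 : k ^ 2 * eps (S m) * 2 * lft m <= k ^ 2 * eps (S m) * 2).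
    { assert (0 <= k ^ 2 * eps (S m)) by (apply Rmult_le_pos; lra). nra. }
    assert (B6 : k ^ 2 * (4 * eps (S m)) < k ^ 2 * (eps m * q)) by (apply Rmult_lt_compat_l; lra).
    lra. }
  exists m0. intros m Hm.
  assert (HL := lft_rgt m).
  assert (S1 := Hsign m Hm). assert (S2 := Hsign (S m) ltac:(lia)).
  rewrite <- lft_S in S2.
  assert (S3 : 0 < D m (lft m)) by (unfold D in *; simpl in S2; lra).
  destruct (IVT_gen (D m) (lft m) (rgt m) 0) as [x [Hx Ex]].
  - intros x. apply continuity_pt_filterlim. unfold D.
    apply (continuous_scal_r ((-1) ^ m) (Derive f)). apply smooth1_continuous. now apply smooth1_Derive.
  - rewrite Rmin_right, Rmax_left by lra. lra.
  - rewrite Rmin_left, Rmax_right in Hx by lra.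
    assert (x <> lft m) by (intros ->; lra). assert (x <> rgt m) by (intros ->; lra).
    assert (Hx' : lft m < x < rgt m) by lra.
    exists x. split; [exact Hx'|]. split; [|split].
    + unfold D in Ex. apply Rmult_integral in Ex. destruct Ex as [E|E]; [|exact E].
      generalize (Hsq m). rewrite E. lra.
    + rewrite (HJ m x Hx).
      assert (Q := bump_pos (lft m) (rgt m) x Hx'). specialize (Hpos m).
      assert ((-1) ^ m <> 0) by (intros E; generalize (Hsq m); rewrite E; lra).
      apply Rmult_integral_contrapositive_currified; [apply Rmult_integral_contrapositive_currified|]; lra.
    + assert (F := Hfr x). generalize (Hm0 m Hm). lra.
Qed.

Lemma simple_zero_isolated (g : R -> R) x l :
  is_derive g x l -> l <> 0 -> g x = 0 -> locally x (fun y => g y = 0 -> y = x).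
Proof.
  intros Hd Hl Hg.
  apply is_derive_Reals in Hd.
  destruct (Hd (Rabs l)) as [e He]; [now apply Rabs_pos_lt|].
  exists e. cut (forall y : R, Rabs (y - x) < e -> g y = 0 -> y = x); [auto|].
  intros y Hy Hgy. apply NNPP. intros Hne.
  assert (H := He (y - x) ltac:(lra) Hy).
  replace (x + (y - x)) with y in H by ring. rewrite Hgy, Hg in H.
  replace ((0 - 0) / (y - x) - l) with (- l) in H by (field; lra).
  rewrite Rabs_Ropp in H. lra.
Qed.

(** * Inductive construction of the conformal factor *)

Definition node (n : nat) : R := 1 / 2 - (1 / 2) ^ (n + 2).
Definition freq (K : nat) : R := 2 * PI * INR K.

Lemma node_bounds n : 1 / 4 <= node n < 1 / 2.
Proof.
  unfold node. assert (0 < (1 / 2) ^ (n + 2)) by (apply pow_lt; lra).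
  assert ((1 / 2) ^ (n + 2) <= (1 / 2) ^ 2) by (apply pow_half_le; lia). simpl in *. lra.
Qed.

Lemma node_lt n : node n < node (S n).
Proof.
  unfold node. replace (S n + 2)%nat with (S (n + 2)) by lia. simpl.
  assert (0 < (1 / 2) ^ (n + 2)) by (apply pow_lt; lra). lra.
Qed.

Lemma node_le m n : (m <= n)%nat -> node m <= node n.
Proof. intros H. unfold node. generalize (pow_half_le (m + 2) (n + 2) ltac:(lia)). lra. Qed.

Lemma freq_pos K : (0 < K)%nat -> 0 < freq K.
Proof.
  intros H. unfold freq. apply lt_INR in H. simpl in H. generalize PI_RGT_0. intros. nra.
Qed.

Lemma freq_inj K K' : freq K = freq K' -> K = K'.
Proof.
  unfold freq. intros H. apply INR_eq. apply Rmult_eq_reg_l with (2 * PI); [exact H|].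
  generalize PI_RGT_0; lra.
Qed.

Lemma freq_large A : exists N, forall K, (N <= K)%nat -> A <= freq K.
Proof.
  destruct (INR_archimed 1 A) as [N HN]; [lra|].
  exists N. intros K HK. unfold freq. apply le_INR in HK.
  assert (H := PI2_1). generalize (pos_INR K). intros. nra.
Qed.

Lemma phase_free_extension k V th c x :
  0 < k -> c <= x <= c + 1 -> is_phase k V th ->
  (forall y, c <= y <= x -> V y = 0) -> th x = th c + k * (x - c).
Proof.
  intros Hk Hx Hth HV.
  rewrite (phase_unique k V (fun _ => 0) th (fun y => k * y + (th c - k * c)) c x 0); auto.
  - ring.
  - apply free_phase.
  - ring.
  - intros y _. rewrite Rabs_R0; lra.
Qed.

Section Construction.
Variable U0 : R -> R.
Variable M0 : R.
Hypothesis U0_smooth : smooth1 U0.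
Hypothesis U0_bound : forall x, Rabs (U0 x) <= M0.
Hypothesis U0_one : forall x, 1 / 4 <= x <= 1 / 2 -> U0 x = 1.

(** The factor U0 + W treats n frequencies and is still 1 on [node n, 1/2].
    Phases are needed only modulo pi at 1/2, whence the sine. *)
Definition stage (n : nat) (K : nat -> nat) (W : R -> R) : Prop :=
  smooth1 W /\ (exists M, forall x, Rabs (W x) <= M) /\
  (forall x, node n <= x <= 1 / 2 -> W x = 0) /\
  (forall j, (j < n)%nat -> (j < K j)%nat) /\
  (forall i j, (i < j < n)%nat -> (K i < K j)%nat) /\
  (forall j, (j < n)%nat -> exists th, is_phase (freq (K j)) (fun x => U0 x + W x - 1) th /\
     th 0 = 0 /\ sin (th (1 / 2)) = 0).

Definition refines (n : nat) (K K' : nat -> nat) (W W' : R -> R) : Prop :=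
  (forall j, (j < n)%nat -> K' j = K j) /\
  exists w, (forall x, W' x = W x + w x) /\ smooth1 w /\ even_periodic w /\
    norm_le n (1 / 8 * (1 / 2) ^ n) w /\ (forall x, 0 <= x <= node n -> w x = 0).

(** On [0, node n] nothing changes, on [node n, node (S n)] the phases follow
    the block perturbation, and on the rest of [0, 1/2] they are free. *)
Lemma stage_step n K W : stage n K W -> exists K' W', stage (S n) K' W' /\ refines n K K' W W'.
Proof.
  intros (HWs & [M HM] & HW0 & HK & HKm & Hph).
  set (V := fun x => U0 x + W x - 1).
  assert (HVs : smooth1 V).
  { apply (smooth1_plus (fun x => U0 x + W x) (fun _ => - (1))); [|apply smooth1_const].
    now apply smooth1_plus. }
  assert (HVb : forall x, Rabs (V x) <= M0 + M + 1).
  { intros x. unfold V. generalize (U0_bound x) (HM x).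
    unfold Rabs; repeat destruct Rcase_abs; lra. }
  assert (HV0 : forall x, node n <= x <= 1 / 2 -> V x = 0).
  { intros x Hx. unfold V. rewrite HW0, U0_one by (generalize (node_bounds n); lra). ring. }
  assert (Hph' : forall j, exists th, (j < n)%nat ->
    is_phase (freq (K j)) V th /\ th 0 = 0 /\ sin (th (1 / 2)) = 0).
  { intros j. destruct (lt_dec j n) as [Hj|Hj].
    - destruct (Hph j Hj) as [th Hth]. exists th; auto.
    - exists (fun _ => 0). tauto. }
  destruct (choose_fun _ _ _ Hph') as [th Hth].
  assert (Hn := node_bounds n). assert (HSn := node_bounds (S n)). assert (Hlt := node_lt n).
  assert (Hfp : forall j, (j < n)%nat -> 0 < freq (K j)).
  { intros j Hj. apply freq_pos. generalize (HK j Hj). lia. }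
  set (eps := 1 / 8 * (1 / 2) ^ n / 2).
  assert (Heps : 0 < eps).
  { unfold eps. assert (0 < (1 / 2) ^ n) by (apply pow_lt; lra). lra. }
  destruct (block_perturbation n (fun j => freq (K j)) (fun j => th j (node n) - freq (K j) * node n)
    (node n) (node (S n)) eps n) as [k0 Hblock]; auto.
  { lra. }
  { intros i j Hi Hj Hij E. apply freq_inj in E.
    destruct (Nat.lt_total i j) as [L|[L|L]]; [|lia|].
    - generalize (HKm i j); lia.
    - generalize (HKm j i); lia. }
  destruct (freq_large k0) as [N HN].
  set (Kn := (N + n + 1 + K (n - 1))%nat).
  assert (HKn : 0 < freq Kn) by (apply freq_pos; unfold Kn; lia).
  destruct (phase_exists (freq Kn) (M0 + M + 1) 0 0 V) as [thn [Hthn Hthn0]]; auto.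
  { intros x; now apply smooth1_continuous. }
  destruct (Hblock (freq Kn) HKn (HN Kn ltac:(unfold Kn; lia)) (thn (node n))
    (- (freq Kn * (1 / 2 - node (S n))))) as (g & Hg & Hgs & Hgn & Hginv & (tg & Htg & Htga & Htgb)).
  assert (Hgc : forall x, continuous g x) by (intros; now apply smooth1_continuous).
  set (w := unfold_circle g).
  destruct (unfold_circle_spec g (node n) (node (S n)) n eps) as (Hw & Hwe & Hwn); auto; try lra.
  fold w in Hw, Hwe, Hwn.
  assert (Hwg : forall x, 0 <= x <= 1 / 2 -> w x = g x).
  { intros x Hx. apply unfold_circle_eq with (node n) (node (S n)); auto; lra. }
  assert (Hw0 : forall x, 0 <= x <= 1 / 2 -> x <= node n \/ node (S n) <= x -> w x = 0).
  { intros x Hx Hx'. rewrite Hwg by exact Hx. now apply supported_closed with (node n) (node (S n)). }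
  set (W' := fun x => W x + w x).
  set (V' := fun x => U0 x + W' x - 1).
  assert (HWs' : smooth1 W') by now apply smooth1_plus.
  assert (Hwb : forall x, Rabs (w x) <= eps + eps) by (intros x; apply (norm_le_0 n _ _ x Hwn)).
  assert (HWb : forall x, Rabs (W' x) <= M + (eps + eps)).
  { intros x. unfold W'. eapply Rle_trans; [apply Rabs_triang|]. generalize (HM x) (Hwb x); lra. }
  assert (HV's : smooth1 V').
  { apply (smooth1_plus (fun x => U0 x + W' x) (fun _ => - (1))); [|apply smooth1_const].
    now apply smooth1_plus. }
  assert (HV'b : forall x, Rabs (V' x) <= M0 + (M + (eps + eps)) + 1).
  { intros x. unfold V'. generalize (U0_bound x) (HWb x).
    unfold Rabs; repeat destruct Rcase_abs; lra. }
  assert (E1 : forall x, 0 <= x <= node n -> V' x = V x).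
  { intros x Hx. unfold V', W', V. rewrite Hw0 by lra. ring. }
  assert (E2 : forall x, node n <= x <= node (S n) -> V' x = g x).
  { intros x Hx. unfold V', W'. rewrite <- Hwg by lra. generalize (HV0 x ltac:(lra)). unfold V. lra. }
  assert (E3 : forall x, node (S n) <= x <= 1 / 2 -> V' x = 0).
  { intros x Hx. unfold V', W'. rewrite Hw0 by lra. generalize (HV0 x ltac:(lra)). unfold V. lra. }
  (* a phase of the new coefficient, read off on the three intervals *)
  assert (T : forall k t t' tt, 0 < k -> is_phase k V t -> t 0 = 0 -> is_phase k V' t' -> t' 0 = 0 ->
     is_phase k g tt -> tt (node n) = t (node n) ->
     t' (1 / 2) = tt (node (S n)) + k * (1 / 2 - node (S n))).
  { intros k t t' tt Hk Ht Ht0 Ht' Ht0' Htt Htta.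
    assert (A1 : t' (node n) = t (node n)).
    { apply (phase_unique k V' V t' t 0 (node n) (M0 + M + 1)); auto; lra. }
    assert (A2 : t' (node (S n)) = tt (node (S n))).
    { apply (phase_unique k V' g t' tt (node n) (node (S n)) (M0 + (M + (eps + eps)) + 1)); auto; try lra.
      intros x Hx. rewrite <- E2 by exact Hx. apply HV'b. }
    rewrite <- A2. apply phase_free_extension with V'; auto; lra. }
  set (K' := fun j => if Nat.eq_dec j n then Kn else K j).
  assert (HK'n : K' n = Kn) by (unfold K'; destruct (Nat.eq_dec n n); [reflexivity|lia]).
  assert (HK'j : forall j, (j < n)%nat -> K' j = K j).
  { intros j Hj. unfold K'. destruct (Nat.eq_dec j n); [lia|reflexivity]. }
  assert (HKmax : forall j, (j < n)%nat -> (K j <= K (n - 1))%nat).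
  { intros j Hj. destruct (Nat.eq_dec j (n - 1)) as [->|E]; [lia|].
    generalize (HKm j (n - 1)%nat). lia. }
  exists K', W'. split.
  - split; [exact HWs'|]. split; [eexists; exact HWb|]. split; [|split; [|split]].
    + intros x Hx. unfold W'. rewrite HW0, Hw0 by lra. ring.
    + intros j Hj. destruct (Nat.eq_dec j n) as [->|E].
      * rewrite HK'n. unfold Kn. lia.
      * rewrite HK'j by lia. apply HK; lia.
    + intros i j Hij. rewrite (HK'j i) by lia. destruct (Nat.eq_dec j n) as [->|E].
      * rewrite HK'n. generalize (HKmax i ltac:(lia)). unfold Kn. lia.
      * rewrite HK'j by lia. apply HKm; lia.
    + intros j Hj.
      destruct (phase_exists (freq (K' j)) (M0 + (M + (eps + eps)) + 1) 0 0 V') as [t' [Ht' Ht0']]; auto.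
      { intros x; now apply smooth1_continuous. }
      exists t'. split; [exact Ht'|]. split; [exact Ht0'|].
      destruct (Nat.eq_dec j n) as [->|E].
      * rewrite HK'n in *. rewrite (T (freq Kn) thn t' tg); auto.
        replace (tg (node (S n)) + freq Kn * (1 / 2 - node (S n))) with
          (tg (node (S n)) - - (freq Kn * (1 / 2 - node (S n)))) by ring. exact Htgb.
      * rewrite HK'j in Ht' by lia.
        destruct (Hth j ltac:(lia)) as (Pj & Pj0 & Pjs).
        destruct (phase_exists (freq (K j)) eps (node n) (th j (node n)) g) as [tt [Htt Htta]]; auto.
        { intros x. apply (norm_le_0 n _ _ x Hgn). }
        rewrite (T (freq (K j)) (th j) t' tt) by (auto; apply Hfp; lia).
        rewrite (Hginv j tt) by (auto; lia || (rewrite Htta; ring)).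
        rewrite (phase_free_extension (freq (K j)) V (th j) (node n) (1 / 2)) in Pjs
          by (auto; try lra; apply Hfp; lia).
        rewrite <- Pjs. f_equal. ring.
  - split; [exact HK'j|]. exists w. split; [reflexivity|]. split; [exact Hw|]. split; [exact Hwe|].
    split; [|intros x Hx; apply Hw0; lra].
    replace (1 / 8 * (1 / 2) ^ n) with (eps + eps) by (unfold eps; field). exact Hwn.
Qed.

Lemma stages_exist : exists (K : nat -> nat -> nat) (W : nat -> R -> R),
  (forall x, W 0%nat x = 0) /\
  forall n, stage n (K n) (W n) /\ refines n (K n) (K (S n)) (W n) (W (S n)).
Proof.
  assert (H0 : stage 0 (fun _ => 0%nat) (fun _ => 0)).
  { split; [apply smooth1_const|]. split; [exists 0; intros; rewrite Rabs_R0; lra|].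
    split; [reflexivity|]. split; [|split]; intros; lia. }
  assert (Hstep : forall z : nat * ((nat -> nat) * (R -> R)), exists z' : (nat -> nat) * (R -> R),
    stage (fst z) (fst (snd z)) (snd (snd z)) ->
    stage (S (fst z)) (fst z') (snd z') /\ refines (fst z) (fst (snd z)) (fst z') (snd (snd z)) (snd z')).
  { intros [n [K W]]. simpl. destruct (classic (stage n K W)) as [H|H].
    - destruct (stage_step n K W H) as (K' & W' & H'). exists (K', W'). auto.
    - exists (K, W). tauto. }
  destruct (choose_fun _ _ _ Hstep) as [F HF].
  set (s := nat_rect (fun _ => ((nat -> nat) * (R -> R))%type) (fun _ => 0%nat, fun _ => 0) (fun n z => F (n, z))).
  assert (HS : forall n, stage n (fst (s n)) (snd (s n))).
  { induction n as [|n IH]; [exact H0|]. apply (HF (n, s n)). exact IH. }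
  exists (fun n => fst (s n)), (fun n => snd (s n)). split; [reflexivity|].
  intros n. split; [apply HS|]. apply (HF (n, s n)). apply HS.
Qed.

(** For a fixed frequency, the limit phase at node n, continued freely to 1/2, is
    the phase of stage n at 1/2, hence a multiple of pi.  The nodes tend to 1/2. *)
Lemma construction : exists (U : R -> R) (K : nat -> nat) (w : R -> R),
  (forall x, U x = U0 x + w x) /\ smooth1 w /\ even_periodic w /\
  (forall x, Rabs (w x) <= 1 / 4) /\ (forall x, 0 <= x <= 1 / 4 -> w x = 0) /\
  (forall j, (j < K j)%nat) /\
  (forall j, exists th, is_phase (freq (K j)) (fun x => U x - 1) th /\ th 0 = 0 /\ sin (th (1 / 2)) = 0).
Proof.
  destruct stages_exist as (K & W & HW0 & HS).
  destruct (choose_fun _ _ _ (fun n => proj2 (proj2 (HS n)))) as [w Hw].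
  set (u := fun x => Series (fun n => w n x)).
  assert (Hwb : forall n x, Rabs (w n x) <= 1 / 8 * (1 / 2) ^ n).
  { intros n x. apply (norm_le_0 n). apply Hw. }
  assert (Hub : forall x, Rabs (u x) <= 1 / 4).
  { intros x. replace (1 / 4) with (2 * (1 / 8)) by field. now apply Series_half_bound. }
  assert (Hus : smooth1 u).
  { apply Series_smooth with (1 / 8); intros n; apply Hw. }
  assert (Hsum : forall x N, sum_n (fun n => w n x) N = W (S N) x).
  { intros x N. rewrite sum_n_Reals. induction N as [|N IH].
    - simpl. destruct (Hw 0%nat) as [E _]. rewrite E, HW0. ring.
    - rewrite tech5, IH. destruct (Hw (S N)) as [E _]. now rewrite E. }
  assert (Hstab : forall n p x, 0 <= x <= node n -> W (p + n)%nat x = W n x).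
  { intros n p x Hx. induction p as [|p IH]; [reflexivity|].
    simpl. destruct (Hw (p + n)%nat) as (E & _ & _ & _ & Z). rewrite E, IH, Z; [ring|].
    generalize (node_le n (p + n) ltac:(lia)). lra. }
  assert (Hu : forall n x, 0 <= x <= node n -> u x = W n x).
  { intros n x Hx. apply is_series_unique.
    apply (is_lim_seq_ext_loc (fun _ => W n x) _ (W n x)); [|apply is_lim_seq_const].
    exists n. intros N HN. rewrite Hsum. replace (S N) with ((S N - n) + n)%nat by lia.
    symmetry. now apply Hstab. }
  assert (HKst : forall j p, K (p + S j)%nat j = K (S j) j).
  { intros j p. induction p as [|p IH]; [reflexivity|]. simpl.
    rewrite (proj1 (proj2 (HS (p + S j)%nat))) by lia. exact IH. }
  assert (HKpos : forall j, (j < K (S j) j)%nat).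
  { intros j. destruct (HS (S j)) as [(_ & _ & _ & H & _) _]. apply H; lia. }
  exists (fun x => U0 x + u x), (fun j => K (S j) j), u.
  split; [reflexivity|]. split; [exact Hus|]. split.
  { split; intros x; unfold u; apply Series_ext; intros n; destruct (Hw n) as (_ & _ & [E1 E2] & _); auto. }
  split; [exact Hub|]. split.
  { intros x Hx. rewrite (Hu 0%nat); [apply HW0|]. unfold node. simpl. lra. }
  split; [exact HKpos|].
  intros j. set (k := freq (K (S j) j)).
  assert (Hk : 0 < k) by (apply freq_pos; generalize (HKpos j); lia).
  set (V := fun x => U0 x + u x - 1).
  assert (HVs : smooth1 V).
  { apply (smooth1_plus (fun x => U0 x + u x) (fun _ => - (1))); [|apply smooth1_const].
    now apply smooth1_plus. }
  assert (HVb : forall x, Rabs (V x) <= M0 + 1 / 4 + 1).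
  { intros x. unfold V. generalize (U0_bound x) (Hub x).
    unfold Rabs; repeat destruct Rcase_abs; lra. }
  destruct (phase_exists k (M0 + 1 / 4 + 1) 0 0 V) as [th [Hth Hth0]]; auto.
  { intros x; now apply smooth1_continuous. }
  exists th. split; [exact Hth|]. split; [exact Hth0|].
  assert (Hz : forall p, sin (th (node (p + S j)) + k * (1 / 2 - node (p + S j))) = 0).
  { intros p. set (n := (p + S j)%nat).
    assert (Hn := node_bounds n).
    destruct (HS n) as [(_ & [M HM] & HWz & _ & _ & Hph) _].
    destruct (Hph j ltac:(unfold n; lia)) as (t & Ht & Ht0 & Hts).
    unfold n in Ht at 1. rewrite HKst in Ht. fold k in Ht.
    set (Vn := fun x => U0 x + W n x - 1) in Ht.
    assert (A : th (node n) = t (node n)).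
    { apply (phase_unique k V Vn th t 0 (node n) (M0 + M + 1)); auto; try lra.
      - intros x Hx. unfold V, Vn. rewrite (Hu n) by exact Hx. reflexivity.
      - intros x _. unfold Vn. generalize (U0_bound x) (HM x).
        unfold Rabs; repeat destruct Rcase_abs; lra. }
    rewrite A, <- (phase_free_extension k Vn t (node n) (1 / 2)); auto; try lra.
    intros y Hy. unfold Vn. rewrite HWz, U0_one by lra. ring. }
  set (s := fun x => sin (th x + k * (1 / 2 - x))).
  assert (Cs : continuous s (1 / 2)).
  { apply (ex_derive_continuous s). unfold s. generalize (Hth (1 / 2)). intros D. auto_derive.
    eexists; exact D. }
  assert (Lnode : is_lim_seq (fun p => node (p + S j)) (1 / 2)).
  { apply (is_lim_seq_ext (fun p => 1 / 2 - (1 / 2) ^ (p + (S j + 2))) _ (1 / 2)).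
    - intros p. unfold node. do 2 f_equal. lia.
    - replace (Finite (1 / 2)) with (Finite (1 / 2 - 0)) by (f_equal; ring).
      apply is_lim_seq_minus'; [apply is_lim_seq_const|].
      apply (is_lim_seq_incr_n (fun p => (1 / 2) ^ p) (S j + 2) 0).
      apply is_lim_seq_geom. rewrite Rabs_right; lra. }
  assert (L : is_lim_seq (fun p => s (node (p + S j))) (s (1 / 2))).
  { apply (is_lim_seq_continuous s _ (1 / 2)); [|exact Lnode].
    now apply continuity_pt_filterlim. }
  assert (L0 : is_lim_seq (fun p => s (node (p + S j))) 0).
  { apply is_lim_seq_ext with (fun _ => 0); [|apply is_lim_seq_const]. intros p. symmetry; apply Hz. }
  assert (E := is_lim_seq_eq _ _ _ L L0). unfold s in E.
  now rewrite Rminus_diag, Rmult_0_r, Rplus_0_r in E.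
Qed.

End Construction.

(** * The metric, its eigenfunctions and their critical points *)

Lemma smooth_product a b : smooth1 a -> smooth1 b -> smooth (fun x y => a x * b y).
Proof.
  intros Ha Hb n x y.
  assert (C : forall a b, smooth1 a -> smooth1 b -> continuity_2d_pt (fun x y => a x * b y) x y).
  { clear. intros a b Ha Hb. apply continuity_2d_pt_mult.
    - apply continuity_1d_2d_pt_comp with (f := a) (g := fun u v => u).
      + apply continuity_pt_filterlim. now apply smooth1_continuous.
      + apply continuity_2d_pt_id1.
    - apply continuity_1d_2d_pt_comp with (f := b) (g := fun u v => v).
      + apply continuity_pt_filterlim. now apply smooth1_continuous.
      + apply continuity_2d_pt_id2. }
  revert a b Ha Hb. induction n as [|n IH]; intros a b Ha Hb.
  - split; [now apply C|exact I].
  - assert (D1 : forall x y, is_derive (fun z => a z * b y) x (Derive a x * b y)).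
    { intros u v. evar_last.
      - apply (is_derive_scal_l a u (Derive a u) (b v)). now apply smooth1_derive.
      - reflexivity. }
    assert (D2 : forall x y, is_derive (fun z => a x * b z) y (a x * Derive b y)).
    { intros u v. apply (is_derive_scal b v (a u)). now apply smooth1_derive. }
    split; [now apply C|]. split; [|split; [|split]].
    + eexists; apply D1.
    + eexists; apply D2.
    + replace (fun u v => Derive (fun z => a z * b v) u) with (fun u v => Derive a u * b v).
      * apply IH; [now apply smooth1_Derive|exact Hb].
      * apply functional_extensionality; intros u. apply functional_extensionality; intros v.
        symmetry. apply is_derive_unique, D1.
    + replace (fun u v => Derive (fun z => a u * b z) v) with (fun u v => a u * Derive b v).
      * apply IH; [exact Ha|now apply smooth1_Derive].
      * apply functional_extensionality; intros u. apply functional_extensionality; intros v.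
        symmetry. apply is_derive_unique, D2.
Qed.

Lemma conformal_metric (Q : R -> R) :
  smooth1 Q -> (forall x, Q (x + 1) = Q x) -> (forall x, 0 < Q x) ->
  exists g : torus_metric, forall x y, g11 g x y = Q x /\ g12 g x y = 0 /\ g22 g x y = Q x.
Proof.
  intros HQ Hp Hpos.
  assert (S1 : smooth_on_torus (fun x _ => Q x)).
  { split; [|intros x y; split; [apply Hp|reflexivity]].
    replace (fun x (_ : R) => Q x) with (fun x (y : R) => Q x * 1).
    - apply (smooth_product Q (fun _ => 1)); [exact HQ|apply smooth1_const].
    - do 2 (apply functional_extensionality; intro). ring. }
  assert (S2 : smooth_on_torus (fun _ _ => 0)).
  { split; [|intros x y; split; reflexivity].
    replace (fun _ _ : R => 0) with (fun (x y : R) => 0 * 0).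
    - apply (smooth_product (fun _ => 0) (fun _ => 0)); apply smooth1_const.
    - do 2 (apply functional_extensionality; intro). ring. }
  assert (Pd : forall x y u v : R, (u, v) <> (0, 0) ->
    0 < Q x * u ^ 2 + 2 * 0 * u * v + Q x * v ^ 2).
  { intros x y u v Huv. replace (Q x * u ^ 2 + 2 * 0 * u * v + Q x * v ^ 2) with (Q x * (u ^ 2 + v ^ 2)) by ring.
    apply Rmult_lt_0_compat; [apply Hpos|].
    destruct (Req_dec u 0) as [->|Hu].
    - assert (v <> 0) by (intros ->; now apply Huv). assert (0 < v ^ 2) by now apply pow2_gt_0. nra.
    - assert (0 < u ^ 2) by now apply pow2_gt_0. generalize (pow2_ge_0 v). lra. }
  exists (Build_torus_metric (fun x _ => Q x) (fun _ _ => 0) (fun x _ => Q x) S1 S2 S1 Pd).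
  intros x y. repeat split.
Qed.

(** In dimension two sqrt(det g) g^ij does not change under a conformal
    change of metric; only the factor 1 / sqrt(det g) remains. *)
Lemma laplace_conformal g (Q : R -> R) (phi : R -> R -> R) x y :
  (forall x, 0 < Q x) ->
  (forall x y, g11 g x y = Q x /\ g12 g x y = 0 /\ g22 g x y = Q x) ->
  laplace_beltrami g phi x y = / Q x * (d1 (d1 phi) x y + d2 (d2 phi) x y).
Proof.
  intros Hpos Hg.
  assert (Hdet : forall s t, det_g g s t = Q s * Q s).
  { intros s t. unfold det_g. destruct (Hg s t) as (-> & -> & ->). ring. }
  assert (Hsq : forall s t, sqrt (det_g g s t) = Q s).
  { intros s t. rewrite Hdet. apply sqrt_square. left; apply Hpos. }
  unfold laplace_beltrami. rewrite Hsq.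
  replace (fun s t => sqrt (det_g g s t) * grad1 g phi s t) with (d1 phi).
  2:{ apply functional_extensionality; intros s. apply functional_extensionality; intros t.
      rewrite Hsq. unfold grad1. rewrite Hdet. destruct (Hg s t) as (_ & -> & ->).
      generalize (Hpos s). intros. field. lra. }
  replace (fun s t => sqrt (det_g g s t) * grad2 g phi s t) with (d2 phi).
  2:{ apply functional_extensionality; intros s. apply functional_extensionality; intros t.
      rewrite Hsq. unfold grad2. rewrite Hdet. destruct (Hg s t) as (-> & -> & _).
      generalize (Hpos s). intros. field. lra. }
  reflexivity.
Qed.

Lemma d1_product (a b : R -> R) x y : smooth1 a -> d1 (fun x y => a x * b y) x y = Derive a x * b y.
Proof.
  intros Ha. unfold d1. apply is_derive_unique.
  apply (is_derive_scal_l a x (Derive a x) (b y)). now apply smooth1_derive.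
Qed.

Lemma d2_product (a b : R -> R) x y : smooth1 b -> d2 (fun x y => a x * b y) x y = a x * Derive b y.
Proof.
  intros Hb. unfold d2. apply is_derive_unique.
  apply (is_derive_scal b y (a x)). now apply smooth1_derive.
Qed.

Lemma Derive_cos_freq k : Derive (fun y => cos (k * y)) = fun y => - k * sin (k * y).
Proof. apply Derive_fun. intros y. auto_derive; [exact I|ring]. Qed.

Lemma smooth1_cos0 k : smooth1 (fun y => cos (k * y)).
Proof.
  apply smooth1_ext with (fun y => cos (k * y + 0)); [intros; f_equal; ring|]. apply smooth1_cos.
Qed.

Lemma separated_eigenfunction g (U f : R -> R) (K : nat) :
  let Q := fun x => 1 + U x in
  (forall x, 0 < Q x) ->
  (forall x y, g11 g x y = Q x /\ g12 g x y = 0 /\ g22 g x y = Q x) ->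
  smooth1 f -> (forall x, f (x + 1) = f x) -> f 0 = 1 ->
  (forall x, is_derive (Derive f) x (- freq K ^ 2 * U x * f x)) ->
  eigenfunction g (freq K ^ 2) (fun x y => f x * cos (freq K * y)).
Proof.
  intros Q HQ Hg Hf Hper H0 Hode.
  split; [|split; [|split]].
  - split; [apply (smooth_product f (fun y => cos (freq K * y))); [exact Hf|apply smooth1_cos0]|].
    intros x y. rewrite Hper. split; [reflexivity|]. f_equal.
    unfold freq. replace (2 * PI * INR K * (y + 1)) with (2 * PI * INR K * y + 2 * INR K * PI) by ring.
    apply cos_period.
  - exists 0, 0. rewrite H0, Rmult_0_r, cos_0. lra.
  - apply pow2_ge_0.
  - intros x y. rewrite (laplace_conformal g Q) by auto.
    replace (d1 (fun x y => f x * cos (freq K * y))) with (fun x y => Derive f x * cos (freq K * y)).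
    2:{ do 2 (apply functional_extensionality; intro). symmetry.
        now apply (d1_product f (fun y => cos (freq K * y))). }
    replace (d2 (fun x y => f x * cos (freq K * y))) with (fun x y => f x * (- freq K * sin (freq K * y))).
    2:{ do 2 (apply functional_extensionality; intro). symmetry.
        rewrite (d2_product f (fun y => cos (freq K * y))) by apply smooth1_cos0.
        now rewrite Derive_cos_freq. }
    rewrite (d1_product (Derive f) (fun y => cos (freq K * y))) by now apply smooth1_Derive.
    rewrite (is_derive_unique _ _ _ (Hode x)).
    assert (D : d2 (fun x y => f x * (- freq K * sin (freq K * y))) x y =
      f x * (- freq K * (freq K * cos (freq K * y)))).
    { unfold d2. apply is_derive_unique. auto_derive; [exact I|ring]. }
    rewrite D. unfold Q. generalize (HQ x). unfold Q. intros. field. lra.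
Qed.

(** Near (x, 0) both f(u) and cos(k v) are nonzero, so that the two equations
    decouple into f'(u) = 0 and sin(k v) = 0, each with a simple zero. *)
Lemma separated_isolated f k (x l : R) :
  0 < k -> smooth1 f -> Derive f x = 0 -> f x <> 0 ->
  is_derive (Derive f) x l -> l <> 0 ->
  isolated_critical_point (fun x y => f x * cos (k * y)) (x, 0).
Proof.
  intros Hk Hf Hx Hfx Hd Hl.
  assert (D1 : forall u v, d1 (fun x y => f x * cos (k * y)) u v = Derive f u * cos (k * v)).
  { intros u v. now apply (d1_product f (fun y => cos (k * y))). }
  assert (D2 : forall u v, d2 (fun x y => f x * cos (k * y)) u v = f u * (- k * sin (k * v))).
  { intros u v. rewrite (d2_product f (fun y => cos (k * y))) by apply smooth1_cos0.
    now rewrite Derive_cos_freq. }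
  split.
  - split; simpl.
    + rewrite D1, Hx. ring.
    + rewrite D2, Rmult_0_r, sin_0. ring.
  - simpl.
    assert (L1 : locally x (fun u => (Derive f u = 0 -> u = x) /\ f u <> 0)).
    { apply filter_and; [now apply simple_zero_isolated with l|].
      apply (smooth1_continuous f x Hf (fun z => z <> 0)). now apply open_neq. }
    assert (L2 : locally 0 (fun v => (sin (k * v) = 0 -> v = 0) /\ cos (k * v) <> 0)).
    { apply filter_and.
      - apply simple_zero_isolated with k; [|lra|].
        + auto_derive; [exact I|]. rewrite Rmult_0_r, cos_0. ring.
        + rewrite Rmult_0_r, sin_0. reflexivity.
      - assert (C : continuous (fun v => cos (k * v)) 0) by (apply smooth1_continuous, smooth1_cos0).
        apply (C (fun z => z <> 0)). apply open_neq. rewrite Rmult_0_r, cos_0. lra. }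
    destruct L1 as [e1 He1]. destruct L2 as [e2 He2].
    exists (mkposreal _ (Rmin_stable_in_posreal e1 e2)). simpl. intros u v Hu Hv [C1 C2].
    simpl in C1, C2. rewrite D1 in C1. rewrite D2 in C2.
    destruct (He1 u) as [A1 A2]; [exact (Rlt_le_trans _ _ _ Hu (Rmin_l _ _))|].
    destruct (He2 v) as [B1 B2]; [exact (Rlt_le_trans _ _ _ Hv (Rmin_r _ _))|].
    assert (u = x) by (apply A1; apply Rmult_integral in C1; tauto).
    assert (v = 0).
    { apply B1. apply Rmult_integral in C2. destruct C2 as [C2|C2]; [contradiction|].
      apply Rmult_integral in C2. destruct C2; [lra|auto]. }
    exists 0%Z, 0%Z. simpl. subst. split; ring.
Qed.

(** Each point of the list coincides modulo Z^2 with at most one (x m, 0),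
    because the x m are distinct and lie in (0, 1/8). *)
Lemma infinite_of_sequence (A : R * R -> Prop) (m0 : nat) (x : nat -> R) :
  (forall m, (m0 <= m)%nat -> lft m < x m < rgt m /\ A (x m, 0)) -> infinite_on_torus A.
Proof.
  intros H l.
  assert (X : exists M, forall m, (M <= m)%nat -> (m0 <= m)%nat ->
     forall q, In q l -> ~ same_point q (x m, 0)).
  { induction l as [|q l [M IH]].
    - exists 0%nat. intros m _ _ q [].
    - assert (Hq : exists M', forall m, (M' <= m)%nat -> (m0 <= m)%nat -> ~ same_point q (x m, 0)).
      { destruct (classic (exists m, (m0 <= m)%nat /\ same_point q (x m, 0))) as [[m [Hm Hs]]|N].
        - exists (S m). intros m' Hm' Hm0 Hs'.
          destruct Hs as (i & _ & E & _). destruct Hs' as (i' & _ & E' & _). simpl in E, E'.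
          destruct (H m Hm) as [B _]. destruct (H m' Hm0) as [B' _].
          generalize (lft_rgt m) (lft_rgt m') (rgt_le m) (rgt_le m') (rgt_lft m m' ltac:(lia)). intros.
          assert (Z1 : IZR (i - i') < 1) by (rewrite minus_IZR; lra).
          assert (Z2 : 0 < IZR (i - i')) by (rewrite minus_IZR; lra).
          apply lt_IZR in Z1. apply lt_IZR in Z2. lia.
        - exists 0%nat. intros m _ Hm Hs. apply N. eauto. }
      destruct Hq as [M' HM']. exists (Nat.max M M'). intros m Hm Hm0 q' [<-|Hq'].
      + apply HM'; lia.
      + apply IH; auto; lia. }
  destruct X as [M HM].
  exists (x (Nat.max M m0), 0). split; [apply H; lia|].
  intros q Hq. apply HM; auto; lia.
Qed.

Theorem theorem1 :
  exists (g : torus_metric) (phi : nat -> R -> R -> R) (lam : nat -> R),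
    (forall i : nat, eigenfunction g (lam i) (phi i)) /\
    is_lim_seq lam p_infty /\
    (forall i : nat, infinite_on_torus (isolated_critical_point (phi i))).
Proof.
  destruct plateau_exists as (P & HP & HPe & HPb & HP0 & HP1).
  destruct oscillation_exists as (O & eps & HO & HOe & HOb & HO0 & Heps & HOJ & HOdec & HOsm).
  destruct (construction (fun x => P x + O x) (5 / 4)) as (U & K & w & HU & Hw & Hwe & Hwb & Hw0 & HK & Hph).
  { now apply smooth1_plus. }
  { intros x. eapply Rle_trans; [apply Rabs_triang|].
    generalize (HPb x) (HOb x). intros. rewrite (Rabs_right (P x)); lra. }
  { intros x Hx. rewrite HP1, HO0 by lra. ring. }
  assert (HUs : smooth1 U).
  { apply smooth1_ext with (fun x => P x + O x + w x); [intros; symmetry; apply HU|].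
    apply smooth1_plus; [now apply smooth1_plus|exact Hw]. }
  assert (HUeven : forall x, U (- x) = U x).
  { intros x. rewrite !HU. now rewrite (proj1 HPe), (proj1 HOe), (proj1 Hwe). }
  assert (HUper : forall x, U (x + 1) = U x).
  { intros x. rewrite !HU. now rewrite (proj2 HPe), (proj2 HOe), (proj2 Hwe). }
  assert (HUb : forall x, - (1 / 2) <= U x <= 3 / 2).
  { intros x. rewrite HU. generalize (HPb x) (HOb x) (Hwb x). intros H1 H2 H3.
    apply Rabs_le_between in H2. apply Rabs_le_between in H3. lra. }
  assert (HUO : forall x, 0 <= x <= 1 / 8 -> U x = O x).
  { intros x Hx. rewrite HU, HP0, Hw0 by lra. ring. }
  destruct (conformal_metric (fun x => 1 + U x)) as [g Hg].
  { apply smooth1_plus; [apply smooth1_const|exact HUs]. }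
  { intros x. now rewrite HUper. }
  { intros x. generalize (HUb x). lra. }
  assert (Hsol : forall i, exists f, smooth1 f /\ f 0 = 1 /\ Derive f 0 = 0 /\
    (forall x, is_derive (Derive f) x (- freq (K i) ^ 2 * U x * f x)) /\ (forall x, f (x + 1) = f x)).
  { intros i. destruct (Hph i) as (th & Hth & Hth0 & Hths).
    destruct (solution_of_phase U (freq (K i)) th HUs Hth Hth0) as (f & Hf & F0 & F1 & F2 & F3).
    exists f. repeat (split; [assumption|]).
    assert (Hqb : forall x, Rabs (- freq (K i) ^ 2 * U x) <= freq (K i) ^ 2 * (3 / 2)).
    { intros x. rewrite Rabs_mult, Rabs_Ropp, Rabs_right by (apply Rle_ge, pow2_ge_0).
      apply Rmult_le_compat_l; [apply pow2_ge_0|]. apply Rabs_le. generalize (HUb x); lra. }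
    assert (E0 : forall x, f (2 * 0 - x) = f x).
    { apply solution_reflect with (fun x => - freq (K i) ^ 2 * U x) (freq (K i) ^ 2 * (3 / 2)); auto.
      intros x. replace (2 * 0 - x) with (- x) by ring. now rewrite HUeven. }
    assert (E1 : forall x, f (2 * (1 / 2) - x) = f x).
    { apply solution_reflect with (fun x => - freq (K i) ^ 2 * U x) (freq (K i) ^ 2 * (3 / 2)); auto.
      intros x. replace (2 * (1 / 2) - x) with (- x + 1) by field. now rewrite HUper, HUeven. }
    intros x. rewrite <- (E0 x), <- (E1 (2 * 0 - x)). f_equal. field. }
  destruct (choose_fun _ _ _ Hsol) as [f Hf].
  assert (Hkp : forall i, 0 < freq (K i)) by (intros i; apply freq_pos; generalize (HK i); lia).
  exists g, (fun i x y => f i x * cos (freq (K i) * y)), (fun i => freq (K i) ^ 2).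
  split; [|split].
  - intros i. destruct (Hf i) as (F & F0 & _ & F2 & F3).
    apply separated_eigenfunction with U; auto.
    intros x. generalize (HUb x). lra.
  - apply (is_lim_seq_le_p_loc INR); [|apply is_lim_seq_INR].
    exists 0%nat. intros i _.
    assert (A : INR (S i) <= INR (K i)) by (apply le_INR; generalize (HK i); lia).
    rewrite S_INR in A. generalize (pos_INR i) PI2_1. intros B C. unfold freq.
    assert (INR i + 1 <= 2 * PI * INR (K i)) by nra. nra.
  - intros i. destruct (Hf i) as (F & F0 & F1 & F2 & F3).
    destruct (derivative_zeros U (f i) eps (freq (K i))) as [m0 Hm0]; auto.
    { intros m x Hx. rewrite HUO; [now apply HOJ|].
      generalize (lft_rgt m) (rgt_le m); lra. }
    { intros m x Hx. rewrite HUO; [now apply HOsm|].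
      generalize (lft_rgt m) (rgt_le m); lra. }
    assert (Hx : forall m, exists x, (m0 <= m)%nat ->
      lft m < x < rgt m /\ Derive (f i) x = 0 /\ U x <> 0 /\ f i x <> 0).
    { intros m. destruct (le_lt_dec m0 m) as [L|L].
      - destruct (Hm0 m L) as [x Hx]. exists x; auto.
      - exists 0. lia. }
    destruct (choose_fun _ _ _ Hx) as [x Hx'].
    apply infinite_of_sequence with m0 x. intros m Hm.
    destruct (Hx' m Hm) as (B & Z & HUx & Hfx). split; [exact B|].
    apply separated_isolated with (- freq (K i) ^ 2 * U (x m) * f i (x m)); auto.
    assert (0 < freq (K i) ^ 2) by (apply pow_lt; auto).
    apply Rmult_integral_contrapositive_currified; [|exact Hfx].
    apply Rmult_integral_contrapositive_currified; [lra|exact HUx].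
Qed.
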